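(* Let $(M^n,g)$, $n\ge3$, be Einstein with $\mathrm{Ric}(g)=\lambda(n-1)g$, and let $\widehat g=e^{2\omega}g$, $\omega\in C^\infty(M)$, be a conformally related Einstein metric with $\mathrm{Ric}(\widehat g)=\widehat\lambda(n-1)\widehat g$. Suppose $\Sigma\subset M$ is a submanifold (of dimension $k$, $1\le k\le n-1$) which is minimal relative to both $g$ and $\widehat g$. Let $$g_+=r^{-2}\big(dr^2+(1-\tfrac14\lambda r^2)^2g\big),\qquad \widehat g_+=r^{-2}\big(dr^2+(1-\tfrac14\widehat\lambda r^2)^2\widehat g\big)$$ be the canonical Poincaré metrics on $M\times(0,\epsilon_0)_r$. Then the diffeomorphism that pulls back $\widehat g_+$ to $g_+$ (to infinite order at $r=0$) and restricts to the identity on $M\times\{0\}$ preserves $\Sigma\times[0,\epsilon_0)$ to infinite order.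
   Context: It is known that there is a diffeomorphism between neighborhoods of $M=M\times\{0\}$ in $X=M\times[0,\epsilon_0)$, restricting to the identity on $M$, which pulls back $\widehat g_+$ to $g_+$ to infinite order at $r=0$; it is unique to infinite order at $r=0$. ''Preserves $\Sigma\times[0,\epsilon_0)$ to infinite order'' means that the image of $\Sigma\times[0,\epsilon_0)$ under the diffeomorphism agrees with $\Sigma\times[0,\epsilon_0)$ to infinite order along $\Sigma\times\{0\}$ (equivalently, writing the image near $\Sigma\times\{0\}$ as a graph over $\Sigma\times[0,\epsilon_0)$ in coordinates $(x,u,r)$ with $\Sigma=\{u=0\}\subset M$, the graphing function vanishes to infinite order at $r=0$). Minimal means vanishing mean curvature vector; submanifolds are embedded. *)

(* Defs.v *)
From HB Require Import structures.
From mathcomp Require Import all_boot all_order all_algebra.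
From mathcomp Require Import all_classical all_reals all_analysis.
Set Implicit Arguments.
Unset Strict Implicit.
Unset Printing Implicit Defensive.
Import Order.TTheory GRing.Theory Num.Theory numFieldNormedType.Exports.
Local Open Scope classical_set_scope.
Local Open Scope ring_scope.

(** ** Smooth functions on subsets of R^d *)

Definition pderiv (R : realType) (d : nat) (i : 'I_d) (f : 'rV[R]_d -> R) :
  'rV[R]_d -> R := fun x => 'D_(delta_mx 0 i) f x.

(* C^oo on the open set [O]: all iterated partial derivatives exist and are
   differentiable (hence continuous) on [O]. *)
Definition smooth_open (R : realType) (d : nat) (O : set 'rV[R]_d)
    (f : 'rV[R]_d -> R) : Prop :=
  forall (s : seq 'I_d) x, O x -> differentiable (foldr (@pderiv R d) f s) x.

(* C^oo on an arbitrary set: local smooth extendability.  For a relatively open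
   subset of R^n x [0, oo) this is smoothness up to the boundary. *)
Definition smooth_on (R : realType) (d : nat) (A : set 'rV[R]_d)
    (f : 'rV[R]_d -> R) : Prop :=
  forall x, A x -> exists (O : set 'rV[R]_d) (F : 'rV[R]_d -> R),
    [/\ open O, O x, smooth_open O F & forall y, A y -> O y -> f y = F y].

Definition smooth_map_on (R : realType) (d e : nat) (A : set 'rV[R]_d)
    (f : 'rV[R]_d -> 'rV[R]_e) : Prop :=
  forall j : 'I_e, smooth_on A (fun x => f x 0 j).

(** ** Smooth manifolds *)

(* The values of [cmap] off [cdom] and of [cinv] off [crange] are irrelevant. *)
Record chart (R : realType) (n : nat) (T : topologicalType) := Chart {
  cdom : set T ;
  cmap :> T -> 'rV[R]_n ;
  cinv : 'rV[R]_n -> T ;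
  cdom_open : open cdom ;
  crange_open : open (cmap @` cdom) ;
  cmapK : forall p, cdom p -> cinv (cmap p) = p ;
  cmap_continuous : {within cdom, continuous cmap} ;
  cinv_continuous : {within cmap @` cdom, continuous cinv} }.

Definition crange (R : realType) (n : nat) (T : topologicalType)
  (c : chart R n T) : set 'rV[R]_n := c @` cdom c.

Definition transition (R : realType) (n : nat) (T : topologicalType)
  (c d : chart R n T) : 'rV[R]_n -> 'rV[R]_n := fun x => d (cinv c x).

Definition compatible (R : realType) (n : nat) (T : topologicalType)
    (c d : chart R n T) : Prop :=
  smooth_map_on (c @` (cdom c `&` cdom d)) (transition c d) /\
  smooth_map_on (d @` (cdom c `&` cdom d)) (transition d c).

(* A smooth n-manifold without boundary, with its maximal atlas. *)
Record manifold (R : realType) (n : nat) := Manifold {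
  mcarrier :> topologicalType ;
  atlas : set (chart R n mcarrier) ;
  m_hausdorff : hausdorff_space mcarrier ;
  m_second_countable : @second_countable mcarrier ;
  atlas_cover : forall p : mcarrier, exists2 c, atlas c & cdom c p ;
  atlas_compatible : forall c d, atlas c -> atlas d -> compatible c d ;
  atlas_maximal : forall c, (forall d, atlas d -> compatible c d) -> atlas c }.

Definition smooth_fun (R : realType) (n : nat) (M : manifold R n)
    (w : M -> R) : Prop :=
  forall c : chart R n M, atlas c -> smooth_on (crange c) (fun x => w (cinv c x)).

(** ** Riemannian metrics and curvature *)

(* A symmetric covariant 2-tensor is a family of component matrices, one for
   each chart.  [jacobian f x] has row i equal to the i-th partial derivative
   of [f], so the pullback of G by f has matrix J (G o f) J^T. *)
Definition pullback (R : realType) (d e : nat) (f : 'rV[R]_d -> 'rV[R]_e)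
    (G : 'rV[R]_e -> 'M[R]_e) (x : 'rV[R]_d) : 'M[R]_d :=
  jacobian f x *m G (f x) *m (jacobian f x)^T.

Record metric (R : realType) (n : nat) (M : manifold R n) := Metric {
  gcoef :> chart R n M -> 'rV[R]_n -> 'M[R]_n ;
  g_smooth : forall c : chart R n M, atlas c ->
    forall i j, smooth_on (crange c) (fun x => gcoef c x i j) ;
  g_sym : forall c : chart R n M, atlas c ->
    forall x, crange c x -> (gcoef c x)^T = gcoef c x ;
  g_pos : forall c : chart R n M, atlas c ->
    forall x, crange c x -> forall v : 'rV[R]_n, v != 0 ->
    0 < (v *m gcoef c x *m v^T) 0 0 ;
  g_change : forall c d : chart R n M, atlas c -> atlas d ->
    forall p, cdom c p -> cdom d p ->
    gcoef c (c p) = pullback (transition c d) (gcoef d) (c p) }.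

(* Gamma^l_{ij} *)
Definition christoffel (R : realType) (n : nat) (G : 'rV[R]_n -> 'M[R]_n)
    (l i j : 'I_n) (x : 'rV[R]_n) : R :=
  2^-1 * \sum_(p < n) invmx (G x) l p *
    (pderiv i (fun y => G y j p) x + pderiv j (fun y => G y i p) x
     - pderiv p (fun y => G y i j) x).

(* R(d_i, d_j) d_k = sum_l (riemann G l i j k) d_l,
   where R(X, Y) = [nabla_X, nabla_Y] - nabla_[X, Y] *)
Definition riemann (R : realType) (n : nat) (G : 'rV[R]_n -> 'M[R]_n)
    (l i j k : 'I_n) (x : 'rV[R]_n) : R :=
  pderiv i (christoffel G l j k) x - pderiv j (christoffel G l i k) x
  + \sum_(p < n) (christoffel G p j k x * christoffel G l i p x
                  - christoffel G p i k x * christoffel G l j p x).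

(* Ric(Y, Z) = tr (X |-> R(X, Y) Z), nonnegative on round spheres *)
Definition ricci (R : realType) (n : nat) (G : 'rV[R]_n -> 'M[R]_n)
    (x : 'rV[R]_n) : 'M[R]_n :=
  \matrix_(j, k) \sum_(i < n) riemann G i i j k x.

Definition einstein (R : realType) (n : nat) (M : manifold R n) (g : metric M)
    (lambda : R) : Prop :=
  forall c : chart R n M, atlas c -> forall x, crange c x ->
    ricci (g c) x = (lambda * (n%:R - 1)) *: g c x.

Definition conformal_change (R : realType) (n : nat) (M : manifold R n)
    (g ghat : metric M) (omega : M -> R) : Prop :=
  forall c : chart R n M, atlas c -> forall x, crange c x ->
    ghat c x = expR (2 * omega (cinv c x)) *: g c x.

(** ** Embedded submanifolds of dimension k and codimension m *)

(* Coordinates (x, u) in R^k x R^m with S = {u = 0}: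
   x = lsubmx (c q) and u = rsubmx (c q). *)
Definition slice_chart (R : realType) (k m : nat) (M : manifold R (k + m))
    (S : set M) (c : chart R (k + m) M) : Prop :=
  atlas c /\ forall q, cdom c q -> (S q <-> rsubmx (c q) = 0).

Definition embedded_submanifold (R : realType) (k m : nat)
    (M : manifold R (k + m)) (S : set M) : Prop :=
  forall p, S p -> exists2 c : chart R (k + m) M, slice_chart S c & cdom c p.

Definition slice_frame (R : realType) (k m : nat) : 'M[R]_(k, k + m) :=
  row_mx 1%:M 0.

(* h_{ab} = g(d_a, d_b), a, b < k *)
Definition induced_metric (R : realType) (k m : nat) (G : 'M[R]_(k + m)) :
  'M[R]_k := slice_frame R k m *m G *m (slice_frame R k m)^T.

Definition tangential (R : realType) (k m : nat) (G : 'M[R]_(k + m))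
    (v : 'rV[R]_(k + m)) : 'rV[R]_(k + m) :=
  v *m G *m (slice_frame R k m)^T *m invmx (induced_metric G) *m slice_frame R k m.

(* (nabla_{d_a} d_b)^perp *)
Definition second_fundamental_form (R : realType) (k m : nat)
    (G : 'rV[R]_(k + m) -> 'M[R]_(k + m)) (a b : 'I_k) (x : 'rV[R]_(k + m)) :
  'rV[R]_(k + m) :=
  let D := \row_l christoffel G l (lshift m a) (lshift m b) x in
  D - tangential (G x) D.

(* the trace of the second fundamental form, with no 1/k factor *)
Definition mean_curvature (R : realType) (k m : nat)
    (G : 'rV[R]_(k + m) -> 'M[R]_(k + m)) (x : 'rV[R]_(k + m)) :
  'rV[R]_(k + m) :=
  \sum_(a < k) \sum_(b < k)
    invmx (induced_metric (G x)) a b *: second_fundamental_form G a b x.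

Definition minimal (R : realType) (k m : nat) (M : manifold R (k + m))
    (g : metric M) (S : set M) : Prop :=
  forall c : chart R (k + m) M, slice_chart S c ->
    forall p, cdom c p -> S p -> mean_curvature (g c) (c p) = 0.

(** ** The collar X = M x [0, eps0) and Poincare metrics *)

Definition collar (R : realType) (n : nat) (M : manifold R n) (eps0 : R) :
  set (M * R) := [set q | 0 <= q.2 < eps0].
Arguments collar {R n} M eps0 _.

(* Coordinates (c, r) on cdom c x R, with r the last coordinate. *)
Definition xmap (R : realType) (n : nat) (M : manifold R n)
    (c : chart R n M) (q : M * R) : 'rV[R]_(n + 1) :=
  row_mx (c q.1) (const_mx q.2).

Definition rcoord (R : realType) (n : nat) (z : 'rV[R]_(n + 1)) : R :=
  z 0 (rshift n ord0).

Definition xinv (R : realType) (n : nat) (M : manifold R n)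
    (c : chart R n M) (z : 'rV[R]_(n + 1)) : M * R :=
  (cinv c (lsubmx z), rcoord z).

(* r^-2 (dr^2 + (1 - lambda r^2 / 4)^2 g) in the coordinates (c, r) *)
Definition poincare (R : realType) (n : nat) (M : manifold R n) (g : metric M)
    (lambda : R) (c : chart R n M) (z : 'rV[R]_(n + 1)) : 'M[R]_(n + 1) :=
  (rcoord z) ^- 2 *:
    block_mx ((1 - 4^-1 * lambda * rcoord z ^+ 2) ^+ 2 *: g c (lsubmx z)) 0
             0 1%:M.

Definition collar_nbhd (R : realType) (n : nat) (M : manifold R n) (eps0 : R)
    (U : set (M * R)) : Prop :=
  (exists2 O : set (M * R), open O & U = O `&` collar M eps0) /\
  forall p : M, U (p, 0).

Definition in_charts (R : realType) (n : nat) (M : manifold R n)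
    (Phi : M * R -> M * R) (c d : chart R n M) :
  'rV[R]_(n + 1) -> 'rV[R]_(n + 1) := fun z => xmap d (Phi (xinv c z)).

Definition smooth_collar_map (R : realType) (n : nat) (M : manifold R n)
    (U : set (M * R)) (Phi : M * R -> M * R) : Prop :=
  {within U, continuous Phi} /\
  forall c d : chart R n M, atlas c -> atlas d ->
    smooth_map_on
      (xmap c @` [set q | [/\ U q, cdom c q.1 & cdom d (Phi q).1]])
      (in_charts Phi c d).

Definition diffeomorphism (R : realType) (n : nat) (M : manifold R n)
    (U V : set (M * R)) (Phi : M * R -> M * R) : Prop :=
  exists Psi : M * R -> M * R,
    [/\ smooth_collar_map U Phi, smooth_collar_map V Psi,
        forall q, U q -> V (Phi q) /\ Psi (Phi q) = q &
        forall q, V q -> U (Psi q) /\ Phi (Psi q) = q].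

(** ** Vanishing to infinite order at r = 0 *)

(* F = O(r^N) for all N, uniformly on the part of A in r > 0 near (p, 0). *)
Definition vanishes_to_infinite_order (R : realType) (T : topologicalType)
    (A : set (T * R)) (F : T * R -> R) (p : T) : Prop :=
  forall N : nat, exists C : R, \forall q \near (p, 0 : R),
    A q -> 0 < q.2 -> `|F q| <= C * q.2 ^+ N.

(* Phi^* ghat_+ = g_+ + O(r^oo).  Where Phi fixes M x {0}, it maps U near (p, 0)
   to cdom c x R, so a single chart c around p serves for source and target. *)
Definition pulls_back_to_infinite_order (R : realType) (n : nat)
    (M : manifold R n) (U : set (M * R)) (Phi : M * R -> M * R)
    (gp ghatp : chart R n M -> 'rV[R]_(n + 1) -> 'M[R]_(n + 1)) : Prop :=
  forall c : chart R n M, atlas c -> forall p, cdom c p -> forall i j,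
    vanishes_to_infinite_order U
      (fun q => (pullback (in_charts Phi c c) (ghatp c) (xmap c q)
                 - gp c (xmap c q)) i j) p.

(* Near each (p, 0) with p in S, the image of S x [0, eps0) is a graph
   u = f(x, r) over S x [0, eps0), with f vanishing to infinite order at r = 0.
   The image determines f near (lsubmx (c p), 0) in r >= 0, so when Phi is a
   diffeomorphism fixing M x {0}, f is smooth there. *)
Definition preserves_to_infinite_order (R : realType) (k m : nat)
    (M : manifold R (k + m)) (S : set M) (U : set (M * R))
    (Phi : M * R -> M * R) : Prop :=
  forall c : chart R (k + m) M, slice_chart S c ->
    forall p, cdom c p -> S p ->
    exists f : 'rV[R]_k * R -> 'rV[R]_m,
      (\forall q \near (p, 0 : R), 0 <= q.2 ->
        ((Phi @` [set q' | U q' /\ S q'.1]) q <->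
         rsubmx (c q.1) = f (lsubmx (c q.1), q.2))) /\
      (forall j : 'I_m,
        vanishes_to_infinite_order setT (fun y => f y 0 j) (lsubmx (c p))).

(* Main.v *)
(* In a slice chart write Phi = (X, rho) with rho = r m. Call a smooth function flat if it is
   divisible by every power of r with smooth quotient; by Hadamard's lemma this is the same as
   being O(r^oo). Inverting the matrices in Phi^* ghat_+ = g_+ gives, modulo flat functions, an
   eikonal equation for m, the transport equation
     X_r (m + r m_r) + r a^-2 <dX, dm>_g = 0    with a = 1 - lambda r^2 / 4,
   and an equation between the cometrics on M. The r^2-coefficient of the latter says that the
   Hessian of sigma = 1/m (at r = 0), that is sigma = e^(-omega), is pure trace. Hence
   tau = (|d sigma|^2 + lambdahat) / (4 sigma) satisfies d tau = - (lambda / 4) d sigma, and both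
   S = 1/m + lambdahat r^2 m / 4 and S0 = sigma + r^2 tau solve the same singular first-order
   equation with the same value at r = 0, so that S - S0 is flat. Therefore dm is, modulo flat
   functions, a multiple of d sigma. Minimality of Sigma for g and for ghat = sigma^-2 g says that
   grad sigma is tangent to Sigma, so the transport equation restricts to Sigma x [0, eps0), where
   it determines the Taylor coefficients of the normal components of X, starting from 0: these
   components are flat. *)

From HB Require Import structures.
Require Import Defs.
From mathcomp Require Import all_boot all_order all_algebra.
From mathcomp Require Import all_classical all_reals all_analysis.
From mathcomp Require Import ring lra.
Import Order.TTheory GRing.Theory Num.Theory numFieldNormedType.Exports.
Local Open Scope classical_set_scope.
Local Open Scope ring_scope.
Set Implicit Arguments.
Unset Strict Implicit.
Unset Printing Implicit Defensive.

(** * Partial derivatives *)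

Section Calculus.
Context {R : realType}.

(** [Phi] is given only on r >= 0, and its isometry property only as an estimate for r > 0, whereas
    the argument keeps differentiating and dividing by r. In a chart [Phi] is therefore replaced by
    a smooth map P on a full ball around a boundary point. Flatness of a smooth function depends
    only on its Taylor coefficients in r at r = 0, and these are determined by r > 0, so the choice
    of the extension is harmless. Divisibility by r^N with a smooth quotient, unlike a bound,
    survives differentiation. The differential equations are singular at r = 0. Instead of a
    uniqueness theorem for them, the proof uses [flat_toS]: if F and its r-derivative are both
    divisible by r^(N+1), then F is divisible by r^(N+2). A transport equation gives the second
    divisibility from the first, and F = 0 at r = 0 starts the induction. This runs once for S - S0
    and once for the normal components of X on the slice. Cometrics are preferred to metrics because
    their entries decouple: the pairings of d rho with d rho and with dX do not involve ghat. *)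

Lemma cvg_mx (T : Type) (F : set_system T) m n (f : T -> 'M[R]_(m, n)) (l : 'M[R]_(m, n)) :
  Filter F -> (forall i j, f x i j @[x --> F] --> l i j) -> f x @[x --> F] --> l.
Proof.
move=> FF H; apply/cvgrPdist_le => /= e e0; near=> x.
rewrite /Num.Def.normr/= mx_normrE (bigmax_le _ (ltW e0))//= => i _.
rewrite !mxE; move: i; near: x; apply: filter_forall => /= i.
exact: ((cvgrPdist_le _ _).1 (H i.1 i.2)).
Unshelve. all: by end_near. Qed.

Lemma cvg_sumr (T : Type) (F : set_system T) (I : Type) (r : seq I) (P : pred I)
    (f : I -> T -> R) (l : I -> R) :
  Filter F -> (forall i, P i -> f i x @[x --> F] --> l i) ->
  \sum_(i <- r | P i) f i x @[x --> F] --> \sum_(i <- r | P i) l i.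
Proof.
move=> FF H; elim: r => [|i r IH].
  by rewrite big_nil; under eq_fun do rewrite big_nil; exact: cvg_cst.
rewrite big_cons; under eq_fun do rewrite big_cons.
by case: ifP => Pi //; apply: cvgD => //; exact: H.
Qed.

Lemma continuous_mulmxr m n p (L : 'M[R]_(n, p)) :
  continuous (mulmxr L : 'M[R]_(m, n) -> 'M[R]_(m, p)).
Proof.
move=> x; apply: (cvg_mx (nbhs_filter x)) => i j.
rewrite /= mxE; under eq_fun do rewrite /= mxE.
apply: (cvg_sumr (nbhs_filter x)) => k _; apply: cvgM; last exact: cvg_cst.
exact: coord_continuous.
Qed.

Lemma pderiv_near_eq d (i : 'I_d) (f g : 'rV[R]_d -> R) x :
  (\near x, f x = g x) -> pderiv i f x = pderiv i g x.
Proof. by move=> fg; apply: near_eq_derive. Qed.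

Lemma differentiable_eps (V W : normedModType R) (f : V -> W) (L : {linear V -> W}) x :
  continuous L ->
  (forall e, 0 < e -> \forall h \near (0 : V), `|f (h + x) - f x - L h| <= e * `|h|) ->
  differentiable f x /\ 'd f x = L :> (V -> W).
Proof.
move=> cL H.
have E : f \o shift x = cst (f x) + L +o_ 0 id.
  apply/eqaddoP => e e0; near=> h => /=.
  rewrite !fctE /= opprD addrA; near: h; exact: H.
have dE := diff_unique cL E; split => //.
by apply/diff_locallyP; rewrite dE.
Unshelve. all: by end_near. Qed.

Lemma diff_eps (V W : normedModType R) (f : V -> W) x e :
  differentiable f x -> 0 < e ->
  \forall h \near (0 : V), `|f (h + x) - f x - 'd f x h| <= e * `|h|.
Proof.
move=> /diff_locally /eqaddoE/eqaddoP H e0; have := H e e0; apply: filterS => h /=.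
by rewrite !fctE /= opprD addrA.
Qed.

Lemma differentiable_near_eq (V W : normedModType R) (f g : V -> W) x :
  (\near x, f x = g x) -> differentiable f x -> differentiable g x.
Proof.
move=> fg df.
suff H e : 0 < e ->
    \forall h \near (0 : V), `|g (h + x) - g x - 'd f x h| <= e * `|h|.
  by have [] := differentiable_eps (diff_continuous df) H.
move=> e0.
have H : \forall h \near (0 : V), f (h + x) = g (h + x).
  have : (fun h => h + x) @ (0 : V) --> x.
    by rewrite -[X in _ --> X]add0r; apply: cvgD; [exact: cvg_id|exact: cvg_cst].
  by move=> /(_ _ fg).
near=> h.
have <- : f (h + x) = g (h + x) by near: h.
rewrite -(nbhs_singleton fg); near: h; exact: diff_eps.
Unshelve. all: by end_near. 
Qed.

Lemma open_near_eq d (O : set 'rV[R]_d) (f g : 'rV[R]_d -> R) x :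
  open O -> O x -> {in O, f =1 g} -> \near x, f x = g x.
Proof.
move=> oO Ox fg; have : nbhs x O by exact: open_nbhs_nbhs.
by apply: filterS => y Oy; apply: fg; rewrite inE.
Qed.

Lemma smooth_open_differentiable d (O : set 'rV[R]_d) f x :
  smooth_open O f -> O x -> differentiable f x.
Proof. by move=> sf Ox; exact: (sf [::] x Ox). Qed.

Lemma smooth_open_pderiv d (O : set 'rV[R]_d) f (i : 'I_d) :
  smooth_open O f -> smooth_open O (pderiv i f).
Proof. by move=> sf s x Ox; have := sf (rcons s i) x Ox; rewrite foldr_rcons. Qed.

(** Smoothness as a coinductive notion: a class of differentiable functions that is stable under
    partial derivatives, up to equality on O, contains only smooth functions. Every closure property
    below comes from choosing a suitable class. *)
Lemma smooth_open_coind d (O : set 'rV[R]_d) (C : ('rV[R]_d -> R) -> Prop) :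
  open O ->
  (forall f, C f -> forall x, O x -> differentiable f x) ->
  (forall f, C f -> forall i, exists2 g, C g & {in O, pderiv i f =1 g}) ->
  forall f, C f -> smooth_open O f.
Proof.
move=> oO Cd Cp f Cf.
have H : forall s, exists2 g, C g & {in O, foldr (@pderiv R d) f s =1 g}.
  elim => [|i s [g Cg fg]]; first by exists f.
  have [h Ch gh] := Cp _ Cg i; exists h => // x; rewrite inE => Ox /=.
  rewrite (@pderiv_near_eq _ i _ g) ?gh ?inE//.
  exact: open_near_eq Ox fg.
move=> s x Ox; have [g Cg fg] := H s.
apply: (@differentiable_near_eq _ _ g); last exact: Cd.
by apply: (@open_near_eq _ O) => // y yO; rewrite fg.
Qed.

Lemma smooth_open_ext d (O : set 'rV[R]_d) f g :
  open O -> {in O, f =1 g} -> smooth_open O f -> smooth_open O g.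
Proof.
move=> oO fg sf.
apply: (@smooth_open_coind _ O (fun g => exists2 f, smooth_open O f & {in O, f =1 g})) => //; last by exists f.
- move=> {sf fg f} {}g [f sf fg] x Ox.
  apply: (@differentiable_near_eq _ _ f); last exact: smooth_open_differentiable Ox.
  exact: open_near_eq Ox fg.
- move=> {sf fg f} {}g [f sf fg] i; exists (pderiv i g) => //.
  exists (pderiv i f); first exact: smooth_open_pderiv.
  move=> x; rewrite inE => Ox; apply: pderiv_near_eq; exact: open_near_eq Ox fg.
Qed.

Lemma smooth_open_sub d (O O' : set 'rV[R]_d) f :
  O' `<=` O -> smooth_open O f -> smooth_open O' f.
Proof. by move=> sub sf s x /sub; exact: sf. Qed.

(* pairing differentiability with the value of the partial derivative lets
   derivatives of compound expressions be computed by unification *)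
Definition has_pderiv d (i : 'I_d) (f : 'rV[R]_d -> R) x (l : R) :=
  differentiable f x /\ pderiv i f x = l.

Section has_pderiv.
Context {d : nat} (i : 'I_d).
Implicit Types (f g : 'rV[R]_d -> R) (x : 'rV[R]_d).

Lemma has_pderivP f x : differentiable f x -> has_pderiv i f x (pderiv i f x).
Proof. by []. Qed.

Lemma has_pderiv_smooth (O : set 'rV[R]_d) f x :
  smooth_open O f -> O x -> has_pderiv i f x (pderiv i f x).
Proof. by move=> sf Ox; apply: has_pderivP; exact: smooth_open_differentiable Ox. Qed.

Lemma has_pderiv_cst (a : R) x : has_pderiv i (fun=> a) x 0.
Proof. by split; [exact: differentiable_cst | exact: derive_cst]. Qed.

Lemma has_pderivD f g x a b : has_pderiv i f x a -> has_pderiv i g x b ->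
  has_pderiv i (fun y => f y + g y) x (a + b).
Proof.
move=> [df <-] [dg <-]; split; first exact: differentiableD.
by rewrite /pderiv (@deriveD _ _ _ f g) //; exact: diff_derivable.
Qed.

Lemma has_pderivM f g x a b : has_pderiv i f x a -> has_pderiv i g x b ->
  has_pderiv i (fun y => f y * g y) x (a * g x + f x * b).
Proof.
move=> [df <-] [dg <-]; split; first exact: differentiableM.
rewrite /pderiv (@deriveM _ _ f g); [|exact: diff_derivable..].
by rewrite addrC; congr (_ + _); rewrite /GRing.scale/= mulrC.
Qed.

Lemma has_pderivN f x a : has_pderiv i f x a -> has_pderiv i (fun y => - f y) x (- a).
Proof.
move=> [df <-]; split; first exact: differentiableN.
by rewrite /pderiv (@deriveN _ _ _ f) //; exact: diff_derivable.
Qed.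

Lemma has_pderivB f g x a b : has_pderiv i f x a -> has_pderiv i g x b ->
  has_pderiv i (fun y => f y - g y) x (a - b).
Proof. by move=> fa /has_pderivN; exact: has_pderivD. Qed.

Lemma has_pderivV f x a : f x != 0 -> has_pderiv i f x a ->
  has_pderiv i (fun y => (f y)^-1) x (- a * ((f x)^-1 * (f x)^-1)).
Proof.
move=> f0 [df <-]; split; first exact: differentiableV.
rewrite /pderiv (@deriveV _ _ f) //; last exact: diff_derivable.
by rewrite /GRing.scale /= -exprVn expr2 !mulNr mulrC.
Qed.

Lemma has_pderivX f x a n : has_pderiv i f x a ->
  has_pderiv i (fun y => f y ^+ n) x (n%:R * a * f x ^+ n.-1).
Proof.
move=> fa; elim: n => [|n IH].
  by rewrite !mul0r; have := has_pderiv_cst 1 x.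
under eq_fun do rewrite exprS.
have := has_pderivM fa IH; congr has_pderiv => /=.
by case: n {IH} => [|n] /=; rewrite ?exprS; ring.
Qed.

Lemma has_pderiv_sum (I : Type) (r : seq I) (P : pred I) (F : I -> 'rV[R]_d -> R) (a : I -> R) x :
  (forall j, P j -> has_pderiv i (F j) x (a j)) ->
  has_pderiv i (fun y => \sum_(j <- r | P j) F j y) x (\sum_(j <- r | P j) a j).
Proof.
move=> H; elim: r => [|j r IH].
  by rewrite big_nil; under eq_fun do rewrite big_nil; exact: has_pderiv_cst.
rewrite big_cons; under eq_fun do rewrite big_cons.
by case: ifP => Pj //; apply: has_pderivD => //; exact: H.
Qed.

Lemma has_pderiv_coord j x : has_pderiv i (fun y : 'rV[R]_d => y 0 j) x (j == i)%:R.
Proof.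
split; first exact: differentiable_coord.
rewrite /pderiv deriveE; last exact: differentiable_coord.
pose g (y : 'rV[R]_d) : R := y 0 j.
have gl : linear g by move=> a u v; rewrite /g !mxE.
pose gL := GRing.isLinear.Build _ _ _ _ g gl.
pose G : {linear _ -> _} := HB.pack g gL.
have := @diff_lin _ _ _ G x (@coord_continuous _ _ _ 0 j).
by move=> ->; rewrite /G /= /g mxE eqxx.
Qed.

Lemma has_pderiv_near_eq f g x a : (\near x, f x = g x) -> has_pderiv i f x a -> has_pderiv i g x a.
Proof.
move=> fg [df <-]; split; first exact: differentiable_near_eq df.
by apply/esym; exact: pderiv_near_eq.
Qed.

End has_pderiv.

Section rV_valued.
Context {d e : nat} (X : 'rV[R]_d -> 'rV[R]_e) (x : 'rV[R]_d).
Context (dX : forall j, differentiable (fun y => X y 0 j) x).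

Lemma differentiable_rV : differentiable X x.
Proof.
have -> : X = \sum_(j < e) (fun y => X y 0 j *: (delta_mx 0 j : 'rV[R]_e)).
  by apply/funext => y; rewrite fct_sumE; exact: row_sum_delta.
by apply: differentiable_sum => j; exact: differentiableZl.
Qed.

Lemma diff_rV v j : ('d X x v) 0 j = 'd (fun y => X y 0 j) x v.
Proof.
pose g (y : 'rV[R]_e) : R := y 0 j.
have gl : linear g by move=> a u w; rewrite /g !mxE.
pose gL := GRing.isLinear.Build _ _ _ _ g gl.
pose G : {linear _ -> _} := HB.pack g gL.
have dG : differentiable g (X x) by exact: differentiable_coord.
have := @diff_comp _ _ _ _ X g x differentiable_rV dG.
have := @diff_lin _ _ _ G (X x) (@coord_continuous _ _ _ 0 j).
rewrite /G /= => -> E.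
by rewrite -[RHS]/('d (g \o X) x v) E.
Qed.

Lemma jacobianE i j : jacobian X x i j = pderiv i (fun y => X y 0 j) x.
Proof.
by rewrite /jacobian /lin1_mx mxE diff_rV /pderiv (deriveE _ (dX j)).
Qed.

End rV_valued.

Lemma has_pderiv_comp d e (X : 'rV[R]_d -> 'rV[R]_e) (f : 'rV[R]_e -> R) (i : 'I_d) x (a : 'I_e -> R) :
  (forall j, has_pderiv i (fun y => X y 0 j) x (a j)) -> differentiable f (X x) ->
  has_pderiv i (fun y => f (X y)) x (\sum_j a j * pderiv j f (X x)).
Proof.
move=> HX df.
have dX j : differentiable (fun y => X y 0 j) x by have [] := HX j.
have dc : differentiable (f \o X) x.
  by apply: differentiable_comp => //; exact: differentiable_rV.
split=> //; rewrite /pderiv (deriveE _ dc) (diff_comp (differentiable_rV dX) df) /=.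
rewrite [X in 'd f _ X]row_sum_delta linear_sum; apply: eq_bigr => j _.
by rewrite linearZ /= (deriveE _ df) diff_rV // -(HX j).2 /pderiv (deriveE _ (dX j)).
Qed.

Lemma has_pderiv_linear d e (L : 'M[R]_(d, e)) (f : 'rV[R]_e -> R) (i : 'I_d) x :
  differentiable f (x *m L) ->
  has_pderiv i (fun y => f (y *m L)) x (\sum_j L i j * pderiv j f (x *m L)).
Proof.
move=> df.
have cL : continuous (mulmxr L : 'rV[R]_d -> 'rV[R]_e).
  exact: continuous_mulmxr.
have dL : differentiable (mulmxr L : 'rV[R]_d -> 'rV[R]_e) x.
  exact: linear_differentiable.
split; first exact: (@differentiable_comp _ _ _ _ (mulmxr L) f).
rewrite /pderiv deriveE; last exact: (@differentiable_comp _ _ _ _ (mulmxr L) f).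
rewrite (@diff_comp _ _ _ _ (mulmxr L) f) //= diff_lin //= -rowE.
rewrite [in LHS](row_sum_delta (row i L)) linear_sum; apply: eq_bigr => j _.
by rewrite linearZ /= mxE deriveE.
Qed.

End Calculus.

(** * Algebra of smooth functions *)

Section Smooth.
Context {R : realType}.

(** The derivatives of f(X), f g and 1/f mix compositions, products and inverses, so no single
    operation gives a class stable under derivation. The expressions generated by all of them
    together do, and one coinduction settles every case. *)
Inductive smooth_expr d (O : set 'rV[R]_d) : ('rV[R]_d -> R) -> Prop :=
| smooth_expr_smooth f : smooth_open O f -> smooth_expr O f
| smooth_expr_comp e (O' : set 'rV[R]_e) (X : 'rV[R]_d -> 'rV[R]_e) f : smooth_open O' f ->
    (forall j, smooth_expr O (fun x => X x 0 j)) -> (forall x, O x -> O' (X x)) ->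
    smooth_expr O (fun x => f (X x))
| smooth_expr_add f g : smooth_expr O f -> smooth_expr O g ->
    smooth_expr O (fun x => f x + g x)
| smooth_expr_mul f g : smooth_expr O f -> smooth_expr O g ->
    smooth_expr O (fun x => f x * g x)
| smooth_expr_inv f : smooth_expr O f -> (forall x, O x -> f x != 0) ->
    smooth_expr O (fun x => (f x)^-1).

Lemma smooth_open_cst d (O : set 'rV[R]_d) (a : R) : open O -> smooth_open O (fun=> a).
Proof.
move=> oO; apply: (smooth_open_coind (C := fun f => exists a, f = fun=> a)) => //; last by exists a.
- by move=> _ [b ->] x _; exact: differentiable_cst.
- move=> _ [b ->] i; exists (fun=> 0); first by exists 0.
  by move=> x _; have [_ ->] := has_pderiv_cst i b x.
Qed.

Lemma smooth_expr_sum d (O : set 'rV[R]_d) n (f : 'I_n -> 'rV[R]_d -> R) :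
  open O -> (forall i, smooth_expr O (f i)) -> smooth_expr O (fun x => \sum_i f i x).
Proof.
move=> oO; elim: n f => [|n IH] f H.
  under eq_fun do rewrite big_ord0; apply: smooth_expr_smooth; exact: smooth_open_cst.
under eq_fun do rewrite big_ord_recr /=.
by apply: smooth_expr_add => //; apply: (IH (fun i => f (widen_ord (leqnSn n) i))).
Qed.

Lemma smooth_exprP d (O : set 'rV[R]_d) f : open O -> smooth_expr O f -> smooth_open O f.
Proof.
move=> oO.
suff H g : smooth_expr O g -> (forall x, O x -> differentiable g x) /\
    forall i, exists2 h, smooth_expr O h & forall x, O x -> has_pderiv i g x (h x).
  move: f; apply: smooth_open_coind => // f /H[df Hf] //.
  by move=> i; have [h Ch hE] := Hf i; exists h => // x; rewrite inE => /hE[_].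
elim=> {g f}.
- move=> f sf; split=> [x Ox|i]; first exact: smooth_open_differentiable Ox.
  exists (pderiv i f); first by apply: smooth_expr_smooth; exact: smooth_open_pderiv.
  by move=> x Ox; exact: has_pderiv_smooth Ox.
- move=> e O' X f sf sX IHX sub.
  have df x : O x -> differentiable f (X x).
    by move=> /sub; exact: smooth_open_differentiable.
  split=> [x Ox|i].
    apply: (@differentiable_comp _ _ _ _ X f); last exact: df.
    by apply: differentiable_rV => j; have [+ _] := IHX j; exact.
  have /fin_all_exists2[X' sX' HX] j := (IHX j).2 i.
  exists (fun x => \sum_j X' j x * pderiv j f (X x)).
    apply: smooth_expr_sum => // j; apply: smooth_expr_mul => //.
    by apply: (@smooth_expr_comp _ _ _ O') => //; exact: smooth_open_pderiv.
  by move=> x Ox; apply: has_pderiv_comp => [j|]; [exact: HX|exact: df].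
- move=> f g _ [df IHf] _ [dg IHg]; split=> [x Ox|i].
    by apply: differentiableD; [exact: df|exact: dg].
  have [f' sf' Hf] := IHf i; have [g' sg' Hg] := IHg i.
  exists (fun x => f' x + g' x); first exact: smooth_expr_add.
  by move=> x Ox; apply: has_pderivD; [exact: Hf|exact: Hg].
- move=> f g sf [df IHf] sg [dg IHg]; split=> [x Ox|i].
    by apply: differentiableM; [exact: df|exact: dg].
  have [f' sf' Hf] := IHf i; have [g' sg' Hg] := IHg i.
  exists (fun x => f' x * g x + f x * g' x).
    by apply: smooth_expr_add; apply: smooth_expr_mul.
  by move=> x Ox; apply: has_pderivM; [exact: Hf|exact: Hg].
- move=> f sf [df IHf] f0; split=> [x Ox|i].
    by apply: differentiableV; [exact: df|exact: f0].
  have [f' sf' Hf] := IHf i.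
  (* The sign and the square are written as products so that the derivative is again built from the
     constructors. *)
  exists (fun x => - 1 * f' x * ((f x)^-1 * (f x)^-1)).
    apply: smooth_expr_mul; last by apply: smooth_expr_mul; exact: smooth_expr_inv.
    apply: smooth_expr_mul => //; apply: smooth_expr_smooth; exact: smooth_open_cst.
  by move=> x Ox; rewrite mulN1r; apply: has_pderivV; [exact: f0|exact: Hf].
Qed.

Context {d : nat} {O : set 'rV[R]_d} (oO : open O).
Implicit Types f g : 'rV[R]_d -> R.

Lemma smooth_openD f g : smooth_open O f -> smooth_open O g ->
  smooth_open O (fun x => f x + g x).
Proof.
by move=> sf sg; apply: smooth_exprP => //; apply: smooth_expr_add; exact: smooth_expr_smooth.
Qed.

Lemma smooth_openM f g : smooth_open O f -> smooth_open O g ->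
  smooth_open O (fun x => f x * g x).
Proof.
by move=> sf sg; apply: smooth_exprP => //; apply: smooth_expr_mul; exact: smooth_expr_smooth.
Qed.

Lemma smooth_openV f : smooth_open O f -> (forall x, O x -> f x != 0) ->
  smooth_open O (fun x => (f x)^-1).
Proof.
by move=> sf f0; apply: smooth_exprP => //; apply: smooth_expr_inv => //; exact: smooth_expr_smooth.
Qed.

Lemma smooth_open_comp e (O' : set 'rV[R]_e) (X : 'rV[R]_d -> 'rV[R]_e) (f : 'rV[R]_e -> R) :
  smooth_open O' f -> (forall j, smooth_open O (fun x => X x 0 j)) ->
  (forall x, O x -> O' (X x)) -> smooth_open O (fun x => f (X x)).
Proof.
move=> sf sX sub; apply: smooth_exprP => //; apply: smooth_expr_comp sf _ sub => j.
exact: smooth_expr_smooth.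
Qed.

Lemma smooth_openN f : smooth_open O f -> smooth_open O (fun x => - f x).
Proof.
move=> sf; under eq_fun do rewrite -mulN1r.
by apply: smooth_openM => //; exact: smooth_open_cst.
Qed.

Lemma smooth_openB f g : smooth_open O f -> smooth_open O g ->
  smooth_open O (fun x => f x - g x).
Proof. by move=> sf sg; apply: smooth_openD => //; exact: smooth_openN. Qed.

Lemma smooth_openX f n : smooth_open O f -> smooth_open O (fun x => f x ^+ n).
Proof.
move=> sf; elim: n => [|n IH]; first by under eq_fun do rewrite expr0; exact: smooth_open_cst.
by under eq_fun do rewrite exprS; exact: smooth_openM.
Qed.

Lemma smooth_open_coord j : smooth_open O (fun x => x 0 j).
Proof.
apply: (smooth_open_coind (C := fun f => (f = fun x => x 0 j) \/ smooth_open O f)) => //; last by left.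
- move=> f [->|sf] x Ox; first exact: differentiable_coord.
  exact: smooth_open_differentiable Ox.
- move=> f [->|sf] i.
    exists (fun=> (j == i)%:R); first by right; exact: smooth_open_cst.
    by move=> x _; have [_ ->] := has_pderiv_coord i j x.
  by exists (pderiv i f) => //; right; exact: smooth_open_pderiv.
Qed.

Lemma smooth_open_sum (I : Type) (r : seq I) (P : pred I) (f : I -> 'rV[R]_d -> R) :
  (forall i, P i -> smooth_open O (f i)) -> smooth_open O (fun x => \sum_(i <- r | P i) f i x).
Proof.
move=> H; elim: r => [|i r IH].
  by under eq_fun do rewrite big_nil; exact: smooth_open_cst.
under eq_fun do rewrite big_cons.
by case Pi: (P i) => //; apply: smooth_openD => //; exact: H.
Qed.

Lemma smooth_open_prod (I : Type) (r : seq I) (P : pred I) (f : I -> 'rV[R]_d -> R) :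
  (forall i, P i -> smooth_open O (f i)) -> smooth_open O (fun x => \prod_(i <- r | P i) f i x).
Proof.
move=> H; elim: r => [|i r IH].
  by under eq_fun do rewrite big_nil; exact: smooth_open_cst.
under eq_fun do rewrite big_cons.
by case Pi: (P i) => //; apply: smooth_openM => //; exact: H.
Qed.

Lemma smooth_open_det n (A : 'rV[R]_d -> 'M[R]_n) :
  (forall i j, smooth_open O (fun x => A x i j)) -> smooth_open O (fun x => \det (A x)).
Proof.
move=> sA; apply: smooth_open_sum => s _; apply: smooth_openM; first exact: smooth_open_cst.
exact: smooth_open_prod.
Qed.

Lemma smooth_open_invmx n (A : 'rV[R]_d -> 'M[R]_n) :
  (forall i j, smooth_open O (fun x => A x i j)) -> (forall x, O x -> A x \in unitmx) ->
  forall i j, smooth_open O (fun x => invmx (A x) i j).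
Proof.
move=> sA uA i j.
apply: (@smooth_open_ext _ _ _ (fun x => (\det (A x))^-1 * \adj (A x) i j)) => //.
  by move=> x; rewrite inE => Ox; rewrite /invmx (uA _ Ox) [in RHS]mxE.
apply: smooth_openM.
  apply: smooth_openV; first exact: smooth_open_det.
  by move=> x Ox; have := uA _ Ox; rewrite unitmxE unitfE.
under eq_fun do rewrite mxE.
apply: smooth_openM; first exact: smooth_open_cst.
apply: smooth_open_det => k l; under eq_fun do rewrite !mxE; exact: sA.
Qed.

Lemma smooth_open_continuous f x : smooth_open O f -> O x -> {for x, continuous f}.
Proof. by move=> sf Ox; apply: differentiable_continuous; exact: smooth_open_differentiable Ox. Qed.

End Smooth.

(** * Mean value estimates and symmetry of second derivatives *)

Section Taylor.
Context {R : realType}.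

Lemma ball_rVP d (x y : 'rV[R]_d) e :
  ball x e y <-> 0 < e /\ forall j, `|x 0 j - y 0 j| < e.
Proof.
split=> [[e0 H]|[e0 H]]; split => //.
  by move=> j; exact: H.
by move=> i j; rewrite (ord1 i); exact: H.
Qed.

Lemma normr_rVP d (x : 'rV[R]_d) e : 0 <= e -> `|x| <= e <-> forall j, `|x 0 j| <= e.
Proof.
move=> e0; rewrite [`|x|]/Num.Def.normr/= mx_normrE; split=> [H j|H].
  by apply: le_trans H; exact: (le_bigmax _ _ (ord0, j)).
by apply: bigmax_le => // -[i j] _ /=; rewrite (ord1 i).
Qed.

Lemma normr_delta_le1 d (i : 'I_d) : `|delta_mx 0 i : 'rV[R]_d| <= 1.
Proof.
apply/normr_rVP => // j; rewrite mxE eqxx /=.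
by case: eqP => _; rewrite ?normr1 ?normr0.
Qed.

Lemma is_derive_line d (f : 'rV[R]_d -> R) x v (t : R) :
  differentiable f (x + t *: v) ->
  is_derive t (1 : R) (fun s : R => f (x + s *: v)) ('d f (x + t *: v) v).
Proof.
move=> df.
pose l (s : R) : 'rV[R]_d := s *: v.
have ll : linear l by move=> a u w; rewrite /l scalerDl scalerA.
pose lL := GRing.isLinear.Build _ _ _ _ l ll.
pose L : {linear R -> 'rV[R]_d} := HB.pack l lL.
have cL : continuous L by move=> s; apply: (cvgZr_tmp (F := nbhs s)); exact: cvg_id.
have [dl El] : differentiable (fun s : R => x + s *: v) t /\
    'd (fun s : R => x + s *: v) t = L :> (R -> 'rV[R]_d).
  apply: differentiable_eps cL _ => e e0; near=> h.
  have -> : x + (h + t) *: v - (x + t *: v) - L h = 0.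
    by rewrite /L /= /l scalerDl opprD addrACA subrr add0r addrK subrr.
  by rewrite normr0 mulr_ge0 // ltW.
have dc : differentiable (f \o (fun s : R => x + s *: v)) t by exact: differentiable_comp.
have dE : 'd (f \o (fun s : R => x + s *: v)) t = 'd f (x + t *: v) \o L :> (R -> R).
  by rewrite diff_comp // El.
apply: DeriveDef; first by apply/derivable1_diffP.
by rewrite deriveE //= dE /= /l scale1r.
Unshelve. all: by end_near. Qed.

(** Locating t by its absolute value lets one statement serve both signs of r, since the extended
    functions live on both sides of r = 0. *)
Lemma mvt_from0 (f df : R -> R) r :
  (forall t, `|t| <= `|r| -> is_derive t (1 : R) f (df t)) ->
  exists2 t, `|t| <= `|r| & f r - f 0 = df t * r.
Proof.
move=> H.
have cf a b : (forall t, t \in `[a, b] -> `|t| <= `|r|) -> {within `[a, b], continuous f}.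
  move=> ab; apply: derivable_within_continuous => t tab.
  by have [] := H t (ab _ tab).
have [r0|r0] := leP 0 r.
  have ab t : t \in `[0, r] -> `|t| <= `|r|.
    by rewrite in_itv /= => /andP[t0 tr]; rewrite !ger0_norm.
  have [c cr E] := MVT_segment r0 (fun t tr => H t (ab t (subset_itv_oo_cc tr))) (cf _ _ ab).
  by exists c; [exact: ab|rewrite E subr0].
have ab t : t \in `[r, 0] -> `|t| <= `|r|.
  by rewrite in_itv /= => /andP[t0 tr]; rewrite !ler0_norm ?(ltW r0)// lerN2.
have [c cr E] := MVT_segment (ltW r0) (fun t tr => H t (ab t (subset_itv_oo_cc tr))) (cf _ _ ab).
by exists c; [exact: ab|rewrite -opprB E sub0r mulrN opprK].
Qed.

Lemma mvt_line d (f : 'rV[R]_d -> R) x v :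
  (forall t : R, `|t| <= 1 -> differentiable f (x + t *: v)) ->
  exists2 t : R, `|t| <= 1 & f (x + v) - f x = 'd f (x + t *: v) v.
Proof.
move=> H.
have [|t t1] := @mvt_from0 (fun s => f (x + s *: v)) (fun t => 'd f (x + t *: v) v) 1.
  by move=> t; rewrite normr1 => t1; apply: is_derive_line; exact: H.
by rewrite normr1 in t1; rewrite scale1r scale0r addr0 mulr1; exists t.
Qed.

Lemma diffE_pderiv d (f : 'rV[R]_d -> R) x s i : differentiable f x ->
  'd f x (s *: delta_mx 0 i) = s * pderiv i f x.
Proof. by move=> df; rewrite linearZ /= /pderiv deriveE. Qed.

Lemma has_pderiv_shift d (f : 'rV[R]_d -> R) x a i : differentiable f (x + a) ->
  has_pderiv i (fun y => f (y + a)) x (pderiv i f (x + a)).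
Proof.
move=> df.
have [dg dE] : differentiable (fun y => f (y + a)) x /\
    'd (fun y => f (y + a)) x = 'd f (x + a) :> ('rV[R]_d -> R).
  apply: differentiable_eps (diff_continuous df) _ => e e0.
  by have := diff_eps df e0; apply: filterS => h; rewrite addrA.
by split; last rewrite /pderiv (deriveE _ dg) dE (deriveE _ df).
Qed.

Lemma near0_ball_open d (O : set 'rV[R]_d) x : open O -> O x ->
  exists2 e : R, 0 < e & forall h : 'rV[R]_d, `|h| < e -> O (h + x).
Proof.
move=> oO Ox; have /nbhs_ballP[e /= e0 H] : nbhs x O by exact: open_nbhs_nbhs.
exists e => // h he; apply: H; rewrite -ball_normE /= opprD addrCA subrr addr0 normrN //.
Qed.

(** Mean value theorem in direction i for g(y) = f(y + s e_j) - f(y), followed by the first-order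
    expansion of [pderiv i f] at x in both resulting terms. *)
Lemma second_difference d (O : set 'rV[R]_d) f x i j e : open O -> smooth_open O f -> O x ->
  0 < e -> \forall s \near (0 : R),
   `|f (x + s *: delta_mx 0 i + s *: delta_mx 0 j) - f (x + s *: delta_mx 0 i)
     - f (x + s *: delta_mx 0 j) + f x - s ^+ 2 * pderiv j (pderiv i f) x| <= e * s ^+ 2.
Proof.
move=> oO sf Ox e0.
have [e1 e10 He1] := near0_ball_open oO Ox.
have dp : differentiable (pderiv i f) x.
  by apply: smooth_open_differentiable Ox; exact: smooth_open_pderiv.
(* The two increments have norms at most 2 |s| and |s|, which add up to three thirds of e |s|. *)
have e30 : 0 < e / 3 by rewrite divr_gt0.
have /nbhs_ballP[e2 /= e20 He2] := diff_eps dp e30.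
near=> s.
have s1 : `|s| * 2 < e1.
  rewrite -ltr_pdivlMr //; near: s.
  have := @nbhs0_lt _ R (e1 / 2); apply; exact: divr_gt0.
have s2 : `|s| * 2 < e2.
  rewrite -ltr_pdivlMr //; near: s.
  have := @nbhs0_lt _ R (e2 / 2); apply; exact: divr_gt0.
have nrm a b : `|a| <= 1 -> `|b| <= 1 ->
    `|a *: (s *: delta_mx 0 i) + b *: (s *: delta_mx 0 j) : 'rV[R]_d| <= `|s| * 2.
  move=> a1 b1; apply: le_trans (ler_normD _ _) _; rewrite !normrZ mulr2n mulrDr mulr1.
  rewrite lerD//; rewrite -[leRHS]mul1r ler_pM // -[leRHS]mulr1 ler_pM //; exact: normr_delta_le1.
have diffF a b : `|a| <= 1 -> `|b| <= 1 ->
    differentiable f (x + a *: (s *: delta_mx 0 i) + b *: (s *: delta_mx 0 j)).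
  move=> a1 b1; apply: smooth_open_differentiable sf _.
  by rewrite -addrA addrC; apply: He1; apply: le_lt_trans s1; exact: nrm.
pose g y := f (y + s *: delta_mx 0 j) - f y.
have dg t : `|t| <= 1 -> has_pderiv i g (x + t *: (s *: delta_mx 0 i))
   (pderiv i f (x + t *: (s *: delta_mx 0 i) + s *: delta_mx 0 j) -
    pderiv i f (x + t *: (s *: delta_mx 0 i))).
  move=> t1; apply: has_pderivB; last first.
    by apply: has_pderivP; have := diffF t 0 t1; rewrite scale0r addr0; apply; rewrite normr0.
  have df : differentiable f (x + t *: (s *: delta_mx 0 i) + s *: delta_mx 0 j).
    by have := diffF t 1 t1; rewrite scale1r; apply; rewrite normr1.
  exact: has_pderiv_shift.
have [t t1 E] := @mvt_line _ g x (s *: delta_mx 0 i) (fun t t1 => (dg t t1).1).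
rewrite (diffE_pderiv _ _ (dg _ t1).1) (dg _ t1).2 /g in E.
rewrite [X in `|X - _|](_ : _ = f (x + s *: delta_mx 0 i + s *: delta_mx 0 j) -
  f (x + s *: delta_mx 0 i) - (f (x + s *: delta_mx 0 j) - f x)); last by ring.
rewrite E.
set h1 := t *: (s *: delta_mx 0 i); set h2 := s *: delta_mx 0 j.
have b2 : h2 = 1 *: h2 by rewrite scale1r.
have := He2 h1; have := He2 (h1 + h2).
rewrite -!ball_normE /= !sub0r !normrN => A2 A1.
have n1 : `|h1| <= `|s| * 2.
  by have := nrm t 0 t1; rewrite scale0r addr0; apply; rewrite normr0.
have n2 : `|h1 + h2| <= `|s| * 2.
  by have := nrm t 1 t1; rewrite scale1r; apply; rewrite normr1.
have n1' : `|h1| <= `|s|.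
  rewrite /h1 !normrZ -[leRHS]mul1r ler_pM // -[leRHS]mulr1 ler_pM //; exact: normr_delta_le1.
have {}A1 := A1 (le_lt_trans n1 s2).
have {}A2 := A2 (le_lt_trans n2 s2).
rewrite linearD /= [in 'd _ _ h2]/h2 diffE_pderiv // in A2.
rewrite [x + h1]addrC [h1 + x + h2]addrAC.
set P := pderiv i f in A1 A2 *; set D := 'd P x h1 in A1 A2.
rewrite (_ : s * _ - _ = s * ((P (h1 + h2 + x) - P x - (D + s * pderiv j P x)) - (P (h1 + x) - P x - D))); last by ring.
rewrite normrM -[s ^+ 2]real_normK ?num_real// expr2 mulrCA ler_wpM2l//.
apply: le_trans (ler_normB _ _) _.
apply: le_trans (lerD A2 A1) _.
rewrite -mulrDr [leRHS](_ : _ = e / 3 * (`|s| * 2 + `|s|)); last by field.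
by rewrite ler_pM2l// lerD.
Unshelve. all: by end_near. Qed.

(** The second difference is symmetric in i and j, and after division by s^2 it approximates both
    mixed derivatives. *)
Lemma pderivC d (O : set 'rV[R]_d) f x i j : open O -> smooth_open O f -> O x ->
  pderiv j (pderiv i f) x = pderiv i (pderiv j f) x.
Proof.
have gen (w u v c p q S k : R) : `|w - u - v + c - S * p| <= k ->
    `|w - v - u + c - S * q| <= k -> `|S * (p - q)| <= k + k.
  rewrite mulrBr !ler_norml => /andP[? ?] /andP[? ?]; apply/andP; split; lra.
move=> oO sf Ox; apply/eqP; rewrite -subr_eq0 -normr_le0; apply/ler_addgt0Pl => e e0.
rewrite addr0.
have e2 : 0 < e / 2 by rewrite divr_gt0.
have /nbhs_ballP[r1 /= r10 H1] := second_difference i j oO sf Ox e2.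
have /nbhs_ballP[r2 /= r20 H2] := second_difference j i oO sf Ox e2.
have [s s0 /andP[s1 s2]] : exists2 s : R, 0 < s & (s < r1) && (s < r2).
  exists (Num.min r1 r2 / 2); first by rewrite divr_gt0// lt_min r10.
  by rewrite !ltr_pdivrMr//; have := ge_min r1 r1 r2; have := ge_min r2 r1 r2; rewrite !lexx orbT /=; lra.
have := H1 s; have := H2 s; rewrite -!ball_normE /= !sub0r !normrN (gtr0_norm s0).
move=> /(_ s2) B /(_ s1) A.
  rewrite -(@ler_pM2l _ (s ^+ 2)); last exact: exprn_gt0.
rewrite -[in X in X * `|_|](gtr0_norm (exprn_gt0 2 s0)) -normrM.
have EC : x + s *: delta_mx 0 j + s *: delta_mx 0 i = x + s *: delta_mx 0 i + s *: delta_mx 0 j.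
  by rewrite addrAC.
rewrite EC in B.
have -> : s ^+ 2 * e = e / 2 * s ^+ 2 + e / 2 * s ^+ 2 by field.
exact: gen A B.
Qed.

End Taylor.

(** * Taylor expansion in r and Hadamard's lemma *)

Section Hadamard.
Context {R : realType} {d : nat}.
Implicit Types (f g : 'rV[R]_(d + 1) -> R) (z : 'rV[R]_(d + 1)) (O : set 'rV[R]_(d + 1)).

Notation rdir := (rshift d ord0 : 'I_(d + 1)).
Notation rd := (pderiv rdir).

Definition setr z (t : R) : 'rV[R]_(d + 1) := row_mx (lsubmx z) (const_mx t).

(** Setting r to 0 as a linear map, so that [has_pderiv_linear] differentiates f(x, 0). *)
Definition proj0_mx : 'M[R]_(d + 1) := block_mx 1%:M 0 0 0.

Lemma rcoord_setr z t : rcoord (setr z t) = t.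
Proof. by rewrite /rcoord /setr row_mxEr mxE. Qed.

Lemma setr_id z : setr z (rcoord z) = z.
Proof.
rewrite -[RHS]hsubmxK; congr row_mx; apply/rowP => j.
by rewrite !mxE (ord1 j).
Qed.

Lemma setr_setr z s t : setr (setr z s) t = setr z t.
Proof. by rewrite /setr row_mxKl. Qed.

Lemma setrE z t : setr z t = setr z 0 + t *: delta_mx 0 rdir.
Proof.
apply/rowP => j; rewrite !mxE; case: (split_ordP j) => i -> /=.
  by rewrite eq_lrshift ?andbF mulr0 addr0.
by rewrite !mxE (ord1 i) eqxx mulr1 add0r.
Qed.

Lemma setr0E z : setr z 0 = z *m proj0_mx.
Proof.
rewrite -{2}(hsubmxK z) /proj0_mx mul_row_block !mulmx0 mulmx1 !addr0.
by congr row_mx; apply/rowP => j; rewrite !mxE.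
Qed.

Lemma rd_setr f z (t : R) : differentiable f (setr z t) ->
  is_derive t (1 : R) (fun s => f (setr z s)) (rd f (setr z t)).
Proof.
rewrite setrE => df; have := is_derive_line df.
by under eq_fun do rewrite -setrE; rewrite /pderiv deriveE.
Qed.

(** Balls are boxes for the sup norm, so a box centred on the slice is stable under moving r towards
    0. *)
Lemma ball_setr x z e t : rcoord x = 0 -> ball x e z -> `|t| <= `|rcoord z| ->
  ball x e (setr z t).
Proof.
move=> x0 /ball_rVP[e0 H] tz; apply/ball_rVP; split => // j.
case: (split_ordP j) => i ->.
  by rewrite row_mxEl mxE; exact: H.
rewrite (ord1 i) row_mxEr mxE [x _ _]x0 sub0r normrN (le_lt_trans tz)//.
by have := H rdir; rewrite [x _ _]x0 sub0r normrN.
Qed.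

Lemma near_setr0 x (P : set 'rV[R]_(d + 1)) : rcoord x = 0 ->
  nbhs x P -> \forall z \near x, forall t, `|t| <= `|rcoord z| -> P (setr z t).
Proof.
move=> x0 /nbhs_ballP[e /= e0 H]; apply/nbhs_ballP; exists e => // z xz t tz.
by apply: H; exact: ball_setr.
Qed.

Lemma smooth_iter_rd O f j : smooth_open O f -> smooth_open O (iter j rd f).
Proof. by move=> sf; elim: j => //= j IH; exact: smooth_open_pderiv. Qed.

(** The r-derivative of the remainder of f is the remainder of [rd f] of one order less; the mean
    value theorem from r = 0 turns the bound on the latter into one on the former. The constant is
    uniform in z near x. *)
Lemma taylor_bound O f x N : open O -> smooth_open O f -> O x -> rcoord x = 0 ->
  exists2 C, 0 <= C & \forall z \near x,
    `|f z - \sum_(j < N) rcoord z ^+ j * (iter j rd f (setr z 0) / j`!%:R)| <= C * `|rcoord z| ^+ N.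
Proof.
move=> oO; elim: N f => [|N IH] f sf Ox x0.
  exists (`|f x| + 1); first by rewrite addr_ge0.
  have /cvgrPdist_le/(_ 1 ltr01) := smooth_open_continuous sf Ox.
  apply: filterS => z H; rewrite big_ord0 subr0 expr0 mulr1.
  rewrite -[f z](subrK (f x)) addrC (le_trans (ler_normD _ _))// lerD//.
  by rewrite distrC.
have [C C0 HC] := IH _ (smooth_open_pderiv rdir sf) Ox x0.
exists C => //.
have nO : nbhs x O by exact: open_nbhs_nbhs.
apply: filterS2 (near_setr0 x0 HC) (near_setr0 x0 nO) => z H1 H2.
pose phi t := f (setr z t) - \sum_(j < N.+1) t ^+ j * (iter j rd f (setr z 0) / j`!%:R).
pose dphi t := rd f (setr z t) - \sum_(j < N) t ^+ j * (iter j rd (rd f) (setr z 0) / j`!%:R).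
have D t : `|t| <= `|rcoord z| -> is_derive t (1 : R) phi (dphi t).
  move=> tz.
  have A := rd_setr (smooth_open_differentiable sf (H2 t tz)).
  pose p (j : 'I_N.+1) : R -> R := (iter j rd f (setr z 0) / j`!%:R) *: (fun t => t ^+ j).
  have B (j : 'I_N.+1) : is_derive t (1 : R) (p j) ((iter j rd f (setr z 0) / j`!%:R) *: (j%:R * t ^+ j.-1)).
    apply: is_deriveZ.
    have := is_deriveX j (@is_derive_id _ _ t (1 : R)).
    rewrite /GRing.scale /= mulr1; congr is_derive.
    by apply/funext => s; rewrite exprfctE.
  have S := is_derive_sum B.
  have E1 : (fun s => f (setr z s)) - \sum_j p j = phi.
    apply/funext => s; rewrite /phi /= fctE; congr (_ - _).
    by rewrite fct_sumE; apply: eq_bigr => j _; rewrite /p fctE /= [RHS]mulrC.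
  have E2 : rd f (setr z t) - \sum_(j < N.+1) (iter j rd f (setr z 0) / j`!%:R) *: (j%:R * t ^+ j.-1)
      = dphi t.
    rewrite /dphi; congr (_ - _).
    rewrite big_ord_recl /= mul0r scaler0 add0r; apply: eq_bigr => j _.
    rewrite /= -iterSr /bump /= add1n /GRing.scale /= factS natrM.
    have f0 : j`!%:R != 0 :> R by rewrite pnatr_eq0 -lt0n fact_gt0.
    have j0 : 1 + j%:R != 0 :> R by rewrite nat1r pnatr_eq0.
    by field; rewrite f0 j0.
  by rewrite -E1 -E2; exact: is_deriveB A S.
have [t tz E] := mvt_from0 D.
rewrite /phi setr_id in E.
have -> : f z - \sum_(j < N.+1) rcoord z ^+ j * (iter j rd f (setr z 0) / j`!%:R) = dphi t * rcoord z.
  rewrite -E [X in _ = _ - X](_ : _ = 0) ?subr0//.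
  rewrite big_ord_recl /= expr0 mul1r fact0 divr1 big1 ?addr0 ?subrr// => j _.
  by rewrite expr0n /= mul0r.
rewrite normrM exprSr mulrA ler_wpM2r//.
have := H1 t tz; rewrite rcoord_setr setr_setr => /le_trans; apply.
by rewrite ler_wpM2l// lerXn2r ?nnegrE.
Qed.


Lemma has_pderiv_rcoord i x : has_pderiv i (@rcoord R d) x (i == rdir)%:R.
Proof. by rewrite eq_sym; exact: has_pderiv_coord. Qed.

Lemma has_pderiv_proj0 f i x : differentiable f (setr x 0) ->
  has_pderiv i (fun z => f (setr z 0)) x (if i == rdir then 0 else pderiv i f (setr x 0)).
Proof.
rewrite setr0E => df; have := has_pderiv_linear i df.
under eq_fun do rewrite -setr0E.
congr has_pderiv; rewrite -setr0E.
case: (split_ordP i) => i' -> {i}.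
  rewrite eq_lrshift (bigD1 (lshift 1 i')) //= big1 ?addr0.
    by rewrite /proj0_mx block_mxEul mxE eqxx mul1r.
  move=> j; case: (split_ordP j) => j' -> {j}; rewrite /proj0_mx.
    by rewrite block_mxEul mxE (inj_eq (@lshift_inj _ _)) eq_sym => /negPf ->; rewrite mul0r.
  by rewrite block_mxEur mxE mul0r.
rewrite (ord1 i') eqxx big1 // => j _.
case: (split_ordP j) => j' -> {j}; rewrite /proj0_mx.
  by rewrite block_mxEdl mxE mul0r.
by rewrite block_mxEdr mxE mul0r.
Qed.

Lemma has_pderiv_quadratic (e : 'rV[R]_(d + 1) -> R) (C : R) i x : rcoord x = 0 -> 0 <= C ->
  (\forall z \near x, `|e z| <= C * `|rcoord z| ^+ 2) -> has_pderiv i e x 0.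
Proof.
move=> x0 C0 H.
have ex : e x = 0.
  by apply/eqP; rewrite -normr_le0; have := nbhs_singleton H; rewrite x0 normr0 expr0n mulr0.
pose L := 'd (cst 0 : 'rV[R]_(d + 1) -> R) x.
have L0 h : L h = 0 by rewrite /L diff_cst.
have [de dE] : differentiable e x /\ 'd e x = L :> ('rV[R]_(d + 1) -> R).
  apply: differentiable_eps; first exact: (diff_continuous (differentiable_cst _ _)).
  move=> eps eps0.
  have /nbhs_ballP[r /= r0 Hr] := H.
  (* This radius gives C |h| <= eps, and C + 1 avoids a division by zero. *)
  apply/nbhs_ballP; exists (Num.min r (eps / (C + 1))).
    by rewrite /= lt_min r0 divr_gt0// ltr_wpDl.
  move=> h; rewrite -ball_normE /= sub0r normrN lt_min => /andP[hr he].
  rewrite L0 ex !subr0.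
  have hh : `|rcoord (h + x)| <= `|h|.
    rewrite /rcoord mxE [x _ _]x0 addr0.
    by have := (@normr_rVP R _ h `|h| (normr_ge0 h)).1 (lexx _); apply.
  apply: le_trans (Hr _ _) _.
    by rewrite -ball_normE /= opprD addrCA subrr addr0 normrN.
  apply: (@le_trans _ _ (C * `|h| ^+ 2)).
    by rewrite ler_wpM2l// lerXn2r ?nnegrE.
  rewrite expr2 mulrA ler_wpM2r//.
  move: he; rewrite ltr_pdivlMr ?ltr_wpDl// mulrDr mulr1 mulrC.
  by have := normr_ge0 h; lra.
by split => //; rewrite /pderiv deriveE // dE L0.
Qed.

Definition vanishes O k f :=
  forall j, (j < k)%N -> forall z, O z -> rcoord z = 0 -> iter j rd f z = 0.

(* f / r^k, extended to the slice r = 0 by its limit. Functions of this form, for varying f and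
   k, are stable under partial derivatives, which is what makes [qdiv] smooth by coinduction. *)
Definition qdiv k f z : R :=
  if rcoord z == 0 then iter k rd f z / k`!%:R else f z / rcoord z ^+ k.

(** Near the slice f / r^k = A(x) + r B(x) + O(r^2), with A and B the Taylor coefficients of orders
    k and k + 1. Tangential derivatives come from A, the r-derivative from B, and the error has zero
    derivative. *)
Lemma has_pderiv_qdiv0 O k f i x : open O -> smooth_open O f -> vanishes O k f ->
  O x -> rcoord x = 0 ->
  has_pderiv i (qdiv k f) x (if i == rdir then iter k.+1 rd f x / (k.+1)`!%:R
                             else pderiv i (iter k rd f) x / k`!%:R).
Proof.
move=> oO sf vf Ox x0.
have xE : setr x 0 = x by rewrite -[in LHS]x0 setr_id.
pose A z := iter k rd f (setr z 0) / k`!%:R.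
pose B z := rcoord z * (iter k.+1 rd f (setr z 0) / (k.+1)`!%:R).
pose e z := qdiv k f z - A z - B z.
have nO : nbhs x O by exact: open_nbhs_nbhs.
(* Two orders beyond k, so that the remainder is still quadratic in r after division by r^k. *)
have [C C0 HC] := taylor_bound k.+2 oO sf Ox x0.
have He : has_pderiv i e x 0.
  apply: (has_pderiv_quadratic _ x0 C0).
  apply: filterS2 HC (near_setr0 x0 nO) => z H1 H2.
  have Oz : O (setr z 0) by apply: H2; rewrite normr0.
  rewrite !big_ord_recr big1 /= ?add0r in H1; last first.
    by move=> j _; rewrite vf ?mul0r ?mulr0 // rcoord_setr.
  rewrite /e /A /B /qdiv; case: eqP => [z0|/eqP z0].
    have zE : setr z 0 = z by rewrite -[in LHS]z0 setr_id.
    by rewrite zE z0 mul0r subrr subr0 normr0 expr0n mulr0.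
  have zk : 0 < `|rcoord z| ^+ k by rewrite exprn_gt0// normr_gt0.
  rewrite -(ler_pM2r zk) -mulrA -exprD (addnC 2) addn2.
  apply: le_trans H1; rewrite -normrX -normrM le_eqVlt; apply/orP; left; apply/eqP.
  by congr `|_|; rewrite !mulrBl mulfVK ?expf_neq0// exprS /=; ring.
have HA : has_pderiv i A x ((if i == rdir then 0 else pderiv i (iter k rd f) x) / k`!%:R).
  have dk : differentiable (iter k rd f) (setr x 0).
    by apply: smooth_open_differentiable (smooth_iter_rd k sf) _; rewrite xE.
  have := has_pderivM (has_pderiv_proj0 i dk) (has_pderiv_cst i (k`!%:R^-1) x).
  by rewrite mulr0 addr0 xE.
have HB : has_pderiv i B x ((i == rdir)%:R * (iter k.+1 rd f x / (k.+1)`!%:R)).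
  have dk : differentiable (iter k.+1 rd f) (setr x 0).
    by apply: smooth_open_differentiable (smooth_iter_rd k.+1 sf) _; rewrite xE.
  have := has_pderivM (has_pderiv_rcoord i x)
   (has_pderivM (has_pderiv_proj0 i dk) (has_pderiv_cst i ((k.+1)`!%:R^-1) x)).
  by rewrite x0 mul0r addr0 xE.
have := has_pderivD (has_pderivD HA HB) He.
rewrite (_ : (fun _ => _) = qdiv k f); last by apply/funext => z; rewrite /e; ring.
by congr has_pderiv; case: eqP => _; rewrite ?mul1r ?mul0r ?addr0 ?add0r.
Qed.

Lemma has_pderiv_qdivN k f i x : differentiable f x -> rcoord x != 0 ->
  has_pderiv i (qdiv k f) x (pderiv i f x / rcoord x ^+ k
     - (i == rdir)%:R * (k%:R * f x) / rcoord x ^+ k.+1).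
Proof.
move=> df x0.
apply: (@has_pderiv_near_eq _ _ _ (fun z => f z * (rcoord z ^+ k)^-1)).
  have := @coord_continuous R _ _ (0 : 'I_1) rdir x.
  move/cvgrPdist_lt => /(_ `|rcoord x|); rewrite normr_gt0 => /(_ x0).
  apply: filterS => z H; have z0 : rcoord z != 0.
    by apply: contraTneq H => z0; rewrite [z _ _]z0 subr0 ltxx.
  by rewrite /qdiv (negPf z0).
have xk : rcoord x ^+ k != 0 by rewrite expf_neq0.
have := has_pderivM (has_pderivP i df) (has_pderivV xk (has_pderivX k (has_pderiv_rcoord i x))).
congr has_pderiv; case: k xk => [|k] xk; first by rewrite !expr0; field.
by rewrite /= !exprS; field; rewrite x0 expf_neq0.
Qed.

Lemma iter_rd_pderivC O f i j z : open O -> smooth_open O f -> O z ->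
  iter j rd (pderiv i f) z = pderiv i (iter j rd f) z.
Proof.
move=> oO sf; elim: j z => //= j IH z Oz.
rewrite (@pderiv_near_eq _ _ _ _ (pderiv i (iter j rd f))).
  by apply: (pderivC _ _ oO _ Oz); exact: smooth_iter_rd.
by apply: (open_near_eq oO Oz) => y; rewrite inE => Oy; exact: IH.
Qed.

Lemma vanishes_pderiv O k f i : open O -> smooth_open O f -> vanishes O k f -> i != rdir ->
  vanishes O k (pderiv i f).
Proof.
move=> oO sf vf ir j jk z Oz z0.
rewrite (iter_rd_pderivC _ _ oO sf Oz).
have zE : setr z 0 = z by rewrite -[in LHS]z0 setr_id.
have dk : differentiable (iter j rd f) (setr z 0).
  by rewrite zE; exact: smooth_open_differentiable (smooth_iter_rd j sf) Oz.
have [_] := has_pderiv_proj0 i dk; rewrite (negPf ir) zE => <-.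
have nO : nbhs z O by exact: open_nbhs_nbhs.
rewrite (@pderiv_near_eq _ _ _ _ (fun=> 0)); first by have [_ ->] := has_pderiv_cst i 0 z.
apply: filterS (near_setr0 z0 nO) => y H.
by apply: vf; rewrite ?rcoord_setr //; apply: H; rewrite normr0.
Qed.

Lemma smooth_rcoord O : open O -> smooth_open O (@rcoord R d).
Proof. by move=> oO; exact: smooth_open_coord. Qed.

(** Here r f_r - k f is the numerator of the r-derivative of f / r^k over r^(k+1). The factor j - k
    shows that it vanishes to order k + 1 whenever f vanishes to order k, which keeps the class used
    for [smooth_qdiv] stable. *)
Lemma iter_rd_euler O f k j z : open O -> smooth_open O f -> O z ->
  iter j rd (fun y => rcoord y * rd f y - k * f y) z =
  rcoord z * iter j.+1 rd f z + (j%:R - k) * iter j rd f z.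
Proof.
move=> oO sf; elim: j z => [|j IH] z Oz; first by rewrite /= sub0r mulNr.
rewrite [LHS]/= (@pderiv_near_eq _ _ _ _ (fun z => rcoord z * iter j.+1 rd f z + (j%:R - k) * iter j rd f z)).
  have H n := has_pderiv_smooth rdir (smooth_iter_rd n sf) Oz.
  have [_ ->] := has_pderivD (has_pderivM (has_pderiv_rcoord rdir z) (H j.+1))
     (has_pderivM (has_pderiv_cst rdir (j%:R - k) z) (H j)).
  by rewrite eqxx /= -natr1; ring.
by apply: (open_near_eq oO Oz) => y; rewrite inE => Oy; exact: IH.
Qed.

Lemma smooth_qdiv O k f : open O -> smooth_open O f -> vanishes O k f -> smooth_open O (qdiv k f).
Proof.
move=> oO sf vf.
apply: (smooth_open_coind (C := fun h => exists k f, [/\ smooth_open O f, vanishes O k f & h = qdiv k f])) => //; last by exists k, f.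
- move=> {k f sf vf} _ [k [f [sf vf ->]]] x Ox.
  have [x0|x0] := eqVneq (rcoord x) 0.
    by have [] := has_pderiv_qdiv0 rdir oO sf vf Ox x0.
  by have [] := has_pderiv_qdivN k rdir (smooth_open_differentiable sf Ox) x0.
- move=> {k f sf vf} _ [k [f [sf vf ->]]] i.
  have [->|ir] := eqVneq i rdir; last first.
    exists (qdiv k (pderiv i f)).
      exists k, (pderiv i f); split => //; first exact: smooth_open_pderiv.
      exact: vanishes_pderiv.
    move=> x; rewrite inE => Ox; have [x0|x0] := eqVneq (rcoord x) 0.
      have [_ ->] := has_pderiv_qdiv0 i oO sf vf Ox x0.
      by rewrite (negPf ir) /qdiv x0 eqxx (iter_rd_pderivC _ _ oO sf Ox).
    have [_ ->] := has_pderiv_qdivN k i (smooth_open_differentiable sf Ox) x0.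
    by rewrite (negPf ir) /qdiv (negPf x0) !mul0r subr0.
  pose g z := rcoord z * rd f z - k%:R * f z.
  exists (qdiv k.+1 g).
    exists k.+1, g; split => //.
      apply: smooth_openB => //; apply: smooth_openM => //.
      - exact: smooth_rcoord.
      - exact: smooth_open_pderiv.
      - exact: smooth_open_cst.
    move=> j jk z Oz z0; rewrite (iter_rd_euler _ _ oO sf Oz) z0 mul0r add0r.
    move: jk; rewrite ltnS leq_eqVlt => /orP[/eqP ->|jk]; first by rewrite subrr mul0r.
    by rewrite vf // mulr0.
  move=> x; rewrite inE => Ox; have [x0|x0] := eqVneq (rcoord x) 0.
    have [_ ->] := has_pderiv_qdiv0 rdir oO sf vf Ox x0.
    rewrite eqxx /qdiv x0 eqxx (iter_rd_euler _ _ oO sf Ox) x0 mul0r add0r.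
    by rewrite -natr1 addrAC subrr add0r mul1r.
  have [_ ->] := has_pderiv_qdivN k rdir (smooth_open_differentiable sf Ox) x0.
  by rewrite eqxx /qdiv (negPf x0) mul1r /g exprS; field; rewrite x0 expf_neq0.
Qed.

Theorem hadamard O f : open O -> smooth_open O f ->
  (forall z, O z -> rcoord z = 0 -> f z = 0) ->
  exists2 g, smooth_open O g & forall z, O z -> f z = rcoord z * g z.
Proof.
move=> oO sf f0; exists (qdiv 1 f).
  by apply: smooth_qdiv => // -[|//] _; exact: f0.
move=> z Oz; rewrite /qdiv; case: eqP => [z0|/eqP z0]; first by rewrite z0 mul0r f0.
by rewrite expr1 mulrC mulfVK.
Qed.

End Hadamard.

(** * Flat functions *)

Section Flat.
Context {R : realType} {d : nat} {O : set 'rV[R]_(d + 1)} (oO : open O).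
Implicit Types (f g F G : 'rV[R]_(d + 1) -> R) (z : 'rV[R]_(d + 1)).

Notation rdir := (rshift d ord0 : 'I_(d + 1)).
Notation rd := (pderiv rdir).

Definition flat_to N F :=
  exists2 G, smooth_open O G & forall z, O z -> F z = rcoord z ^+ N * G z.

Definition flat F := forall N, flat_to N F.

Lemma flat_to0 F : smooth_open O F -> flat_to 0 F.
Proof. by move=> sF; exists F => // z _; rewrite expr0 mul1r. Qed.

Lemma flat_to_ext N F G : (forall z, O z -> F z = G z) -> flat_to N F -> flat_to N G.
Proof. by move=> FG [K sK E]; exists K => // z Oz; rewrite -FG// E. Qed.

Lemma flat_toD N F G : flat_to N F -> flat_to N G -> flat_to N (fun z => F z + G z).
Proof.
move=> [F' sF EF] [G' sG EG]; exists (fun z => F' z + G' z); first exact: smooth_openD.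
by move=> z Oz; rewrite EF// EG// mulrDr.
Qed.

Lemma flat_toMl N F G : smooth_open O F -> flat_to N G -> flat_to N (fun z => F z * G z).
Proof.
move=> sF [G' sG EG]; exists (fun z => F z * G' z); first exact: smooth_openM.
by move=> z Oz; rewrite EG// mulrCA.
Qed.

Lemma flat_toMr N F G : flat_to N F -> smooth_open O G -> flat_to N (fun z => F z * G z).
Proof. by move=> fF sG; under eq_fun do rewrite mulrC; exact: flat_toMl. Qed.

Lemma flat_toN N F : flat_to N F -> flat_to N (fun z => - F z).
Proof.
move=> fF; under eq_fun do rewrite -mulN1r; apply: flat_toMl => //; exact: smooth_open_cst.
Qed.

Lemma flat_toB N F G : flat_to N F -> flat_to N G -> flat_to N (fun z => F z - G z).
Proof. by move=> fF /flat_toN; exact: flat_toD. Qed.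

Lemma flat_to_le M N F : (M <= N)%N -> flat_to N F -> flat_to M F.
Proof.
move=> MN [G sG E]; exists (fun z => rcoord z ^+ (N - M) * G z).
  by apply: smooth_openM => //; apply: smooth_openX => //; exact: smooth_rcoord.
by move=> z Oz; rewrite mulrA -exprD subnKC// E.
Qed.

Lemma flat_to_rM N F : flat_to N F -> flat_to N.+1 (fun z => rcoord z * F z).
Proof. by move=> [G sG E]; exists G => // z Oz; rewrite E// mulrA -exprS. Qed.

Lemma flat_to_sum N (I : Type) (r : seq I) (P : pred I) (F : I -> 'rV[R]_(d + 1) -> R) :
  (forall i, P i -> flat_to N (F i)) -> flat_to N (fun z => \sum_(i <- r | P i) F i z).
Proof.
move=> H; elim: r => [|i r IH].
  under eq_fun do rewrite big_nil; exists (fun=> 0); first exact: smooth_open_cst.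
  by move=> z _; rewrite mulr0.
under eq_fun do rewrite big_cons.
by case Pi: (P i) => //; apply: flat_toD => //; exact: H.
Qed.

Lemma flat_to_pderiv N F i : i != rdir -> flat_to N F -> flat_to N (pderiv i F).
Proof.
move=> ir [G sG E]; exists (pderiv i G); first exact: smooth_open_pderiv.
move=> z Oz; rewrite (@pderiv_near_eq _ _ _ _ (fun z => rcoord z ^+ N * G z)); last first.
  by apply: (open_near_eq oO Oz) => y; rewrite inE; exact: E.
have [_ ->] := has_pderivM (has_pderivX N (has_pderiv_rcoord i z)) (has_pderiv_smooth i sG Oz).
by rewrite (negPf ir) mulr0 !mul0r add0r.
Qed.

Lemma flat_to_rd N F : flat_to N.+1 F -> flat_to N (rd F).
Proof.
move=> [G sG E]; exists (fun z => N.+1%:R * G z + rcoord z * rd G z).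
  apply: smooth_openD => //; apply: smooth_openM => //.
  - exact: smooth_open_cst.
  - exact: smooth_rcoord.
  - exact: smooth_open_pderiv.
move=> z Oz; rewrite (@pderiv_near_eq _ _ _ _ (fun z => rcoord z ^+ N.+1 * G z)); last first.
  by apply: (open_near_eq oO Oz) => y; rewrite inE; exact: E.
have [_ ->] := has_pderivM (has_pderivX N.+1 (has_pderiv_rcoord rdir z)) (has_pderiv_smooth rdir sG Oz).
by rewrite eqxx mulr1 /= exprS; ring.
Qed.

(* on the slice r = 0, f is the r-derivative of r * f *)
Lemma smooth_rM_eq0 f : smooth_open O f -> (forall z, O z -> rcoord z * f z = 0) ->
  forall z, O z -> f z = 0.
Proof.
move=> sf H z Oz; have [z0|z0] := eqVneq (rcoord z) 0; last first.
  by apply/(mulfI z0); rewrite mulr0 H.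
have [_] := has_pderivM (has_pderiv_rcoord rdir z) (has_pderiv_smooth rdir sf Oz).
rewrite z0 mul0r addr0 eqxx mul1r => <-.
rewrite (@pderiv_near_eq _ _ _ _ (fun=> 0)); first by have [_ ->] := has_pderiv_cst rdir 0 z.
by apply: (open_near_eq oO Oz) => y; rewrite inE; exact: H.
Qed.

Lemma smooth_rM_inj f g : smooth_open O f -> smooth_open O g ->
  (forall z, O z -> rcoord z * f z = rcoord z * g z) -> forall z, O z -> f z = g z.
Proof.
move=> sf sg H z Oz; apply/eqP; rewrite -subr_eq0; apply/eqP.
apply: (@smooth_rM_eq0 (fun z => f z - g z)) => //; first exact: smooth_openB.
by move=> y Oy; rewrite mulrBr H// subrr.
Qed.

(** Pointwise cancellation fails on the slice itself; smoothness of both sides determines the value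
    there. *)
Lemma flat_to_cancel N F : smooth_open O F -> flat_to N.+1 (fun z => rcoord z * F z) ->
  flat_to N F.
Proof.
move=> sF [G sG E]; exists G => //; apply: smooth_rM_inj => //.
  by apply: smooth_openM => //; apply: smooth_openX => //; exact: smooth_rcoord.
by move=> z Oz; rewrite E// exprS mulrA.
Qed.

Lemma smooth_rXM_inj N f g : smooth_open O f -> smooth_open O g ->
  (forall z, O z -> rcoord z ^+ N * f z = rcoord z ^+ N * g z) -> forall z, O z -> f z = g z.
Proof.
elim: N f g => [|N IH] f g sf sg H z Oz; first by have := H z Oz; rewrite expr0 !mul1r.
apply: (smooth_rM_inj sf sg) => // y Oy.
apply: (IH (fun z => rcoord z * f z) (fun z => rcoord z * g z)) => //.
- by apply: smooth_openM => //; exact: smooth_rcoord.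
- by apply: smooth_openM => //; exact: smooth_rcoord.
- by move=> w Ow; rewrite !mulrA -exprSr H.
Qed.

(** If F = r^(N+1) G and F_r = r^(N+1) K, then (N + 1) G = r (K - G_r), so G is divisible by r. The
    statement starts at order one: vanishing on the slice, the initial condition, has to be supplied
    separately. *)
Lemma flat_toS N F : flat_to N.+1 F -> flat_to N.+1 (rd F) -> flat_to N.+2 F.
Proof.
move=> [G sG EG] [K sK EK].
exists (fun z => N.+1%:R^-1 * (K z - rd G z)).
  apply: smooth_openM => //; first exact: smooth_open_cst.
  by apply: smooth_openB => //; exact: smooth_open_pderiv.
have E1 z : O z -> rcoord z ^+ N * (N.+1%:R * G z) = rcoord z ^+ N * (rcoord z * (K z - rd G z)).
  move=> Oz; have := EK z Oz.
  rewrite (@pderiv_near_eq _ _ _ _ (fun z => rcoord z ^+ N.+1 * G z)); last first.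
    by apply: (open_near_eq oO Oz) => y; rewrite inE; exact: EG.
  have [_ ->] := has_pderivM (has_pderivX N.+1 (has_pderiv_rcoord rdir z)) (has_pderiv_smooth rdir sG Oz).
  rewrite eqxx mulr1 /= exprS => H.
  have -> : rcoord z ^+ N * (rcoord z * (K z - rd G z)) = rcoord z * rcoord z ^+ N * K z
     - rcoord z * rcoord z ^+ N * rd G z by ring.
  by rewrite -H; ring.
move=> z Oz; rewrite EG// [rcoord z ^+ N.+2]exprSr -mulrA; congr (_ * _).
have E2 : N.+1%:R * G z = rcoord z * (K z - rd G z).
  apply: (smooth_rXM_inj _ _ E1 Oz).
    by apply: smooth_openM => //; exact: smooth_open_cst.
  apply: smooth_openM => //; first exact: smooth_rcoord.
  by apply: smooth_openB => //; exact: smooth_open_pderiv.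
by rewrite mulrCA -E2 mulKf ?pnatr_eq0.
Qed.

Lemma near_slice_pos (P : set 'rV[R]_(d + 1)) x : nbhs x P -> rcoord x = 0 ->
  forall e : R, 0 < e -> exists2 z, P z & 0 < rcoord z < e.
Proof.
move=> /nbhs_ballP[r /= r0 H] x0 e e0.
have [t t0 /andP[tr te]] : exists2 t : R, 0 < t & (t < r) && (t < e).
  exists (Num.min r e / 2); first by rewrite divr_gt0// lt_min r0.
  by rewrite !ltr_pdivrMr//; have := ge_min r r e; have := ge_min e r e; rewrite !lexx orbT /=; lra.
exists (setr x t); last by rewrite rcoord_setr t0.
apply: H; apply/ball_rVP; split => // j; case: (split_ordP j) => i ->.
  by rewrite row_mxEl mxE subrr normr0.
by rewrite (ord1 i) row_mxEr mxE [x _ _]x0 sub0r normrN gtr0_norm.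
Qed.

(** Write F = r^N G. If G were nonzero at a slice point, |F| would exceed a multiple of r^N nearby,
    against the bound of order N + 1 at small r > 0. Hence G vanishes on the slice and Hadamard's
    lemma extracts one more r. *)
Lemma bigO_flat F : smooth_open O F ->
  (forall x, O x -> rcoord x = 0 -> forall N, exists C,
     \forall z \near x, 0 < rcoord z -> `|F z| <= C * rcoord z ^+ N) ->
  flat F.
Proof.
move=> sF H; elim=> [|N [G sG EG]]; first exact: flat_to0.
have [z Oz z0|K sK EK] := hadamard oO sG; last first.
  by exists K => // z Oz; rewrite EG// EK// exprSr mulrA.
apply/eqP; apply: contraT => Gz.
have [C HC] := H z Oz z0 N.+1.
have g2 : 0 < `|G z| / 2 by rewrite divr_gt0 // normr_gt0.
have /cvgrPdist_lt/(_ _ g2) cG := smooth_open_continuous sG Oz.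
have nO : nbhs z O by exact: open_nbhs_nbhs.
have C1 : 0 < `|C| + 1 by rewrite ltr_wpDl.
(* The bound on r makes C r smaller than |G z| / 2, while |G y| stays above |G z| / 2 by
   continuity. *)
have [|y [[Hy Gy] Oy] /andP[y0 ye]] :=
  near_slice_pos (filterI (filterI HC cG) nO) z0 (_ : 0 < `|G z| / 2 / (`|C| + 1)).
  by rewrite divr_gt0.
have := Hy y0; rewrite (EG y Oy) normrM gtr0_norm ?exprn_gt0// exprSr mulrCA ler_pM2l ?exprn_gt0// => A.
move: ye; rewrite ltr_pdivlMr// => ye.
have B : `|G z| <= `|G z - G y| + `|G y|.
  by rewrite -[X in `|X| <= _](subrK (G y)) ler_normD.
have D : C * rcoord y <= rcoord y * (`|C| + 1).
  rewrite mulrC ler_wpM2l ?(ltW y0)//; have := ler_norm C; lra.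
by lra.
Qed.

Lemma flat_to_bound N F x : flat_to N F -> O x ->
  exists C, \forall z \near x, `|F z| <= C * `|rcoord z| ^+ N.
Proof.
move=> [G sG EG] Ox; exists (`|G x| + 1).
have /cvgrPdist_lt/(_ 1 ltr01) cG := smooth_open_continuous sG Ox.
have nO : nbhs x O by exact: open_nbhs_nbhs.
apply: filterS2 cG nO => z Gz Oz.
rewrite EG// normrM normrX mulrC ler_wpM2r ?exprn_ge0//.
have B : `|G z| <= `|G x - G z| + `|G x|.
  by rewrite distrC -[X in `|X| <= _](subrK (G x)) ler_normD.
by lra.
Qed.

End Flat.

(** * Functions of x alone on the collar, and restriction to r = 0 *)

Section BoundaryFunctions.
Context {R : realType} {d : nat}.

Lemma rshift_neq_lshift (i : 'I_d) : (lshift 1 i == rshift d ord0 :> 'I_(d + 1)) = false.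
Proof. exact: eq_lrshift. Qed.

Lemma has_pderiv_lsubmx (f : 'rV[R]_d -> R) i (z : 'rV[R]_(d + 1)) : differentiable f (lsubmx z) ->
  has_pderiv (lshift 1 i) (fun y => f (lsubmx y)) z (pderiv i f (lsubmx z)).
Proof.
move=> df.
have := @has_pderiv_comp R _ _ (fun y : 'rV[R]_(d + 1) => lsubmx y) f (lshift 1 i) z
  (fun j => (j == i)%:R) _ df.
case=> [j|dc H].
  under eq_fun do rewrite mxE; rewrite -(inj_eq (@lshift_inj _ 1)); exact: has_pderiv_coord.
split => //; rewrite H (bigD1 i) //= eqxx mul1r big1 ?addr0//.
by move=> j /negPf ->; rewrite mul0r.
Qed.

Lemma has_rd_lsubmx (f : 'rV[R]_d -> R) (z : 'rV[R]_(d + 1)) : differentiable f (lsubmx z) ->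
  has_pderiv (rshift d ord0) (fun y => f (lsubmx y)) z 0.
Proof.
move=> df.
have := @has_pderiv_comp R _ _ (fun y : 'rV[R]_(d + 1) => lsubmx y) f (rshift d ord0) z
  (fun j => 0) _ df.
case=> [j|dc H].
  under eq_fun do rewrite mxE.
  by have := has_pderiv_coord (rshift d ord0) (lshift 1 j) z; rewrite rshift_neq_lshift.
by split => //; rewrite H big1 // => j _; rewrite mul0r.
Qed.

Lemma smooth_lsubmx (O : set 'rV[R]_(d + 1)) (O0 : set 'rV[R]_d) f : open O ->
  smooth_open O0 f -> (forall z, O z -> O0 (lsubmx z)) -> smooth_open O (fun z => f (lsubmx z)).
Proof.
move=> oO sf sub; apply: (smooth_open_comp oO sf) => // j.
by under eq_fun do rewrite mxE; exact: smooth_open_coord.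
Qed.

Definition at0 (x : 'rV[R]_d) : 'rV[R]_(d + 1) := row_mx x 0.

Lemma lsubmx_at0 x : lsubmx (at0 x) = x. Proof. exact: row_mxKl. Qed.
Lemma rcoord_at0 x : rcoord (at0 x) = 0. Proof. by rewrite /rcoord row_mxEr mxE. Qed.
Lemma at0_lsubmx (z : 'rV[R]_(d + 1)) : at0 (lsubmx z) = setr z 0.
Proof. by rewrite /at0 /setr; congr row_mx; apply/rowP => j; rewrite !mxE. Qed.

Lemma has_pderiv_at0 (F : 'rV[R]_(d + 1) -> R) i x : differentiable F (at0 x) ->
  has_pderiv i (fun y => F (at0 y)) x (pderiv (lshift 1 i) F (at0 x)).
Proof.
move=> dF.
have := @has_pderiv_comp R _ _ at0 F i x (fun j => (j == lshift 1 i)%:R) _ dF.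
case=> [j|dc H]; last first.
  split => //; rewrite H (bigD1 (lshift 1 i)) //= eqxx mul1r big1 ?addr0//.
  by move=> j /negPf ->; rewrite mul0r.
case: (split_ordP j) => j' ->.
  by under eq_fun do rewrite row_mxEl; rewrite (inj_eq (@lshift_inj _ _)); exact: has_pderiv_coord.
under eq_fun do rewrite row_mxEr mxE.
by rewrite eq_rlshift; exact: has_pderiv_cst.
Qed.

Lemma smooth_at0 (O0 : set 'rV[R]_d) (O : set 'rV[R]_(d + 1)) F : open O0 ->
  smooth_open O F -> (forall x, O0 x -> O (at0 x)) -> smooth_open O0 (fun x => F (at0 x)).
Proof.
move=> oO sF sub; apply: (smooth_open_comp oO sF) => // j.
case: (split_ordP j) => j' ->.
  by under eq_fun do rewrite row_mxEl; exact: smooth_open_coord.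
by under eq_fun do rewrite row_mxEr mxE; exact: smooth_open_cst.
Qed.

End BoundaryFunctions.

(** * Consequences of the isometry equation in a chart *)

(** The product of dX^I and dX^J when dX^I = dx^I + t a, to be used with t = r^2 and A the
    cometric. *)
Lemma delta_quadratic (R : comPzRingType) n (A : 'M[R]_n) (a b : 'I_n -> R) I J t :
  \sum_i \sum_j A i j * ((I == i)%:R + t * a i) * ((J == j)%:R + t * b j)
  = A I J + t * (\sum_j A I j * b j + \sum_i A i J * a i + t * \sum_i \sum_j A i j * a i * b j).
Proof.
have E i : \sum_j A i j * ((I == i)%:R + t * a i) * ((J == j)%:R + t * b j) =
   ((I == i)%:R + t * a i) * (A i J + t * \sum_j A i j * b j).
  rewrite (eq_bigr (fun j => ((I == i)%:R + t * a i) * (A i j * (J == j)%:R) +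
     ((I == i)%:R + t * a i) * (t * (A i j * b j)))); last by move=> j _; ring.
  rewrite big_split /= -!mulr_sumr -mulrDr; congr (_ * (_ + _)).
  rewrite (bigD1 J) //= eqxx mulr1 big1 ?addr0// => j; rewrite eq_sym => /negPf ->.
  by rewrite mulr0.
rewrite (eq_bigr _ (fun i _ => E i)).
rewrite (eq_bigr (fun i => (I == i)%:R * (A i J + t * \sum_j A i j * b j) +
   (t * (A i J * a i) + t * (t * \sum_j A i j * a i * b j)))); last first.
  move=> i _; rewrite mulrDl; congr (_ + _).
  have -> : \sum_j A i j * a i * b j = a i * \sum_j A i j * b j.
    by rewrite mulr_sumr; apply: eq_bigr => j _; ring.
  by ring.
rewrite big_split /= big_split /= -!mulr_sumr.
have dsum (c : 'I_n -> R) : \sum_(i < n) (I == i)%:R * c i = c I.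
  rewrite (bigD1 I) //= eqxx mul1r big1 ?addr0 // => i; rewrite eq_sym => /negPf ->.
  by rewrite mul0r.
by rewrite dsum; ring.
Qed.

(** An exact remainder for the warping factors a^-2 and b^-2; its value l / 2 at t = 0 is the origin
    of the terms lambda / 2 and lambdahat / 2 at order r^2. *)
Lemma inv_sqr_expand (R : numFieldType) (l t : R) : 1 - 4^-1 * l * t != 0 ->
  ((1 - 4^-1 * l * t) ^+ 2)^-1 =
  1 + t * ((l / 2 - 16^-1 * l ^+ 2 * t) * ((1 - 4^-1 * l * t) ^+ 2)^-1).
Proof.
set A := 1 - 4^-1 * l * t => A0.
have E : t * (l / 2 - 16^-1 * l ^+ 2 * t) = 1 - A ^+ 2 by rewrite /A; field.
by rewrite mulrA E mulrBl mul1r mulfV ?expf_neq0 // addrC subrK.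
Qed.

Section FlatMatrices.
Context {R : realType} {d : nat} {O : set 'rV[R]_(d + 1)} (oO : open O).

Definition smooth_mx e (U : set 'rV[R]_e) p q (A : 'rV[R]_e -> 'M[R]_(p, q)) :=
  forall i j, smooth_open U (fun z => A z i j).

Definition flat_mx p q (A : 'rV[R]_(d + 1) -> 'M[R]_(p, q)) :=
  forall i j, flat (O := O) (fun z => A z i j).

Lemma flat_mx_mull p q s (A : 'rV[R]_(d + 1) -> 'M[R]_(p, q)) (T : 'rV[R]_(d + 1) -> 'M[R]_(q, s)) :
  smooth_mx O A -> flat_mx T -> flat_mx (fun z => A z *m T z).
Proof.
move=> sA fT i j N; under eq_fun do rewrite mxE.
by apply: flat_to_sum => // k _; apply: flat_toMl => //; exact: fT.
Qed.

Lemma flat_mx_mulr p q s (T : 'rV[R]_(d + 1) -> 'M[R]_(p, q)) (A : 'rV[R]_(d + 1) -> 'M[R]_(q, s)) :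
  flat_mx T -> smooth_mx O A -> flat_mx (fun z => T z *m A z).
Proof.
move=> fT sA i j N; under eq_fun do rewrite mxE.
by apply: flat_to_sum => // k _; apply: flat_toMr => //; exact: fT.
Qed.

Lemma flat_mx_ext p q (T U : 'rV[R]_(d + 1) -> 'M[R]_(p, q)) :
  (forall z, O z -> T z = U z) -> flat_mx T -> flat_mx U.
Proof.
by move=> TU fT i j N; apply: flat_to_ext (fT i j N) => // z Oz; rewrite TU.
Qed.

Lemma flat_ext (F G : 'rV[R]_(d + 1) -> R) : (forall z, O z -> F z = G z) ->
  flat (O := O) F -> flat (O := O) G.
Proof. by move=> FG fF N; exact: flat_to_ext FG (fF N). Qed.

Lemma smooth_mx_block e (U : set 'rV[R]_e) n (A : 'rV[R]_e -> 'M[R]_n) : open U ->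
  smooth_mx U A -> smooth_mx U (fun z => block_mx (A z) 0 0 1%:M : 'M[R]_(n + 1)).
Proof.
move=> oU sA i j; case: (split_ordP i) => i' ->; case: (split_ordP j) => j' ->.
- by under eq_fun do rewrite block_mxEul; exact: sA.
- by under eq_fun do rewrite block_mxEur mxE; exact: smooth_open_cst.
- by under eq_fun do rewrite block_mxEdl mxE; exact: smooth_open_cst.
- by under eq_fun do rewrite block_mxEdr mxE; exact: smooth_open_cst.
Qed.

(* the congruence U^T N U of N = diag(A, 1) *)
Lemma congr_blockE n (U : 'M[R]_(n + 1)) (A : 'M[R]_n) c e :
  (U *m (block_mx A 0 0 1%:M : 'M[R]_(n + 1)) *m U^T) c e =
  \sum_i \sum_j A i j * U c (lshift 1 i) * U e (lshift 1 j)
  + U c (rshift n ord0) * U e (rshift n ord0).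
Proof.
rewrite !mxE big_split_ord /= big_ord1; congr (_ + _); last first.
  rewrite !mxE big_split_ord /= big_ord1 big1 ?add0r.
    by rewrite block_mxEdr mxE eqxx mulr1.
  by move=> i _; rewrite block_mxEur mxE mulr0.
rewrite exchange_big /=; apply: eq_bigr => j _.
rewrite !mxE big_split_ord /= big_ord1 block_mxEdl mxE mulr0 addr0 mulr_suml.
by apply: eq_bigr => i _; rewrite block_mxEul [_ * A i j]mulrC.
Qed.

End FlatMatrices.

Ltac prove_smooth :=
  repeat first [ assumption | exact: smooth_rcoord | apply: smooth_open_cst
    | apply: smooth_openB | apply: smooth_openD | apply: smooth_openN
    | apply: smooth_openM | apply: smooth_openX | apply: smooth_open_pderiv
    | apply: smooth_open_sum => ? _ ].

(** * The isometry equation in coordinates: x ranges over B, the components X of Phi over the larger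
    B' *)

Section Core.
Context {R : realType} {n : nat} (O : set 'rV[R]_(n + 1)) (B B' : set 'rV[R]_n).
Context (oO : open O) (oB : open B) (oB' : open B') (BB' : B `<=` B').
Context (OB : forall z, O z -> B (lsubmx z)) (BO : forall x, B x -> O (at0 x)).
Context (lambda lambdah : R) (G Gh : 'rV[R]_n -> 'M[R]_n).
Context (sG : smooth_mx B' G) (sGh : smooth_mx B' Gh)
  (uG : forall x, B' x -> G x \in unitmx) (uGh : forall x, B' x -> Gh x \in unitmx)
  (symG : forall x, B' x -> (G x)^T = G x).
Context (P : 'rV[R]_(n + 1) -> 'rV[R]_(n + 1)) (mm : 'rV[R]_(n + 1) -> R).
Context (sP : forall j, smooth_open O (fun z => P z 0 j))
  (PB' : forall z, O z -> B' (lsubmx (P z)))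
  (P0 : forall x, B x -> P (at0 x) = at0 x)
  (smm : smooth_open O mm) (mm0 : forall z, O z -> mm z != 0)
  (Pm : forall z, O z -> rcoord (P z) = rcoord z * mm z)
  (uJ : forall z, O z -> jacobian P z \in unitmx).

Notation r := (@rcoord R n).
Notation rdir := (rshift n ord0 : 'I_(n + 1)).
Notation rd := (pderiv rdir).
Notation D i := (pderiv (lshift 1 i : 'I_(n + 1))).
Notation flat := (flat (O := O)).
Notation flat_to := (flat_to (O := O)).

Let X (i : 'I_n) z := P z 0 (lshift 1 i).
Let aa z := 1 - 4^-1 * lambda * r z ^+ 2.
Let bb z := 1 - 4^-1 * lambdah * r (P z) ^+ 2.
Context (aa0 : forall z, O z -> aa z != 0) (bb0 : forall z, O z -> bb z != 0).
Let H x := invmx (G x).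
Let Hh x := invmx (Gh x).

(* rho^2 (Phi^* ghat_+ - g_+), where Phi = P = (X, rho) and rho = r m *)
Definition conformal_defect z : 'M[R]_(n + 1) :=
  jacobian P z *m (block_mx (bb z ^+ 2 *: Gh (lsubmx (P z))) 0 0 1%:M : 'M[R]_(n + 1))
    *m (jacobian P z)^T
  - mm z ^+ 2 *: (block_mx (aa z ^+ 2 *: G (lsubmx z)) 0 0 1%:M : 'M[R]_(n + 1)).

Context (fT : flat_mx (O := O) conformal_defect).

Lemma smooth_r : smooth_open O r. Proof. exact: smooth_rcoord. Qed.
Lemma smooth_aa : smooth_open O aa. Proof. by have := smooth_r; rewrite /aa => ?; prove_smooth. Qed.
Lemma smooth_bb : smooth_open O bb. Proof. have := sP rdir; rewrite /bb /rcoord => ?; prove_smooth. Qed.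

Lemma jacobian_pderiv z i j : O z -> jacobian P z i j = pderiv i (fun y => P y 0 j) z.
Proof. by move=> Oz; apply: jacobianE => k; exact: smooth_open_differentiable (sP k) Oz. Qed.

Lemma smooth_jacobian : smooth_mx O (jacobian P).
Proof.
move=> i j; apply: (@smooth_open_ext _ _ _ (pderiv i (fun y => P y 0 j))) => //.
  by move=> z; rewrite inE => Oz; rewrite jacobian_pderiv.
exact: smooth_open_pderiv.
Qed.

Lemma smooth_cometric : smooth_mx B' H.
Proof. by move=> i j; exact: (smooth_open_invmx oB' sG uG). Qed.

Lemma smooth_cometrich : smooth_mx B' Hh.
Proof. by move=> i j; exact: (smooth_open_invmx oB' sGh uGh). Qed.

Lemma smooth_cometric_lsubmx i j : smooth_open O (fun z => H (lsubmx z) i j).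
Proof. by apply: (smooth_lsubmx oO (smooth_cometric i j)) => z /OB /BB'. Qed.

Lemma smooth_cometrich_comp i j : smooth_open O (fun z => Hh (lsubmx (P z)) i j).
Proof.
apply: (smooth_open_comp oO (smooth_cometrich i j)) => // k.
by under eq_fun do rewrite mxE; exact: sP.
Qed.

(** If T = J Gh J^T - m^2 G is flat, then J^T G^-1 J - m^2 Gh^-1 = Gh^-1 J^-1 T G^-1 J is flat too,
    where G and Gh denote the two block matrices. Inversion is thus an exact identity that is linear
    in T. *)
Lemma cometric_flat : flat_mx (O := O) (fun z =>
  (jacobian P z)^T *m (block_mx ((aa z ^+ 2)^-1 *: H (lsubmx z)) 0 0 1%:M : 'M[R]_(n + 1)) *m jacobian P z
  - mm z ^+ 2 *: (block_mx ((bb z ^+ 2)^-1 *: Hh (lsubmx (P z))) 0 0 1%:M : 'M[R]_(n + 1))).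
Proof.
pose N z : 'M[R]_(n + 1) := block_mx ((aa z ^+ 2)^-1 *: H (lsubmx z)) 0 0 1%:M.
pose Nh z : 'M[R]_(n + 1) := block_mx ((bb z ^+ 2)^-1 *: Hh (lsubmx (P z))) 0 0 1%:M.
have sN : smooth_mx O N.
  apply: smooth_mx_block => // i j; under eq_fun do rewrite mxE.
  apply: smooth_openM => //; last exact: smooth_cometric_lsubmx.
  apply: smooth_openV => //; first by apply: smooth_openX => //; exact: smooth_aa.
  by move=> z Oz; rewrite expf_neq0 ?aa0.
have sNh : smooth_mx O Nh.
  apply: smooth_mx_block => // i j; under eq_fun do rewrite mxE.
  apply: smooth_openM => //; last exact: smooth_cometrich_comp.
  apply: smooth_openV => //; first by apply: smooth_openX => //; exact: smooth_bb.
  by move=> z Oz; rewrite expf_neq0 ?bb0.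
have siJ : smooth_mx O (fun z => invmx (jacobian P z)).
  by move=> i j; exact: (smooth_open_invmx oO smooth_jacobian uJ).
apply: flat_mx_ext (flat_mx_mulr oO (flat_mx_mulr oO (flat_mx_mull oO sNh (flat_mx_mull oO siJ fT)) sN) smooth_jacobian) => z Oz.
rewrite -/(N z) -/(Nh z) /conformal_defect.
set G1 := block_mx (bb z ^+ 2 *: _) _ _ _; set G0 := block_mx (aa z ^+ 2 *: _) _ _ _.
have E0 : G0 *m N z = 1%:M.
  rewrite /G0 /N mulmx_block !mulmx0 !mul0mx !addr0 !add0r mulmx1.
  rewrite -scalemxAl -scalemxAr scalerA mulfV ?expf_neq0 ?aa0// scale1r mulmxV ?uG//; last exact/BB'/OB.
  by rewrite -scalar_mx_block.
have E1 : Nh z *m G1 = 1%:M.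
  rewrite /G1 /Nh mulmx_block !mulmx0 !mul0mx !addr0 !add0r mulmx1.
  rewrite -scalemxAl -scalemxAr scalerA mulVf ?expf_neq0 ?bb0// scale1r mulVmx ?uGh//; last exact: PB'.
  by rewrite -scalar_mx_block.
have uJz := uJ Oz; set J := jacobian P z in uJz *.
rewrite mulmxBr mulmxBr !mulmxBl; congr (_ - _).
  by rewrite !mulmxA -[_ *m invmx J *m J]mulmxA mulVmx // mulmx1 E1 mul1mx.
rewrite -!scalemxAr -!scalemxAl; congr (_ *: _).
by rewrite -!mulmxA [G0 *m _]mulmxA E0 mul1mx mulVmx // mulmx1.
Qed.

Let ip (f g : 'rV[R]_(n + 1) -> R) z := \sum_i \sum_j H (lsubmx z) i j * D i f z * D j g z.

Lemma cometric_flatE c e : flat (fun z => (aa z ^+ 2)^-1 * ip (fun y => P y 0 c) (fun y => P y 0 e) z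
   + rd (fun y => P y 0 c) z * rd (fun y => P y 0 e) z
   - mm z ^+ 2 * (block_mx ((bb z ^+ 2)^-1 *: Hh (lsubmx (P z))) 0 0 1%:M : 'M[R]_(n + 1)) c e).
Proof.
apply: flat_ext (cometric_flat c e) => z Oz.
rewrite [LHS]mxE; congr (_ + _); last by rewrite !mxE.
have tE i j : (jacobian P z)^T i j = pderiv j (fun y => P y 0 i) z.
  by rewrite mxE jacobian_pderiv.
rewrite -[X in _ *m X]trmxK congr_blockE; congr (_ + _); last by rewrite !tE.
rewrite /ip mulr_sumr; apply: eq_bigr => i _; rewrite mulr_sumr; apply: eq_bigr => j _.
by rewrite !tE mxE; ring.
Qed.

Lemma smooth_ip f g : smooth_open O f -> smooth_open O g -> smooth_open O (ip f g).
Proof.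
move=> sf sg; apply: smooth_open_sum => // i _; apply: smooth_open_sum => // j _.
by apply: smooth_openM => //; [apply: smooth_openM => //; [exact: smooth_cometric_lsubmx|]|]; exact: smooth_open_pderiv.
Qed.

Lemma smooth_aaV2 : smooth_open O (fun z => (aa z ^+ 2)^-1).
Proof.
apply: smooth_openV => //; first by apply: smooth_openX => //; exact: smooth_aa.
by move=> z Oz; rewrite expf_neq0 ?aa0.
Qed.

Lemma D_rho i z : O z -> D i (fun y => P y 0 rdir) z = r z * D i mm z.
Proof.
move=> Oz; rewrite (@pderiv_near_eq _ _ _ _ (fun y => r y * mm y)); last first.
  by apply: (open_near_eq oO Oz) => y; rewrite inE; exact: Pm.
have [_ ->] := has_pderivM (has_pderiv_rcoord (lshift 1 i) z) (has_pderiv_smooth (lshift 1 i) smm Oz).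
by rewrite rshift_neq_lshift mul0r add0r.
Qed.

Lemma rd_rho z : O z -> rd (fun y => P y 0 rdir) z = mm z + r z * rd mm z.
Proof.
move=> Oz; rewrite (@pderiv_near_eq _ _ _ _ (fun y => r y * mm y)); last first.
  by apply: (open_near_eq oO Oz) => y; rewrite inE; exact: Pm.
have [_ ->] := has_pderivM (has_pderiv_rcoord rdir z) (has_pderiv_smooth rdir smm Oz).
by rewrite eqxx mul1r.
Qed.

Lemma ip_rho f z : O z -> ip f (fun y => P y 0 rdir) z = r z * ip f mm z.
Proof.
move=> Oz; rewrite /ip mulr_sumr; apply: eq_bigr => i _; rewrite mulr_sumr; apply: eq_bigr => j _.
by rewrite D_rho//; ring.
Qed.

(** This is (|d rho|^2 - m^2) / r for the metric dr^2 + a^2 g, with rho = r m. *)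
Definition eikonal z := 2 * mm z * rd mm z + r z * rd mm z ^+ 2
  + r z * (aa z ^+ 2)^-1 * ip mm mm z.

Lemma smooth_eikonal : smooth_open O eikonal.
Proof.
have := smooth_r; have := smooth_aaV2; have := smooth_ip smm smm; have := smooth_open_pderiv rdir smm.
by rewrite /eikonal => ? ? ? ?; prove_smooth.
Qed.

Lemma eikonal_flat : flat eikonal.
Proof.
move=> N; apply: flat_to_cancel => //; first exact: smooth_eikonal.
have := cometric_flatE rdir rdir; move/(_ N.+1); apply: flat_to_ext => z Oz.
rewrite block_mxEdr mxE eqxx ip_rho// rd_rho//.
have -> : ip (fun y => P y 0 rdir) mm z = r z * ip mm mm z.
  rewrite /ip mulr_sumr; apply: eq_bigr => i _; rewrite mulr_sumr; apply: eq_bigr => j _.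
  by rewrite D_rho//; ring.
by rewrite mulr1 /eikonal; ring.
Qed.

(** The pairing of dX^I with d rho for dr^2 + a^2 g; it would vanish for an exact isometry, X being
    constant along the gradient lines of rho. *)
Definition transport I z := rd (X I) z * (mm z + r z * rd mm z)
  + r z * (aa z ^+ 2)^-1 * ip (X I) mm z.

Lemma transport_flat I : flat (transport I).
Proof.
apply: flat_ext (cometric_flatE (lshift 1 I) rdir) => z Oz.
by rewrite block_mxEur mxE ip_rho// rd_rho// /transport /X; ring.
Qed.

Lemma metric_flat I J : flat (fun z => (aa z ^+ 2)^-1 * ip (X I) (X J) z
   + rd (X I) z * rd (X J) z - mm z ^+ 2 * ((bb z ^+ 2)^-1 * Hh (lsubmx (P z)) I J)).
Proof.
apply: flat_ext (cometric_flatE (lshift 1 I) (lshift 1 J)) => z Oz.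
by rewrite block_mxEul mxE.
Qed.

Lemma at0_near (x : 'rV[R]_n) : B x -> \forall y \near x, B y.
Proof. by move=> Bx; exact: open_nbhs_nbhs. Qed.

Lemma X_at0 x I : B x -> X I (at0 x) = x 0 I.
Proof. by move=> Bx; rewrite /X P0// /at0 row_mxEl. Qed.

Lemma D_at0 f i x : smooth_open O f -> B x -> D i f (at0 x) = pderiv i (fun y => f (at0 y)) x.
Proof.
by move=> sf Bx; have [_ ->] := has_pderiv_at0 i (smooth_open_differentiable sf (BO Bx)).
Qed.

Lemma DX_at0 x i I : B x -> D i (X I) (at0 x) = (I == i)%:R.
Proof.
move=> Bx; rewrite D_at0//; last exact: sP.
rewrite (@pderiv_near_eq _ _ _ _ (fun y => y 0 I)); last first.
  by apply: filterS (at0_near Bx) => y By; rewrite X_at0.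
by have [_ ->] := has_pderiv_coord i I x.
Qed.

Lemma aa_at0 x : aa (at0 x) = 1.
Proof. by rewrite /aa rcoord_at0 expr0n mulr0 subr0. Qed.

Lemma bb_at0 x : B x -> bb (at0 x) = 1.
Proof. by move=> Bx; rewrite /bb P0// rcoord_at0 expr0n mulr0 subr0. Qed.

Lemma flat_to_at0 N f x : flat_to N.+1 f -> B x -> f (at0 x) = 0.
Proof. by move=> [g _ E] Bx; rewrite E ?rcoord_at0 ?expr0n ?mul0r//; exact: BO. Qed.

Let m0 x := mm (at0 x).

(** On the slice the tangential block of the Jacobian is the identity and the tangential derivatives
    of rho vanish. The conformal factor is thus recovered from the isometry, as the square of m0. *)
Lemma boundary_metric x : B x -> Gh x = m0 x ^+ 2 *: G x.
Proof.
move=> Bx; apply/matrixP => i j; rewrite [RHS]mxE /m0.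
have := flat_to_at0 (fT (lshift 1 i) (lshift 1 j) 1%N) Bx.
rewrite /conformal_defect mxE [X in _ + X]mxE.
move/eqP; rewrite subr_eq0 => /eqP.
rewrite congr_blockE [RHS]mxE block_mxEul [in RHS]mxE aa_at0 expr1n mul1r lsubmx_at0.
rewrite !(jacobian_pderiv _ _ (BO Bx)) !D_rho; [|exact: BO..].
rewrite rcoord_at0 !mul0r addr0 P0 // lsubmx_at0 => <-.
rewrite (bigD1 i) //= [X in _ + X]big1 ?addr0; last first.
  move=> k ki; rewrite big1 // => l _; rewrite jacobian_pderiv; last exact: BO.
  by have := DX_at0 i k Bx; rewrite /X => ->; rewrite (negPf ki) mulr0 mul0r.
rewrite (bigD1 j) //= [X in _ + X]big1 ?addr0; last first.
  move=> k kj; rewrite !jacobian_pderiv; try exact: BO.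
  by have := DX_at0 j k Bx; rewrite /X => ->; rewrite (negPf kj) mulr0.
rewrite !jacobian_pderiv; try exact: BO.
have := DX_at0 i i Bx; have := DX_at0 j j Bx; rewrite /X => -> ->.
by rewrite !eqxx !mulr1 mxE bb_at0 // expr1n mul1r.
Qed.

Lemma m0_neq0 x : B x -> m0 x != 0. Proof. by move=> Bx; apply: mm0; exact: BO. Qed.

Lemma smooth_m0 : smooth_open B m0. Proof. exact: smooth_at0 smm BO. Qed.

Lemma boundary_cometric x : B x -> Hh x = (m0 x ^+ 2)^-1 *: H x.
Proof.
move=> Bx; have m0x := m0_neq0 Bx; have Gx := uG (BB' Bx).
rewrite /Hh boundary_metric // /H.
by rewrite invmxZ ?unitmxZ ?unitfE ?expf_neq0.
Qed.

Context (hr : forall z, O z -> mm z + r z * rd mm z != 0).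

Lemma smooth_rd_rho : smooth_open O (fun z => mm z + r z * rd mm z).
Proof. by have := smooth_r; have := smooth_open_pderiv rdir smm; move=> ? ?; prove_smooth. Qed.

(** The transport equation is solved for X_r, whose coefficient m + r m_r is invertible; all other
    terms carry a factor r or are flat. *)
Lemma rdX_flat1 I : flat_to 1 (rd (X I)).
Proof.
apply: (@flat_to_ext _ _ _ _ (fun z => (mm z + r z * rd mm z)^-1 *
   (transport I z - r z * ((aa z ^+ 2)^-1 * ip (X I) mm z)))).
  by move=> z Oz; have := hr Oz => h; rewrite /transport; have h' := aa0 Oz; field; rewrite h h'.
apply: flat_toMl => //; first by apply: smooth_openV => //; exact: smooth_rd_rho.
apply: flat_toB => //; first exact: transport_flat.
apply: flat_to_rM; apply: flat_to0; apply: smooth_openM => //; first exact: smooth_aaV2.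
by apply: smooth_ip => //; exact: sP.
Qed.

Lemma rdm_flat1 : flat_to 1 (rd mm).
Proof.
have srm := smooth_open_pderiv rdir smm.
apply: (@flat_to_ext _ _ _ _ (fun z => (2 * mm z)^-1 *
   (eikonal z - r z * (rd mm z ^+ 2 + (aa z ^+ 2)^-1 * ip mm mm z)))).
  move=> z Oz; have := mm0 Oz => h; rewrite /eikonal.
  by have := aa0 Oz => h'; field; rewrite h h'.
apply: flat_toMl => //.
  apply: smooth_openV => //; first by prove_smooth.
  by move=> z Oz; rewrite mulf_neq0 ?mm0 ?pnatr_eq0.
apply: flat_toB => //; first exact: eikonal_flat.
apply: flat_to_rM; apply: flat_to0; have := smooth_ip smm smm; have := smooth_aaV2 => ? ?; prove_smooth.
Qed.

(** X - x and m - m0 vanish on the slice together with their r-derivatives, so [flat_toS] extracts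
    r^2. [Xi] and [m2] are full smooth remainders, not just coefficients, so that the equations can
    be divided by powers of r before r is set to 0. *)
Lemma second_order_expansion : exists Xi : 'I_n -> 'rV[R]_(n + 1) -> R, exists m2,
  [/\ forall I, smooth_open O (Xi I), smooth_open O m2,
      forall I z, O z -> X I z = z 0 (lshift 1 I) + r z ^+ 2 * Xi I z &
      forall z, O z -> mm z = m0 (lsubmx z) + r z ^+ 2 * m2 z].
Proof.
have AX I : flat_to 2 (fun z => X I z - z 0 (lshift 1 I)).
  have sf : smooth_open O (fun z => X I z - z 0 (lshift 1 I)).
    by apply: smooth_openB => //; [exact: sP|exact: smooth_open_coord].
  apply: flat_toS => //.
    have [z Oz z0|g sg E] := hadamard oO sf; last by exists g => // z Oz; rewrite expr1 E.
    rewrite -(setr_id z) z0 -at0_lsubmx X_at0 ?at0_lsubmx; last exact: OB.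
    by rewrite /setr row_mxEl subrr.
  apply: flat_to_ext (rdX_flat1 I) => z Oz.
  have [_ ->] := has_pderivB (has_pderiv_smooth rdir (sP (lshift 1 I)) Oz)
    (has_pderiv_coord rdir (lshift 1 I) z).
  by rewrite rshift_neq_lshift subr0.
have sm0l : smooth_open O (fun z => m0 (lsubmx z)) by apply: (smooth_lsubmx oO smooth_m0).
have Am : flat_to 2 (fun z => mm z - m0 (lsubmx z)).
  have sf : smooth_open O (fun z => mm z - m0 (lsubmx z)) by prove_smooth.
  apply: flat_toS => //.
    have [z Oz z0|g sg E] := hadamard oO sf; last by exists g => // z Oz; rewrite expr1 E.
    by rewrite /m0 at0_lsubmx -[in setr _ _]z0 setr_id subrr.
  apply: flat_to_ext rdm_flat1 => z Oz.
  have [_ ->] := has_pderivB (has_pderiv_smooth rdir smm Oz)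
    (has_rd_lsubmx (smooth_open_differentiable smooth_m0 (OB Oz))).
  by rewrite subr0.
have /fin_all_exists2[Xi sXi EX] I := AX I.
have [m2 sm2 Em] := Am.
exists Xi, m2; split => // [I z Oz|z Oz].
  by rewrite -EX// addrC subrK.
by rewrite -Em// addrC subrK.
Qed.

(** * Taylor coefficients of order r^2 at the boundary *)

Section SecondOrder.
Context (Xi : 'I_n -> 'rV[R]_(n + 1) -> R) (m2 : 'rV[R]_(n + 1) -> R)
  (sXi : forall I, smooth_open O (Xi I)) (sm2 : smooth_open O m2)
  (EX : forall I z, O z -> X I z = z 0 (lshift 1 I) + r z ^+ 2 * Xi I z)
  (Em : forall z, O z -> mm z = m0 (lsubmx z) + r z ^+ 2 * m2 z).

Lemma rd_X_expand I z : O z -> rd (X I) z = r z * (2 * Xi I z + r z * rd (Xi I) z).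
Proof.
move=> Oz; rewrite (@pderiv_near_eq _ _ _ _ (fun z => z 0 (lshift 1 I) + r z ^+ 2 * Xi I z)); last first.
  by apply: (open_near_eq oO Oz) => y; rewrite inE; exact: EX.
have [_ ->] := has_pderivD (has_pderiv_coord rdir (lshift 1 I) z)
  (has_pderivM (has_pderivX 2 (has_pderiv_rcoord rdir z)) (has_pderiv_smooth rdir (sXi I) Oz)).
by rewrite rshift_neq_lshift eqxx add0r mulr1 /=; ring.
Qed.

Lemma D_X_expand i I z : O z -> D i (X I) z = (I == i)%:R + r z ^+ 2 * D i (Xi I) z.
Proof.
move=> Oz; rewrite (@pderiv_near_eq _ _ _ _ (fun z => z 0 (lshift 1 I) + r z ^+ 2 * Xi I z)); last first.
  by apply: (open_near_eq oO Oz) => y; rewrite inE; exact: EX.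
have [_ ->] := has_pderivD (has_pderiv_coord (lshift 1 i) (lshift 1 I) z)
  (has_pderivM (has_pderivX 2 (has_pderiv_rcoord (lshift 1 i) z)) (has_pderiv_smooth (lshift 1 i) (sXi I) Oz)).
by rewrite rshift_neq_lshift (inj_eq (@lshift_inj _ _)) mulr0 !mul0r add0r.
Qed.

Lemma rd_mm_expand z : O z -> rd mm z = r z * (2 * m2 z + r z * rd m2 z).
Proof.
move=> Oz; rewrite (@pderiv_near_eq _ _ _ _ (fun z => m0 (lsubmx z) + r z ^+ 2 * m2 z)); last first.
  by apply: (open_near_eq oO Oz) => y; rewrite inE; exact: Em.
have [_ ->] := has_pderivD (has_rd_lsubmx (smooth_open_differentiable smooth_m0 (OB Oz)))
  (has_pderivM (has_pderivX 2 (has_pderiv_rcoord rdir z)) (has_pderiv_smooth rdir sm2 Oz)).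
by rewrite eqxx add0r mulr1 /=; ring.
Qed.

(** The transport equation divided by r, at r = 0. In terms of sigma = 1 / m0 it says that [Xi]
    restricts to grad sigma / (2 sigma). *)
Lemma Xi_at0 I x : B x ->
  2 * m0 x * Xi I (at0 x) + \sum_j H x I j * pderiv j m0 x = 0.
Proof.
move=> Bx.
have sXi' := smooth_open_pderiv rdir (sXi I).
have srm := smooth_open_pderiv rdir smm.
pose f z := (2 * Xi I z + r z * rd (Xi I) z) * (mm z + r z * rd mm z)
  + (aa z ^+ 2)^-1 * ip (X I) mm z.
have ff : flat_to 1 f.
  apply: flat_to_cancel => //.
    have := smooth_r; have := smooth_aaV2; have := smooth_ip (sP (lshift 1 I)) smm; rewrite /f => ? ? ?.
    have ? := sXi I; prove_smooth.
  apply: flat_to_ext (transport_flat I 2) => z Oz.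
  by rewrite /transport rd_X_expand// /f; ring.
have := flat_to_at0 ff Bx; rewrite /f rcoord_at0 aa_at0 !mul0r !addr0 expr1n invr1 mul1r.
rewrite /ip lsubmx_at0 (bigD1 I) //= [X in _ + (_ + X)]big1 ?addr0; last first.
  move=> i iI; rewrite big1// => j _.
  by rewrite DX_at0// eq_sym (negPf iI) mulr0 mul0r.
move=> E; rewrite -[RHS]E /m0; congr (_ + _); first by ring.
by apply: eq_bigr => j _; rewrite DX_at0// eqxx mulr1 D_at0.
Qed.

Lemma m2_at0 x : B x ->
  4 * m0 x * m2 (at0 x) + \sum_i \sum_j H x i j * pderiv i m0 x * pderiv j m0 x = 0.
Proof.
move=> Bx.
have sm2' := smooth_open_pderiv rdir sm2.
have srm := smooth_open_pderiv rdir smm.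
pose f z := 2 * mm z * (2 * m2 z + r z * rd m2 z) + rd mm z ^+ 2 + (aa z ^+ 2)^-1 * ip mm mm z.
have ff : flat_to 1 f.
  apply: flat_to_cancel => //.
    have := smooth_r; have := smooth_aaV2; have := smooth_ip smm smm; rewrite /f => ? ? ?; prove_smooth.
  apply: flat_to_ext (eikonal_flat 2) => z Oz.
  by rewrite /eikonal {1}rd_mm_expand// /f; ring.
have := flat_to_at0 ff Bx; rewrite /f rcoord_at0 aa_at0 !mul0r !addr0 expr1n invr1 mul1r.
rewrite rd_mm_expand ?rcoord_at0; last exact: BO.
rewrite mul0r expr0n addr0 /ip lsubmx_at0 => E; rewrite -[RHS]E; congr (_ + _); first by rewrite /m0; ring.
by apply: eq_bigr => i _; apply: eq_bigr => j _; rewrite !D_at0.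
Qed.

Lemma Hh_expansion I J : exists2 h2, smooth_open O h2 &
  (forall z, O z -> Hh (lsubmx (P z)) I J = Hh (lsubmx z) I J + r z ^+ 2 * h2 z) /\
  (forall x, B x -> h2 (at0 x) = \sum_k Xi k (at0 x) * pderiv k (fun y => Hh y I J) x).
Proof.
pose q z := Hh (lsubmx (P z)) I J - Hh (lsubmx z) I J.
have sq : smooth_open O q.
  apply: smooth_openB => //; first exact: smooth_cometrich_comp.
  by apply: (smooth_lsubmx oO (smooth_cometrich I J)) => z /OB /BB'.
have rdq z : O z -> rd q z = \sum_k rd (X k) z * pderiv k (fun y => Hh y I J) (lsubmx (P z)).
  move=> Oz.
  have A : has_pderiv rdir (fun z => Hh (lsubmx (P z)) I J) z
      (\sum_k rd (X k) z * pderiv k (fun y => Hh y I J) (lsubmx (P z))).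
    apply: (@has_pderiv_comp _ _ _ (fun z => lsubmx (P z)) (fun y => Hh y I J)) => [k|].
      by under eq_fun do rewrite mxE; apply: has_pderiv_smooth Oz; exact: sP.
    exact: smooth_open_differentiable (smooth_cometrich I J) (PB' Oz).
  have Bz := BB' (OB Oz).
  have [_ ->] := has_pderivB A (has_rd_lsubmx (smooth_open_differentiable (smooth_cometrich I J) Bz)).
  by rewrite subr0.
have sdH k : smooth_open O (fun z => pderiv k (fun y => Hh y I J) (lsubmx (P z))).
  apply: (smooth_open_comp oO (smooth_open_pderiv k (smooth_cometrich I J))) => // j.
  by under eq_fun do rewrite mxE; exact: sP.
have [h2 sh2 Eh] : flat_to 2 q.
  apply: flat_toS => //.
    have [z Oz z0|g sg E] := hadamard oO sq; last by exists g => // z Oz; rewrite expr1 E.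
    rewrite /q -{1}(setr_id z) z0 -at0_lsubmx P0 ?lsubmx_at0 ?subrr//; exact: OB.
  apply: (@flat_to_ext _ _ _ _ (fun z => \sum_k rd (X k) z * pderiv k (fun y => Hh y I J) (lsubmx (P z)))).
    by move=> z Oz; rewrite rdq.
  by apply: flat_to_sum => // k _; apply: flat_toMr => //; exact: rdX_flat1.
exists h2 => //; split => [z Oz|x Bx]; first by rewrite -Eh// /q addrC subrK.
have sh2' := smooth_open_pderiv rdir sh2.
(* Both sides are the r-derivative of [q], computed from its expansion and by the chain rule; one
   factor r is then cancelled. *)
have E1 z : O z -> r z * (2 * h2 z + r z * rd h2 z) =
    r z * \sum_k (2 * Xi k z + r z * rd (Xi k) z) * pderiv k (fun y => Hh y I J) (lsubmx (P z)).
  move=> Oz; transitivity (rd q z).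
    rewrite (@pderiv_near_eq _ _ _ q (fun z => r z ^+ 2 * h2 z)); last first.
      by apply: (open_near_eq oO Oz) => y; rewrite inE; exact: Eh.
    have [_ ->] := has_pderivM (has_pderivX 2 (has_pderiv_rcoord rdir z)) (has_pderiv_smooth rdir sh2 Oz).
    by rewrite eqxx mulr1 /=; ring.
  rewrite rdq // mulr_sumr; apply: eq_bigr => k _; rewrite rd_X_expand//; ring.
have E2 : 2 * h2 (at0 x) + r (at0 x) * rd h2 (at0 x) =
    \sum_k (2 * Xi k (at0 x) + r (at0 x) * rd (Xi k) (at0 x)) * pderiv k (fun y => Hh y I J) (lsubmx (P (at0 x))).
  have sr' := smooth_r.
  apply: (smooth_rM_inj oO _ _ E1); first by prove_smooth.
  - apply: smooth_open_sum => // k _; have := sXi k; have := smooth_open_pderiv rdir (sXi k); have := sdH k.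
    by move=> ? ? ?; prove_smooth.
  - exact: BO.
have two : (2 : R) != 0 by rewrite pnatr_eq0.
apply: (mulfI two); move: E2; rewrite rcoord_at0 mul0r addr0 => ->.
rewrite mulr_sumr; apply: eq_bigr => k _.
by rewrite mul0r addr0 P0// lsubmx_at0 mulrA.
Qed.

(** The r^2-coefficient of [metric_flat]. The product X_r X_r gives 4 Xi Xi, a^-2 gives lambda / 2,
    and the pairing of the dX gives the derivatives of [Xi]. On the target side m^2 contributes 2 m0
    m2, b^-2 contributes lambdahat / 2 times m0^4 because rho = r m, and moving the base point from
    x to X differentiates the cometric along [Xi]. *)
Lemma second_order_metric I J x : B x ->
  4 * Xi I (at0 x) * Xi J (at0 x) + lambda / 2 * H x I J
  + (\sum_j H x I j * pderiv j (fun y => Xi J (at0 y)) x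
     + \sum_i H x i J * pderiv i (fun y => Xi I (at0 y)) x)
  - (2 * m0 x * m2 (at0 x) * Hh x I J + lambdah / 2 * m0 x ^+ 4 * Hh x I J
     + m0 x ^+ 2 * \sum_k Xi k (at0 x) * pderiv k (fun y => Hh y I J) x) = 0.
Proof.
move=> Bx; have [h2 sh2 [Eh h2at0]] := Hh_expansion I J.
pose m0l (z : 'rV[R]_(n + 1)) := m0 (lsubmx z).
pose a2 z := (lambda / 2 - 16^-1 * lambda ^+ 2 * r z ^+ 2) * (aa z ^+ 2)^-1.
pose bi z := (bb z ^+ 2)^-1.
pose b2 z := mm z ^+ 2 * (lambdah / 2 - 16^-1 * lambdah ^+ 2 * (r z ^+ 2 * mm z ^+ 2)) * bi z.
pose W z := \sum_j H (lsubmx z) I j * D j (Xi J) z + \sum_i H (lsubmx z) i J * D i (Xi I) z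
   + r z ^+ 2 * ip (Xi I) (Xi J) z.
pose u K z := 2 * Xi K z + r z * rd (Xi K) z.
pose HP z := Hh (lsubmx (P z)) I J.
(* The left side of [metric_flat] equals r^2 [K2]: the terms of order zero cancel by
   [boundary_cometric]. *)
pose K2 z := u I z * u J z + a2 z * ip (X I) (X J) z + W z
   - ((2 * m0l z * m2 z + r z ^+ 2 * m2 z ^+ 2) * bi z * HP z + m0l z ^+ 2 * b2 z * HP z
      + m0l z ^+ 2 * h2 z).
have sm0l : smooth_open O m0l by apply: (smooth_lsubmx oO smooth_m0).
have sbi : smooth_open O bi.
  apply: smooth_openV => //; first by apply: smooth_openX => //; exact: smooth_bb.
  by move=> z Oz; rewrite expf_neq0 ?bb0.
have sa2 : smooth_open O a2 by have := smooth_r; have := smooth_aaV2; rewrite /a2 => ? ?; prove_smooth.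
have sb2 : smooth_open O b2 by have := smooth_r; rewrite /b2 => ?; prove_smooth.
have su K : smooth_open O (u K).
  by have := smooth_r; have := sXi K; have := smooth_open_pderiv rdir (sXi K); rewrite /u => ? ? ?; prove_smooth.
have sW : smooth_open O W.
  apply: smooth_openD => //; first (apply: smooth_openD => //;
    by apply: smooth_open_sum => // j _; apply: smooth_openM => //; [exact: smooth_cometric_lsubmx|exact: smooth_open_pderiv]).
  by apply: smooth_openM => //; [apply: smooth_openX => //; exact: smooth_r|exact: smooth_ip].
have sHP : smooth_open O HP := smooth_cometrich_comp I J.
have sipX : smooth_open O (ip (X I) (X J)) := smooth_ip (sP _) (sP _).
have sK2 : smooth_open O K2.
  by have := smooth_r; have := su I; have := su J; rewrite /K2 => ? ? ?; prove_smooth.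
have EipX z : O z -> ip (X I) (X J) z = H (lsubmx z) I J + r z ^+ 2 * W z.
  move=> Oz; rewrite /W /ip -delta_quadratic.
  by apply: eq_bigr => i _; apply: eq_bigr => j _; rewrite !D_X_expand.
have K2f : flat_to 1 K2.
  apply: flat_to_cancel => //; apply: flat_to_cancel => //.
    by have := smooth_r => ?; prove_smooth.
  apply: flat_to_ext (metric_flat I J 3) => z Oz.
  have ha := aa0 Oz; have hb := bb0 Oz.
  have Ea : (aa z ^+ 2)^-1 = 1 + r z ^+ 2 * a2 z.
    by rewrite {1}/aa inv_sqr_expand // /a2 /aa.
  have Eb : (bb z ^+ 2)^-1 = 1 + r z ^+ 2 * b2 z.
    have e : bb z = 1 - 4^-1 * lambdah * (r z ^+ 2 * mm z ^+ 2) by rewrite /bb Pm// exprMn.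
    rewrite {1}e inv_sqr_expand -?e // /b2 /bi; ring.
  have Emm : mm z ^+ 2 = m0l z ^+ 2 + r z ^+ 2 * (2 * m0l z * m2 z + r z ^+ 2 * m2 z ^+ 2).
    by rewrite {1}Em// -/(m0l z); ring.
  have E0 : H (lsubmx z) I J = m0l z ^+ 2 * Hh (lsubmx z) I J.
    have Bz := OB Oz; rewrite boundary_cometric// mxE mulrA mulfV ?mul1r//.
    by rewrite expf_neq0 // m0_neq0.
  rewrite !rd_X_expand // -/(u I z) -/(u J z) Emm -/(bi z) -/(HP z).
  have -> : (aa z ^+ 2)^-1 * ip (X I) (X J) z = H (lsubmx z) I J + r z ^+ 2 * W z + r z ^+ 2 * a2 z * ip (X I) (X J) z.
    by rewrite Ea mulrDl mul1r {1}EipX.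
  have EHP : HP z = Hh (lsubmx z) I J + r z ^+ 2 * h2 z := Eh z Oz.
  have -> : (m0l z ^+ 2 + r z ^+ 2 * (2 * m0l z * m2 z + r z ^+ 2 * m2 z ^+ 2)) * (bi z * HP z)
    = m0l z ^+ 2 * (HP z + r z ^+ 2 * b2 z * HP z) + r z ^+ 2 * (2 * m0l z * m2 z + r z ^+ 2 * m2 z ^+ 2) * bi z * HP z.
    by rewrite [bi z]Eb; ring.
  rewrite {1}EHP E0 /K2; ring.
have := flat_to_at0 K2f Bx.
rewrite /K2 /u /W /a2 /b2 /bi /m0l /HP rcoord_at0 aa_at0 bb_at0 // P0 // lsubmx_at0 h2at0 //.
move=> E; rewrite -[RHS]E EipX ?rcoord_at0; last exact: BO.
have -> : \sum_j H x I j * D j (Xi J) (at0 x) = \sum_j H x I j * pderiv j (fun y => Xi J (at0 y)) x.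
  by apply: eq_bigr => j _; rewrite D_at0.
have -> : \sum_i H x i J * D i (Xi I) (at0 x) = \sum_i H x i J * pderiv i (fun y => Xi I (at0 y)) x.
  by apply: eq_bigr => i _; rewrite D_at0.
rewrite lsubmx_at0 !expr1n invr1 /m0.
set S1 := \sum_j _; set S2 := \sum_i _; set S3 := \sum_k _.
by field.
Qed.


End SecondOrder.

(** * The function sigma: its Hessian and the gradient of tau *)

Let sig x := (m0 x)^-1.

Lemma m0_sigV x : m0 x = (sig x)^-1. Proof. by rewrite /sig invrK. Qed.

Lemma smooth_sig : smooth_open B sig.
Proof. by apply: smooth_openV => //; [exact: smooth_m0|exact: m0_neq0]. Qed.

Lemma sig_neq0 x : B x -> sig x != 0. Proof. by move=> Bx; rewrite invr_neq0 ?m0_neq0. Qed.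

(** [Y] is the g-gradient of sigma, and [psi] below is |d sigma|^2. *)
Let Y I x := \sum_j H x I j * pderiv j sig x.
Let psi x := \sum_i Y i x * pderiv i sig x.

Lemma smooth_cometric_B : smooth_mx B H.
Proof. by move=> i j; apply: smooth_open_sub BB' (smooth_cometric i j). Qed.

Lemma smooth_Y I : smooth_open B (Y I).
Proof.
apply: smooth_open_sum => // j _; apply: smooth_openM => //; first exact: smooth_cometric_B.
by apply: smooth_open_pderiv; exact: smooth_sig.
Qed.

Lemma smooth_psi : smooth_open B psi.
Proof.
apply: smooth_open_sum => // j _; apply: smooth_openM => //; first exact: smooth_Y.
by apply: smooth_open_pderiv; exact: smooth_sig.
Qed.

Lemma H_sym x i j : B x -> H x i j = H x j i.
Proof.
move=> Bx; rewrite -[in LHS](_ : (H x)^T = H x) ?mxE//.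
by rewrite /H trmx_inv symG//; exact: BB'.
Qed.

Lemma pderiv_m0 j x : B x -> pderiv j m0 x = - pderiv j sig x * ((sig x)^-1 * (sig x)^-1).
Proof.
move=> Bx; have [_ <-] := has_pderivV (sig_neq0 Bx) (has_pderiv_smooth j smooth_sig Bx).
by congr pderiv; apply/funext => y; rewrite invrK.
Qed.

(** The left side is minus the Lie derivative of the cometric along grad sigma, that is twice the
    Hessian of sigma with raised indices. Written in this way it needs no connection and matches
    [second_order_metric] term by term. *)
Lemma hessian_sig I J x : B x ->
  \sum_l H x I l * pderiv l (Y J) x + \sum_k H x k J * pderiv k (Y I) x
  - \sum_k Y k x * pderiv k (fun y => H y I J) x
  = ((psi x + lambdah) / sig x - lambda * sig x) * H x I J.
Proof.
have [Xi [m2 [sXi sm2 EX Em]]] := second_order_expansion.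
move=> Bx; have s0 := sig_neq0 Bx.
have XiE K y : B y -> Xi K (at0 y) = Y K y / (2 * sig y).
  move=> By; have t0 := sig_neq0 By.
  have := Xi_at0 sXi EX K By.
  rewrite (m0_sigV y).
  have -> : \sum_j H y K j * pderiv j m0 y = - Y K y * ((sig y)^-1 * (sig y)^-1).
    by rewrite /Y -sumrN mulr_suml; apply: eq_bigr => j _; rewrite pderiv_m0//; ring.
  move=> E; have -> : Xi K (at0 y) = sig y / 2 * (2 / sig y * Xi K (at0 y)) by field.
  rewrite (_ : 2 / sig y * _ = Y K y * ((sig y)^-1 * (sig y)^-1)); first by field.
  by apply/eqP; rewrite -subr_eq0 -mulNr E.
have m2E : m2 (at0 x) = - psi x / (4 * sig x ^+ 3).
  have := m2_at0 sm2 Em Bx.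
  rewrite (m0_sigV x).
  have -> : \sum_i \sum_j H x i j * pderiv i m0 x * pderiv j m0 x = psi x / sig x ^+ 4.
    rewrite /psi mulr_suml; apply: eq_bigr => i _; rewrite /Y !mulr_suml; apply: eq_bigr => j _.
    by rewrite !pderiv_m0//; field.
  move=> E; have -> : m2 (at0 x) = sig x / 4 * (4 / sig x * m2 (at0 x)) by field.
  rewrite (_ : 4 / sig x * _ = - (psi x / sig x ^+ 4)); first by field.
  by apply/eqP; rewrite -subr_eq0 opprK E.
have dXi K k : pderiv k (fun y => Xi K (at0 y)) x =
    pderiv k (Y K) x / (2 * sig x) - Y K x * pderiv k sig x / (2 * sig x ^+ 2).
  rewrite (@pderiv_near_eq _ _ _ _ (fun y => Y K y * (2 * sig y)^-1)); last first.
    by apply: filterS (at0_near Bx) => y By; rewrite XiE.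
  have t0 : 2 * sig x != 0 by rewrite mulf_neq0 ?pnatr_eq0.
  have [_ ->] := has_pderivM (has_pderiv_smooth k (smooth_Y K) Bx)
    (has_pderivV t0 (has_pderivM (has_pderiv_cst k 2 x) (has_pderiv_smooth k smooth_sig Bx))).
  by field.
have dHh k : pderiv k (fun y => Hh y I J) x =
    2 * sig x * pderiv k sig x * H x I J + sig x ^+ 2 * pderiv k (fun y => H y I J) x.
  rewrite (@pderiv_near_eq _ _ _ _ (fun y => sig y ^+ 2 * H y I J)); last first.
    by apply: filterS (at0_near Bx) => y By; rewrite boundary_cometric// mxE exprVn.
  have [_ ->] := has_pderivM (has_pderivX 2 (has_pderiv_smooth k smooth_sig Bx)) (has_pderiv_smooth k (smooth_cometric_B I J) Bx).
  by rewrite /= expr1; ring.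
have := second_order_metric sXi sm2 EX Em I J Bx.
rewrite boundary_cometric // !mxE !XiE // m2E (m0_sigV x).
set A := \sum_l H x I l * pderiv l (Y J) x; set C := \sum_k H x k J * pderiv k (Y I) x.
set E := \sum_k Y k x * pderiv k (fun y => H y I J) x.
have -> : \sum_j H x I j * pderiv j (fun y => Xi J (at0 y)) x = A / (2 * sig x) - Y J x * Y I x / (2 * sig x ^+ 2).
  rewrite /A mulr_suml {3}/Y mulr_sumr mulr_suml -sumrB; apply: eq_bigr => j _.
  by rewrite dXi; field.
have -> : \sum_i H x i J * pderiv i (fun y => Xi I (at0 y)) x = C / (2 * sig x) - Y I x * Y J x / (2 * sig x ^+ 2).
  rewrite /C mulr_suml {3}/Y mulr_sumr mulr_suml -sumrB; apply: eq_bigr => j _.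
  by rewrite dXi (H_sym j J Bx); field.
have -> : \sum_k Xi k (at0 x) * pderiv k (fun y => Hh y I J) x = psi x * H x I J + sig x / 2 * E.
  rewrite /E /psi mulr_suml mulr_sumr -big_split /=; apply: eq_bigr => k _.
  by rewrite dHh XiE//; field.
(* The products Y^I Y^J cancel, 4 Xi Xi against the derivatives of 1 / (2 sigma); only multiples of
   the cometric remain on the right. *)
move=> F; apply/eqP; rewrite -subr_eq0; apply/eqP.
rewrite -[RHS](mulr0 (2 * sig x)) -F; field.
by [].
Qed.

(** Since d |d sigma|^2 is twice the Hessian applied to grad sigma, a pure-trace Hessian makes it a
    multiple of d sigma. *)
Lemma grad_psi k x : B x ->
  pderiv k psi x = ((psi x + lambdah) / sig x - lambda * sig x) * pderiv k sig x.
Proof.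
move=> Bx; set c := (_ - _).
have ss k' := smooth_open_pderiv k' smooth_sig.
have dpsi l : pderiv l psi x = \sum_i (pderiv l (Y i) x * pderiv i sig x + Y i x * pderiv l (pderiv i sig) x).
  have [_ ->] // : has_pderiv l psi x (\sum_i (pderiv l (Y i) x * pderiv i sig x + Y i x * pderiv l (pderiv i sig) x)).
  apply: has_pderiv_sum => i _; apply: has_pderivM; first exact: has_pderiv_smooth (smooth_Y i) Bx.
  exact: has_pderiv_smooth (ss i) Bx.
have dY J l : pderiv l (Y J) x = \sum_m (pderiv l (fun y => H y J m) x * pderiv m sig x + H x J m * pderiv l (pderiv m sig) x).
  have [_ ->] // : has_pderiv l (Y J) x (\sum_m (pderiv l (fun y => H y J m) x * pderiv m sig x + H x J m * pderiv l (pderiv m sig) x)).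
  apply: has_pderiv_sum => i _; apply: has_pderivM; first exact: has_pderiv_smooth (smooth_cometric_B J i) Bx.
  exact: has_pderiv_smooth (ss i) Bx.
have dHsym i j l : pderiv l (fun y => H y i j) x = pderiv l (fun y => H y j i) x.
  by apply: pderiv_near_eq; apply: filterS (at0_near Bx) => y By; exact: H_sym.
have E1 J : \sum_l H x l J * pderiv l psi x = c * Y J x.
  (* Contracting the Hessian identity with d sigma: second derivatives of sigma cancel by [pderivC],
     derivatives of H by its symmetry, and d psi with a raised index is left. *)
  have T : \sum_I pderiv I sig x * (\sum_l H x I l * pderiv l (Y J) x + \sum_k H x k J * pderiv k (Y I) x
    - \sum_k Y k x * pderiv k (fun y => H y I J) x) = c * Y J x.
    rewrite /Y mulr_sumr; apply: eq_bigr => I _.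
    rewrite -/(Y _ _) hessian_sig// -/c (H_sym J I Bx); ring.
  rewrite -T [RHS](eq_bigr (fun I => pderiv I sig x * \sum_l H x I l * pderiv l (Y J) x +
     pderiv I sig x * (\sum_k H x k J * pderiv k (Y I) x) +
    - (pderiv I sig x * \sum_k Y k x * pderiv k (fun y => H y I J) x))); last first.
    by move=> I _; ring.
  rewrite !big_split /= sumrN.
  have -> : \sum_I pderiv I sig x * (\sum_l H x I l * pderiv l (Y J) x) = \sum_l Y l x * pderiv l (Y J) x.
    rewrite (eq_bigr (fun I => \sum_l pderiv I sig x * (H x I l * pderiv l (Y J) x))); last by move=> *; rewrite mulr_sumr.
    rewrite exchange_big /=; apply: eq_bigr => l _; rewrite /Y mulr_suml; apply: eq_bigr => I _.
    by rewrite (H_sym I l Bx); ring.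
  have -> : \sum_I pderiv I sig x * (\sum_k Y k x * pderiv k (fun y => H y I J) x) =
      \sum_l Y l x * \sum_m pderiv l (fun y => H y J m) x * pderiv m sig x.
    rewrite (eq_bigr (fun I => \sum_l pderiv I sig x * (Y l x * pderiv l (fun y => H y I J) x))); last by move=> *; rewrite mulr_sumr.
    rewrite exchange_big /=; apply: eq_bigr => l _; rewrite mulr_sumr; apply: eq_bigr => I _.
    by rewrite dHsym; ring.
  have -> : \sum_I pderiv I sig x * (\sum_k H x k J * pderiv k (Y I) x) =
      \sum_l H x l J * (pderiv l psi x - \sum_i Y i x * pderiv l (pderiv i sig) x).
    rewrite (eq_bigr (fun I => \sum_l pderiv I sig x * (H x l J * pderiv l (Y I) x))); last by move=> *; rewrite mulr_sumr.
    rewrite exchange_big /=; apply: eq_bigr => l _; rewrite dpsi -sumrB mulr_sumr; apply: eq_bigr => I _.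
    by ring.
  have -> : \sum_l Y l x * pderiv l (Y J) x = \sum_l Y l x * (\sum_m pderiv l (fun y => H y J m) x * pderiv m sig x)
     + \sum_l Y l x * (\sum_m H x J m * pderiv l (pderiv m sig) x).
    by rewrite -big_split /=; apply: eq_bigr => l _; rewrite dY big_split /= mulrDr.
  have -> : \sum_l H x l J * (pderiv l psi x - \sum_i Y i x * pderiv l (pderiv i sig) x) =
      \sum_l H x l J * pderiv l psi x - \sum_l Y l x * (\sum_m H x J m * pderiv l (pderiv m sig) x).
    have -> : \sum_l Y l x * (\sum_m H x J m * pderiv l (pderiv m sig) x) = \sum_l H x l J * (\sum_i Y i x * pderiv l (pderiv i sig) x).
      rewrite (eq_bigr (fun l => \sum_m Y l x * (H x J m * pderiv l (pderiv m sig) x))); last by move=> *; rewrite mulr_sumr.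
      rewrite exchange_big /=; apply: eq_bigr => m _; rewrite mulr_sumr; apply: eq_bigr => l _.
      by rewrite (H_sym J m Bx) (pderivC m l oB smooth_sig Bx); ring.
    by rewrite -sumrB; apply: eq_bigr => l _; rewrite mulrBr.
  by ring.
have uH : H x \in unitmx by rewrite unitmx_inv; apply: uG; exact: BB'.
have : (\row_l (pderiv l psi x - c * pderiv l sig x)) *m H x = 0.
  apply/rowP => J; rewrite !mxE.
  rewrite (eq_bigr (fun l => H x l J * pderiv l psi x - c * (H x J l * pderiv l sig x))); last first.
    by move=> l _; rewrite mxE (H_sym J l Bx); ring.
  by rewrite sumrB E1 -mulr_sumr subrr.
move/(congr1 (mulmx^~ (invmx (H x)))); rewrite mulmxK // mul0mx => /rowP/(_ k).
by rewrite !mxE => /eqP; rewrite subr_eq0 => /eqP.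
Qed.

(* for an exact isometry, r (rho^-1 + lambdahat rho / 4) = sigma + r^2 tau *)
Let tau x := (psi x + lambdah) / (4 * sig x).

Lemma smooth_tau : smooth_open B tau.
Proof.
have := smooth_psi; have := smooth_sig => ? ?; apply: smooth_openM => //; first by prove_smooth.
by apply: smooth_openV => //; [prove_smooth|move=> x Bx; rewrite mulf_neq0 ?pnatr_eq0 ?sig_neq0].
Qed.

Lemma grad_tau k x : B x -> pderiv k tau x = - (lambda / 4) * pderiv k sig x.
Proof.
move=> Bx; have s0 := sig_neq0 Bx.
have t0 : 4 * sig x != 0 by rewrite mulf_neq0 ?pnatr_eq0.
have [_ ->] := has_pderivM (has_pderivD (has_pderiv_smooth k smooth_psi Bx) (has_pderiv_cst k lambdah x))
    (has_pderivV t0 (has_pderivM (has_pderiv_cst k 4 x) (has_pderiv_smooth k smooth_sig Bx))).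
by rewrite grad_psi//; field.
Qed.

(** * Comparison of S with S0, and transport along grad sigma *)

Context (hS : forall z, O z -> 1 + 4^-1 * lambdah * (r z * mm z) ^+ 2 != 0).

Definition defining z := (mm z)^-1 + 4^-1 * lambdah * r z ^+ 2 * mm z.
Definition defining0 z := sig (lsubmx z) + r z ^+ 2 * tau (lsubmx z).
Let S := defining.
Let S0 := defining0.

(* The functions s = rho^-1 + lambdahat rho / 4 satisfy |d s|^2 = s^2 - lambdahat in the metric
   ghat_+. Writing s = f / r and pulling back to g_+ gives [cone_eikonal f] = 0. *)
Definition cone_eikonal f z :=
  - 2 * f z * rd f z + r z * (rd f z ^+ 2 + (aa z ^+ 2)^-1 * ip f f z + lambdah).

Lemma smooth_S : smooth_open O S.
Proof. by have := smooth_r; have := smooth_openV oO smm mm0; rewrite /S /defining => ? ?; prove_smooth. Qed.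

Lemma smooth_sig_lsubmx : smooth_open O (fun z => sig (lsubmx z)).
Proof. exact: (smooth_lsubmx oO smooth_sig). Qed.

Lemma smooth_tau_lsubmx : smooth_open O (fun z => tau (lsubmx z)).
Proof. exact: (smooth_lsubmx oO smooth_tau). Qed.

Lemma smooth_S0 : smooth_open O S0.
Proof.
have := smooth_r; have := smooth_sig_lsubmx; have := smooth_tau_lsubmx; rewrite /S0 /defining0 => ? ? ?; prove_smooth.
Qed.

Lemma S_neq0 z : O z -> S z != 0.
Proof.
move=> Oz; have h := mm0 Oz; rewrite /S /defining.
have -> : (mm z)^-1 + 4^-1 * lambdah * r z ^+ 2 * mm z = (mm z)^-1 * (1 + 4^-1 * lambdah * (r z * mm z) ^+ 2).
  by field.
by rewrite mulf_neq0 ?invr_neq0 ?hS.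
Qed.

Lemma bbE z : O z -> bb z = 1 - 4^-1 * lambdah * (r z * mm z) ^+ 2.
Proof. by move=> Oz; rewrite /bb Pm. Qed.

Lemma D_S i z : O z -> D i S z = - (D i mm z * bb z / mm z ^+ 2).
Proof.
move=> Oz; have h := mm0 Oz.
have [_ ->] := has_pderivD (has_pderivV h (has_pderiv_smooth (lshift 1 i) smm Oz))
  (has_pderivM (has_pderivM (has_pderiv_cst (lshift 1 i) (4^-1 * lambdah) z)
    (has_pderivX 2 (has_pderiv_rcoord (lshift 1 i) z))) (has_pderiv_smooth (lshift 1 i) smm Oz)).
by rewrite rshift_neq_lshift mulr0 bbE//; field.
Qed.

Lemma rd_S z : O z -> rd S z = - rd mm z / mm z ^+ 2
  + 4^-1 * lambdah * (2 * r z * mm z + r z ^+ 2 * rd mm z).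
Proof.
move=> Oz; have h := mm0 Oz.
have [_ ->] := has_pderivD (has_pderivV h (has_pderiv_smooth rdir smm Oz))
  (has_pderivM (has_pderivM (has_pderiv_cst rdir (4^-1 * lambdah) z)
    (has_pderivX 2 (has_pderiv_rcoord rdir z))) (has_pderiv_smooth rdir smm Oz)).
by rewrite eqxx mulr1 /=; field.
Qed.

(** By [grad_tau], d sigma + r^2 d tau = (1 - lambda r^2 / 4) d sigma. So dS0 stays parallel to d
    sigma for all r, and the factor a cancels the a^-2 of the cometric. *)
Lemma D_S0 i z : O z -> D i S0 z = aa z * pderiv i sig (lsubmx z).
Proof.
move=> Oz; have Bz := OB Oz.
have [_ ->] := has_pderivD (has_pderiv_lsubmx i (smooth_open_differentiable smooth_sig Bz))
  (has_pderivM (has_pderivX 2 (has_pderiv_rcoord (lshift 1 i) z))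
    (has_pderiv_lsubmx i (smooth_open_differentiable smooth_tau Bz))).
by rewrite rshift_neq_lshift mulr0 grad_tau// /aa; field.
Qed.

Lemma rd_S0 z : O z -> rd S0 z = 2 * r z * tau (lsubmx z).
Proof.
move=> Oz; have Bz := OB Oz.
have [_ ->] := has_pderivD (has_rd_lsubmx (smooth_open_differentiable smooth_sig Bz))
  (has_pderivM (has_pderivX 2 (has_pderiv_rcoord rdir z))
    (has_rd_lsubmx (smooth_open_differentiable smooth_tau Bz))).
by rewrite eqxx mulr1 /=; ring.
Qed.

(** S is a function of m and r with m-derivative - b / m^2, and the change of unknown turns
    [eikonal] into [cone_eikonal S] up to the exact factor b^2 / m^4. *)
Lemma cone_eikonal_S : flat (cone_eikonal S).
Proof.
move=> N.
have sc : smooth_open O (fun z => bb z ^+ 2 * (mm z ^+ 4)^-1).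
  apply: smooth_openM => //; first by apply: smooth_openX => //; exact: smooth_bb.
  apply: smooth_openV => //; first by prove_smooth.
  by move=> z Oz; rewrite expf_neq0 ?mm0.
apply: flat_to_ext (flat_toMl oO sc (eikonal_flat N)) => z Oz.
have h := mm0 Oz; have h' := aa0 Oz.
have -> : cone_eikonal S z = - 2 * S z * rd S z + r z * (rd S z ^+ 2 + lambdah)
   + r z * (aa z ^+ 2)^-1 * (bb z ^+ 2 * (mm z ^+ 4)^-1) * ip mm mm z.
  have -> : cone_eikonal S z = - 2 * S z * rd S z + r z * (rd S z ^+ 2 + lambdah)
     + r z * (aa z ^+ 2)^-1 * ip S S z by rewrite /cone_eikonal; ring.
  congr (_ + _); rewrite -[RHS]mulrA; congr (_ * _).
  rewrite /ip mulr_sumr; apply: eq_bigr => i _; rewrite mulr_sumr; apply: eq_bigr => j _.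
  by rewrite !D_S//; field.
rewrite rd_S// /eikonal /S /defining bbE//.
by field; rewrite h h'.
Qed.

(** Because a^-2 |dS0|^2 = psi, the expression reduces to r (psi + lambdahat - 4 sigma tau), which
    the choice of tau makes zero. *)
Lemma cone_eikonal_S0 z : O z -> cone_eikonal S0 z = 0.
Proof.
move=> Oz; have h' := aa0 Oz; have s0 := sig_neq0 (OB Oz).
have E : (aa z ^+ 2)^-1 * ip S0 S0 z = psi (lsubmx z).
  rewrite /ip mulr_sumr; apply: eq_bigr => i _; rewrite /Y mulr_sumr mulr_suml; apply: eq_bigr => j _.
  by rewrite !D_S0//; field.
by rewrite /cone_eikonal E rd_S0// /S0 /defining0 /tau; field.
Qed.

Lemma ip_flat N f g : smooth_open O f -> flat_to N g -> flat_to N (ip f g).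
Proof.
move=> sf fg; apply: flat_to_sum => // i _; apply: flat_to_sum => // j _.
apply: flat_toMl => //; last by apply: flat_to_pderiv; rewrite ?rshift_neq_lshift.
by apply: smooth_openM => //; [exact: smooth_cometric_lsubmx|exact: smooth_open_pderiv].
Qed.

Lemma ip_sym f g z : O z -> ip f g z = ip g f z.
Proof.
move=> Oz; rewrite /ip exchange_big; apply: eq_bigr => i _; apply: eq_bigr => j _.
by rewrite (H_sym j i (OB Oz)); ring.
Qed.

Lemma ip_diffl f g h z : O z -> smooth_open O f -> smooth_open O g ->
  ip (fun y => f y - g y) h z = ip f h z - ip g h z.
Proof.
move=> Oz sf sg; rewrite /ip -sumrB; apply: eq_bigr => i _; rewrite -sumrB; apply: eq_bigr => j _.
have [_ ->] := has_pderivB (has_pderiv_smooth (lshift 1 i) sf Oz) (has_pderiv_smooth (lshift 1 i) sg Oz).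
by ring.
Qed.

(* Modulo flat functions, D = S - S0 satisfies 2 S D_r = c D + r (linear in D_r and d D), so that
   vanishing of D to order N + 1 makes D_r vanish to order N + 1. *)
Lemma defining_flat : flat (fun z => S z - S0 z).
Proof.
have sS := smooth_S; have sS0 := smooth_S0.
have sd : smooth_open O (fun z => S z - S0 z) by prove_smooth.
have srS := smooth_open_pderiv rdir sS; have srS0 := smooth_open_pderiv rdir sS0.
have F1 : flat_to 1 (fun z => S z - S0 z).
  have [z Oz z0|g sg E] := hadamard oO sd; last by exists g => // z Oz; rewrite expr1 E.
  have E : z = at0 (lsubmx z) by rewrite at0_lsubmx -[in RHS]z0 setr_id.
  rewrite E /S /defining /S0 /defining0 rcoord_at0 lsubmx_at0 expr0n mulr0 !mul0r !addr0.
  by rewrite /sig /m0 subrr.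
suff FN N : flat_to N.+1 (fun z => S z - S0 z).
  by move=> N; exact: flat_to_le (leqnSn N) (FN N).
elim: N => // N IH; apply: flat_toS => //.
have rdd z : O z -> rd (fun z => S z - S0 z) z = rd S z - rd S0 z.
  by move=> Oz; have [_ ->] := has_pderivB (has_pderiv_smooth rdir sS Oz) (has_pderiv_smooth rdir sS0 Oz).
(* The order lost by differentiating in r is regained from the factor r in front of this term. *)
have frd : flat_to N (rd (fun z => S z - S0 z)) by exact: flat_to_rd.
pose dd z := S z - S0 z.
apply: (@flat_to_ext _ _ _ _ (fun z => (- 2 * S z)^-1 *
   (cone_eikonal S z + 2 * rd S0 z * dd z - r z * (rd dd z * (rd S z + rd S0 z))
    - r z * (aa z ^+ 2)^-1 * ip S dd z - r z * (aa z ^+ 2)^-1 * ip S0 dd z))).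
  move=> z Oz; have h := S_neq0 Oz; have h' := aa0 Oz; have := cone_eikonal_S0 Oz.
  have -> : ip S dd z = ip S S z - ip S S0 z.
    by rewrite ip_sym// ip_diffl// (@ip_sym S0 S).
  have -> : ip S0 dd z = ip S S0 z - ip S0 S0 z.
    by rewrite ip_sym// ip_diffl//.
  rewrite /cone_eikonal => E.
  have rddd : rd dd z = rd S z - rd S0 z := rdd z Oz.
  rewrite rddd; apply: (mulfI (_ : - 2 * S z != 0)).
    by rewrite mulf_neq0 ?oppr_eq0 ?pnatr_eq0.
  rewrite mulVKf; last by rewrite mulf_neq0 ?oppr_eq0 ?pnatr_eq0.
  rewrite -[LHS]subr0 -[X in _ - X]E /dd; ring.
have sa := smooth_aaV2; have sr' := smooth_r.
apply: flat_toMl => //.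
  apply: smooth_openV => //; first by prove_smooth.
  by move=> z Oz; rewrite mulf_neq0 ?oppr_eq0 ?pnatr_eq0 ?S_neq0.
apply: flat_toB => //; first apply: flat_toB => //; first apply: flat_toB => //; first apply: flat_toD => //.
- exact: cone_eikonal_S.
- by apply: flat_toMl => //; prove_smooth.
- apply: flat_to_rM; apply: flat_toMr => //; prove_smooth.
- by apply: flat_toMl => //; [prove_smooth|exact: ip_flat].
- by apply: flat_toMl => //; [prove_smooth|exact: ip_flat].
Qed.

(** By [D_S] dm = - (m^2 / b) dS, and dS may be replaced by dS0 = a d sigma up to flat terms. The
    pairing of dX with dm thus becomes the derivative of X along grad sigma, times a smooth
    factor. *)
Lemma transport_sig I : flat (fun z => rd (X I) z * (mm z + r z * rd mm z)
  - r z * ((aa z)^-1 * mm z ^+ 2 * (bb z)^-1) * \sum_i D i (X I) z * Y i (lsubmx z)).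
Proof.
move=> N; have sS := smooth_S; have sS0 := smooth_S0.
pose dd z := S z - S0 z.
have sbV : smooth_open O (fun z => (bb z)^-1) by apply: smooth_openV => //; exact: smooth_bb.
have F := ip_flat (sP (lshift 1 I)) (defining_flat N).
have sc : smooth_open O (fun z => r z * (aa z ^+ 2)^-1 * (mm z ^+ 2 * (bb z)^-1)).
  by have := smooth_aaV2; have := smooth_r => ? ?; prove_smooth.
apply: flat_to_ext (flat_toD oO (transport_flat I N) (flat_toMl oO sc F)) => z Oz.
have h := mm0 Oz; have h' := aa0 Oz; have h'' := bb0 Oz.
rewrite /transport.
have -> : ip (X I) mm z = - (mm z ^+ 2 / bb z) * (aa z * \sum_i D i (X I) z * Y i (lsubmx z) + ip (X I) dd z).
  rewrite /ip mulr_sumr -big_split mulr_sumr; apply: eq_bigr => i _ /=.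
  rewrite /Y mulr_sumr mulr_sumr -big_split mulr_sumr; apply: eq_bigr => j _ /=.
  have [_ ->] := has_pderivB (has_pderiv_smooth (lshift 1 j) sS Oz) (has_pderiv_smooth (lshift 1 j) sS0 Oz).
  by rewrite D_S// D_S0//; field; rewrite h h''.
by rewrite /dd; field; rewrite h' h''.
Qed.

End Core.

(** * Restriction to a slice *)

Section Slice.
Context {R : realType} {k m : nat} (O : set 'rV[R]_(k + m + 1)) (oO : open O).

Definition slice_emb (y : 'rV[R]_(k + 1)) : 'rV[R]_(k + m + 1) :=
  row_mx (row_mx (lsubmx y) 0) (rsubmx y).

Notation O1 := (slice_emb @^-1` O).

Lemma rcoord_slice_emb y : rcoord (slice_emb y) = rcoord y.
Proof. by rewrite /rcoord /slice_emb row_mxEr mxE. Qed.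

(** The [match] is the ambient direction that corresponds to direction i of the slice;
    [fintype.split] separates the x-directions from r. *)
Lemma slice_emb_coord j :
  (exists2 j', (fun y => slice_emb y 0 j) = (fun y => y 0 j') &
     forall i : 'I_(k + 1), (j' == i)%:R = (j == match fintype.split i with
       inl a => lshift 1 (lshift m a) | inr b => rshift (k + m) b end)%:R :> R) \/
  ((fun y => slice_emb y 0 j) = (fun=> 0) /\
     forall i : 'I_(k + 1), (j == match fintype.split i with
       inl a => lshift 1 (lshift m a) | inr b => rshift (k + m) b end) = false).
Proof.
case: (split_ordP j) => [j1|j1] ->; last first.
  left; exists (rshift k j1).
    by apply/funext => y; rewrite /slice_emb row_mxEr mxE.
  move=> i; case: (split_ordP i) => i1 ->. 
    by rewrite !eq_rlshift.
  by rewrite !(inj_eq (@rshift_inj _ _)).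
case: (split_ordP j1) => j2 ->.
  left; exists (lshift 1 j2).
    by apply/funext => y; rewrite /slice_emb row_mxEl row_mxEl mxE.
  move=> i; case: (split_ordP i) => i1 ->. 
    by rewrite !(inj_eq (@lshift_inj _ _)).
  by rewrite !eq_lrshift.
right; split; first by apply/funext => y; rewrite /slice_emb row_mxEl row_mxEr mxE.
move=> i; case: (split_ordP i) => i1 _.
  by rewrite (inj_eq (@lshift_inj _ _)) eq_rlshift.
by rewrite eq_lrshift.
Qed.

Lemma has_pderiv_slice_emb i j y : has_pderiv i (fun y => slice_emb y 0 j) y
  (j == match fintype.split i with
       inl a => lshift 1 (lshift m a) | inr b => rshift (k + m) b end)%:R.
Proof.
have [[j' -> E]|[-> E]] := slice_emb_coord j; last by rewrite (E i); exact: has_pderiv_cst.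
by rewrite -E; exact: has_pderiv_coord.
Qed.

Lemma has_pderiv_on_slice (f : 'rV[R]_(k + m + 1) -> R) i y : differentiable f (slice_emb y) ->
  has_pderiv i (fun y => f (slice_emb y)) y
    (pderiv (match fintype.split i with
       inl a => lshift 1 (lshift m a) | inr b => rshift (k + m) b end) f (slice_emb y)).
Proof.
move=> df; set i' := match _ with inl _ => _ | inr _ => _ end.
have := has_pderiv_comp (fun j => has_pderiv_slice_emb i j y) df; rewrite -/i'.
rewrite (bigD1 i') //= eqxx mul1r big1 ?addr0// => j /negPf ->.
by rewrite mul0r.
Qed.

Lemma slice_emb_continuous : continuous slice_emb.
Proof.
move=> y; apply: differentiable_continuous; apply: differentiable_rV => j.
have [[j' -> E]|[-> _]] := slice_emb_coord j; [exact: differentiable_coord|exact: differentiable_cst].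
Qed.

Lemma open_slice : open O1.
Proof. by apply: open_comp => // y _; exact: slice_emb_continuous. Qed.

Lemma smooth_on_slice f : smooth_open O f -> smooth_open O1 (fun y => f (slice_emb y)).
Proof.
move=> sf; apply: (smooth_open_comp open_slice sf) => // j.
have [[j' -> E]|[-> _]] := slice_emb_coord j.
  by apply: smooth_open_coord; exact: open_slice.
by apply: smooth_open_cst; exact: open_slice.
Qed.

Lemma flat_to_on_slice N F : flat_to (O := O) N F -> flat_to (O := O1) N (fun y => F (slice_emb y)).
Proof.
move=> [G sG E]; exists (fun y => G (slice_emb y)); first exact: smooth_on_slice.
by move=> y Oy; rewrite E// rcoord_slice_emb.
Qed.

(** As the field Y is tangent to the slice, its derivative of f only sees g, the restriction of f.
    The equation becomes one for g alone: divisibility of g by r^(N+1) passes to its tangential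
    derivatives, hence to g_r, and [flat_toS] raises the order. *)
Lemma flat_on_slice (f h c : 'rV[R]_(k + m + 1) -> R) (Y : 'I_(k + m) -> 'rV[R]_(k + m + 1) -> R) :
  smooth_open O f -> smooth_open O h -> smooth_open O c -> (forall i, smooth_open O (Y i)) ->
  (forall z, O z -> h z != 0) ->
  (forall y b, O (slice_emb y) -> Y (rshift k b) (slice_emb y) = 0) ->
  (forall y, O (slice_emb y) -> rcoord y = 0 -> f (slice_emb y) = 0) ->
  flat (O := O) (fun z => pderiv (rshift (k + m) ord0) f z * h z
     - rcoord z * c z * \sum_i pderiv (lshift 1 i) f z * Y i z) ->
  flat (O := O1) (fun y => f (slice_emb y)).
Proof.
move=> sf sh sc sY h0 Y0 f0 ff.
have oO1 := open_slice.
pose g y := f (slice_emb y).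
have sg : smooth_open O1 g := smooth_on_slice sf.
have F1 : flat_to (O := O1) 1 g.
  have [z Oz z0|K sK E] := hadamard oO1 sg; last by exists K => // z Oz; rewrite expr1 E.
  exact: f0.
suff FN N : flat_to (O := O1) N.+1 g.
  by move=> N; exact: (flat_to_le oO1 (leqnSn N) (FN N)).
elim: N => // N IH; apply: (flat_toS oO1) => //.
have dg i y : O1 y -> pderiv i g y = pderiv (match fintype.split i with
       inl a => lshift 1 (lshift m a) | inr b => rshift (k + m) b end) f (slice_emb y).
  by move=> Oy; have [_ ->] := has_pderiv_on_slice i (smooth_open_differentiable sf Oy).
apply: (@flat_to_ext _ _ _ _ (fun y => (h (slice_emb y))^-1 *
  ((pderiv (rshift (k + m) ord0) f (slice_emb y) * h (slice_emb y)
     - rcoord (slice_emb y) * c (slice_emb y) * \sum_i pderiv (lshift 1 i) f (slice_emb y) * Y i (slice_emb y))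
   + rcoord y * c (slice_emb y) * \sum_a pderiv (lshift 1 a) g y * Y (lshift m a) (slice_emb y)))).
  move=> y Oy; have hy := h0 _ Oy.
  have EY : \sum_i pderiv (lshift 1 i) f (slice_emb y) * Y i (slice_emb y) =
      \sum_a pderiv (lshift 1 a) g y * Y (lshift m a) (slice_emb y).
    rewrite big_split_ord /= [X in _ + X]big1 ?addr0; last first.
      by move=> b _; rewrite Y0// mulr0.
    by apply: eq_bigr => a _; rewrite dg// (unsplitK (inl _)).
  rewrite dg// (unsplitK (inr _)) rcoord_slice_emb EY.
  by rewrite subrK mulrCA mulVf ?mulr1.
apply: (flat_toMl oO1).
  by apply: (smooth_openV oO1) => [|y Oy]; [exact: smooth_on_slice|exact: h0].
apply: (flat_toD oO1).
  exact: (flat_to_on_slice (ff N.+1)).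
apply: (flat_toMl oO1).
  by apply: (smooth_openM oO1); [exact: smooth_rcoord|exact: smooth_on_slice].
apply: (flat_to_sum oO1) => a _; apply: (flat_toMr oO1); last by apply: smooth_on_slice.
by apply: (flat_to_pderiv oO1) => //; rewrite rshift_neq_lshift.
Qed.

End Slice.

(** * Conformal change of the mean curvature *)

Section Minimal.
Context {R : realType}.

Lemma posdef_unitmx n (A : 'M[R]_n) :
  (forall v : 'rV[R]_n, v != 0 -> 0 < (v *m A *m v^T) 0 0) -> A \in unitmx.
Proof.
move=> H; rewrite unitmxE unitfE; apply/negP => /det0P[v v0 E].
by have := H v v0; rewrite E mul0mx mxE ltxx.
Qed.

Context {k m : nat}.
Implicit Types (A : 'M[R]_(k + m)) (x v : 'rV[R]_(k + m)).

Lemma induced_metricE A a b : induced_metric A a b = A (lshift m a) (lshift m b).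
Proof.
rewrite /induced_metric /slice_frame tr_row_mx trmx1 trmx0 -{1}[A]submxK mul_row_block.
by rewrite !mul1mx !mul0mx !addr0 mul_row_col mulmx1 mulmx0 addr0 !mxE.
Qed.

Lemma induced_metric_unit A :
  (forall v, v != 0 -> 0 < (v *m A *m v^T) 0 0) -> induced_metric A \in unitmx.
Proof.
move=> H; apply: posdef_unitmx => v v0.
have := H (v *m slice_frame R k m); rewrite trmx_mul /induced_metric !mulmxA; apply.
rewrite /slice_frame mul_mx_row mulmx1 mulmx0; apply: contraNneq v0 => /(congr1 lsubmx).
by rewrite row_mxKl => ->; apply/eqP/rowP => j; rewrite !mxE.
Qed.

Lemma tangentialD A u v : tangential A (u + v) = tangential A u + tangential A v.
Proof. by rewrite /tangential !mulmxDl. Qed.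

Lemma tangentialZ A (c : R) v : tangential A (c *: v) = c *: tangential A v.
Proof. by rewrite /tangential -!scalemxAl. Qed.

Lemma tangential_scale A (c : R) v : c != 0 -> induced_metric A \in unitmx ->
  tangential (c *: A) v = tangential A v.
Proof.
move=> c0 uA; rewrite /tangential.
have -> : induced_metric (c *: A) = c *: induced_metric A.
  by rewrite /induced_metric -scalemxAr -scalemxAl.
rewrite invmxZ ?unitmxZ ?unitfE// -!scalemxAr -!scalemxAl scalerA.
by rewrite mulVf// scale1r.
Qed.

Lemma tangential_frame A a : induced_metric A \in unitmx ->
  tangential A (delta_mx 0 (lshift m a)) = delta_mx 0 (lshift m a).
Proof.
move=> uA.
have -> : delta_mx 0 (lshift m a) = row a (slice_frame R k m).
  apply/rowP => j; rewrite !mxE; case: (split_ordP j) => j' ->.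
    by rewrite mxE (inj_eq (@lshift_inj _ _)) eq_sym.
  by rewrite mxE eq_rlshift.
rewrite /tangential -row_mul -row_mul -[slice_frame _ _ _ *m _ *m _]/(induced_metric A).
by rewrite -row_mul mulmxV// row1 -rowE.
Qed.

Lemma rsubmx_tangential A v : rsubmx (tangential A v) = 0.
Proof. by rewrite /tangential /slice_frame mul_mx_row mulmx0 row_mxKr. Qed.

Section Conformal.
Context (G Gh : 'rV[R]_(k + m) -> 'M[R]_(k + m)) (w : 'rV[R]_(k + m) -> R) (x : 'rV[R]_(k + m)).
Context (dG : forall i j, differentiable (fun y => G y i j) x) (dw : differentiable w x)
  (w0 : w x != 0) (GhG : \forall y \near x, Gh y = w y ^+ 2 *: G y)
  (symG : (G x)^T = G x) (posG : forall v, v != 0 -> 0 < (v *m G x *m v^T) 0 0).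

Let V : 'rV[R]_(k + m) := \row_l \sum_p invmx (G x) l p * pderiv p w x.

Let uG : G x \in unitmx. Proof. exact: posdef_unitmx. Qed.
Let uh : induced_metric (G x) \in unitmx. Proof. exact: induced_metric_unit. Qed.

(** The classical formula for the factor exp(2 log w), with w^-1 dw in place of d log w because the
    sign of w is not fixed. *)
Lemma christoffel_conformal l i j : christoffel Gh l i j x = christoffel G l i j x +
  (w x)^-1 * (pderiv i w x * (l == j)%:R + pderiv j w x * (l == i)%:R - G x i j * V 0 l).
Proof.
have dGh p i' j' : pderiv p (fun y => Gh y i' j') x =
    2 * w x * pderiv p w x * G x i' j' + w x ^+ 2 * pderiv p (fun y => G y i' j') x.
  rewrite (@pderiv_near_eq _ _ _ _ (fun y => w y ^+ 2 * G y i' j')); last first.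
    by apply: filterS GhG => y ->; rewrite mxE.
  have [_ ->] := has_pderivM (has_pderivX 2 (has_pderivP p dw)) (has_pderivP p (dG i' j')).
  by rewrite /= expr1; ring.
have w20 : w x ^+ 2 != 0 by rewrite expf_neq0.
have iGh : invmx (Gh x) = (w x ^+ 2)^-1 *: invmx (G x).
  by rewrite (nbhs_singleton GhG) invmxZ// unitmxZ ?unitfE.
have symE i' j' : G x i' j' = G x j' i' by rewrite -[in LHS]symG mxE.
have iG l' j' : \sum_p invmx (G x) l' p * G x j' p = (l' == j')%:R.
  have := mulVmx uG; move/matrixP/(_ l' j'); rewrite !mxE => <-.
  by apply: eq_bigr => p _; rewrite symE.
have -> : (w x)^-1 * (pderiv i w x * (l == j)%:R + pderiv j w x * (l == i)%:R - G x i j * V 0 l) =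
   (w x)^-1 * \sum_p invmx (G x) l p * (pderiv i w x * G x j p + pderiv j w x * G x i p - pderiv p w x * G x i j).
  rewrite -!iG mxE !mulr_sumr -big_split -sumrB /= mulr_sumr.
  by apply: eq_bigr => p _; ring.
rewrite /christoffel !mulr_sumr -big_split; apply: eq_bigr => p _ /=.
by rewrite iGh mxE !dGh; field.
Qed.

(** The two Kronecker terms of the Christoffel difference are multiples of frame vectors, hence
    tangent to the slice; only the normal part of grad log w survives. *)
Lemma second_fundamental_form_conformal a b :
  second_fundamental_form Gh a b x = second_fundamental_form G a b x
   - ((w x)^-1 * G x (lshift m a) (lshift m b)) *: (V - tangential (G x) V).
Proof.
rewrite /second_fundamental_form.
have w20 : w x ^+ 2 != 0 by rewrite expf_neq0.
set D := \row_l christoffel G l _ _ x.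
have -> : \row_l christoffel Gh l (lshift m a) (lshift m b) x = D +
   ((w x)^-1 * pderiv (lshift m a) w x) *: delta_mx 0 (lshift m b) +
   ((w x)^-1 * pderiv (lshift m b) w x) *: delta_mx 0 (lshift m a) +
   (- ((w x)^-1 * G x (lshift m a) (lshift m b))) *: V.
  apply/rowP => l; rewrite !mxE christoffel_conformal !mxE eqxx /=; ring.
rewrite (nbhs_singleton GhG) tangential_scale//.
rewrite !tangentialD !tangentialZ !tangential_frame//.
rewrite !scaleNr scalerBr !opprD !opprK.
set u1 := _ *: delta_mx 0 (lshift m b); set u2 := _ *: delta_mx 0 (lshift m a).
set t := tangential _ D; set v1 := _ *: V; set v2 := _ *: tangential _ V.
apply/rowP => l; rewrite !mxE; ring.
Qed.

(** Taking the trace, the mean curvature of Gh is w^-2 times that of G minus k times the normal part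
    of grad log w. If both vanish and k > 0, grad w is tangent. *)
Lemma normal_gradient : (0 < k)%N -> mean_curvature G x = 0 -> mean_curvature Gh x = 0 ->
  rsubmx V = 0.
Proof.
move=> k0 HG HGh.
have w20 : w x ^+ 2 != 0 by rewrite expf_neq0.
have ih : invmx (induced_metric (Gh x)) = (w x ^+ 2)^-1 *: invmx (induced_metric (G x)).
  rewrite (nbhs_singleton GhG).
  have -> : induced_metric (w x ^+ 2 *: G x) = w x ^+ 2 *: induced_metric (G x).
    by rewrite /induced_metric -scalemxAr -scalemxAl.
  by rewrite invmxZ// unitmxZ ?unitfE.
set N := V - tangential (G x) V.
have E : mean_curvature Gh x = (w x ^+ 2)^-1 *: (mean_curvature G x - ((w x)^-1 * k%:R) *: N).
  have symE i' j' : G x i' j' = G x j' i' by rewrite -[in LHS]symG mxE.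
  have tr : \sum_a \sum_b invmx (induced_metric (G x)) a b * G x (lshift m a) (lshift m b) = k%:R.
    rewrite (eq_bigr (fun a => 1)); first by rewrite sumr_const card_ord.
    move=> a _; have := mulVmx uh; move/matrixP/(_ a a); rewrite !mxE eqxx => E1.
    by rewrite -[RHS]E1; apply: eq_bigr => b _; rewrite induced_metricE symE.
  rewrite /mean_curvature scalerBr scalerA -tr mulrA mulr_sumr scaler_suml scaler_sumr -sumrB.
  apply: eq_bigr => a _; rewrite mulr_sumr scaler_suml scaler_sumr -sumrB; apply: eq_bigr => b _.
  rewrite second_fundamental_form_conformal ih mxE -/N scalerBr !scalerA; congr (_ - _ *: _).
  by ring.
move: HGh; rewrite E HG sub0r scalerN => /eqP; rewrite oppr_eq0 scalerA scaler_eq0 => /orP[|/eqP].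
  by rewrite !mulf_eq0 !invr_eq0 (negPf w20) (negPf w0) pnatr_eq0 /= eqn0Ngt k0.
by rewrite /N => /eqP; rewrite subr_eq0 => /eqP ->; exact: rsubmx_tangential.
Qed.

End Conformal.
End Minimal.

(** * Charts of the collar *)

Section Charts.
Context {R : realType}.

Lemma cvg_row_mx (T : Type) (F : set_system T) n1 n2 (f : T -> 'rV[R]_n1) (g : T -> 'rV[R]_n2)
    (a : 'rV[R]_n1) (b : 'rV[R]_n2) :
  Filter F -> f x @[x --> F] --> a -> g x @[x --> F] --> b ->
  row_mx (f x) (g x) @[x --> F] --> row_mx a b.
Proof.
move=> FF fa gb; apply: cvg_mx => i j; case: (split_ordP j) => j' ->.
  rewrite row_mxEl; under eq_fun do rewrite row_mxEl.
  apply: (@cvg_comp _ _ _ f (fun v : 'rV[R]_n1 => v i j') _ _ _ fa); exact: coord_continuous.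
rewrite row_mxEr; under eq_fun do rewrite row_mxEr.
apply: (@cvg_comp _ _ _ g (fun v : 'rV[R]_n2 => v i j') _ _ _ gb); exact: coord_continuous.
Qed.

Lemma cvg_const_mx (T : Type) (F : set_system T) m n (f : T -> R) (a : R) :
  Filter F -> f x @[x --> F] --> a -> const_mx (f x) @[x --> F] --> (const_mx a : 'M[R]_(m, n)).
Proof.
by move=> FF fa; apply: cvg_mx => i j; rewrite mxE; under eq_fun do rewrite mxE.
Qed.

Lemma within_continuous_near (T S : topologicalType) (A : set T) (f : T -> S) x (W : set S) :
  {within A, continuous f} -> A x -> nbhs (f x) W -> \forall y \near x, A y -> W (f y).
Proof. by move=> /subspace_continuousP cf Ax Wfx; exact: (cf x Ax W Wfx). Qed.

Context {n : nat} {M : manifold R n}.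
Implicit Types (c : chart R n M).

Lemma chart_cvg c p : cdom c p -> c q @[q --> p] --> c p.
Proof.
move=> cp W Wcp; have D : nbhs p (cdom c) by apply: open_nbhs_nbhs; split => //; exact: cdom_open.
by apply: filterS2 D (within_continuous_near (@cmap_continuous _ _ _ c) cp Wcp) => q a; apply.
Qed.

Lemma chart_inv_cvg c x : crange c x -> cinv c y @[y --> x] --> cinv c x.
Proof.
move=> cx W Wcx; have D : nbhs x (crange c) by apply: open_nbhs_nbhs; split => //; exact: crange_open.
by apply: filterS2 D (within_continuous_near (@cinv_continuous _ _ _ c) cx Wcx) => q a; apply.
Qed.

Lemma cinv_dom c x : crange c x -> cdom c (cinv c x).
Proof. by move=> [p cp <-]; rewrite cmapK. Qed.

Lemma cinvK c x : crange c x -> c (cinv c x) = x.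
Proof. by move=> [p cp <-]; rewrite cmapK. Qed.

Lemma xinvK c z : crange c (lsubmx z) -> xmap c (xinv c z) = z.
Proof.
move=> cz; rewrite /xmap /xinv /= cinvK//; exact: setr_id.
Qed.

Lemma xmapK c q : cdom c q.1 -> xinv c (xmap c q) = q.
Proof.
move=> cq; rewrite /xinv /xmap row_mxKl cmapK// /rcoord row_mxEr mxE.
by case: q {cq}.
Qed.

Lemma lsubmx_xmap c q : lsubmx (xmap c q) = c q.1. Proof. exact: row_mxKl. Qed.
Lemma rcoord_xmap c q : rcoord (xmap c q) = q.2. Proof. by rewrite /rcoord row_mxEr mxE. Qed.
Lemma xmap0 c p : xmap c (p, 0) = at0 (c p).
Proof. by rewrite /xmap /at0; congr row_mx; apply/rowP => j; rewrite !mxE. Qed.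

Lemma xmap_cvg c p : cdom c p -> xmap c q @[q --> (p, 0 : R)] --> at0 (c p).
Proof.
move=> cp; rewrite -xmap0; apply: cvg_row_mx.
  apply: (@cvg_comp _ _ _ (fun q : M * R => q.1) c _ _ _ _ (chart_cvg cp)).
  exact: cvg_fst.
by apply: cvg_const_mx; exact: cvg_snd.
Qed.

Lemma lsubmx_cvg_at0 (x : 'rV[R]_n) : lsubmx z @[z --> at0 x] --> x.
Proof. by rewrite -[X in _ --> X]lsubmx_at0; exact: continuous_lsubmx. Qed.

Lemma rcoord_cvg_at0 (x : 'rV[R]_n) : rcoord z @[z --> at0 x] --> (0 : R).
Proof. by rewrite -[X in _ --> X](rcoord_at0 x); exact: coord_continuous. Qed.

Lemma xinv_near c x (W : set (M * R)) : crange c x -> nbhs (cinv c x, 0 : R) W ->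
  \forall z \near at0 x, W (xinv c z).
Proof.
move=> cx [[A B] /= [nA nB] AB].
have cA : \forall z \near at0 x, A (cinv c (lsubmx z)).
  have h := chart_inv_cvg cx nA.
  exact: (@lsubmx_cvg_at0 x _ h).
have cB : \forall z \near at0 x, B (rcoord z).
  exact: (@rcoord_cvg_at0 x _ nB).
by apply: filterS2 cA cB => z Az Bz; apply: AB.
Qed.

Lemma ball_at0 (x y : 'rV[R]_n) e : ball x e y -> ball (at0 x) e (at0 y).
Proof.
move=> /ball_rVP[e0 H]; apply/ball_rVP; split=> // j; case: (split_ordP j) => i ->.
  by rewrite !row_mxEl.
by rewrite !row_mxEr !mxE subrr normr0.
Qed.

Lemma ball_lsubmx (z y : 'rV[R]_(n + 1)) e : ball z e y -> ball (lsubmx z) e (lsubmx y).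
Proof.
by move=> /ball_rVP[e0 H]; apply/ball_rVP; split=> // j; rewrite !mxE; exact: H.
Qed.

(* [smooth_collar_map] only provides local extensions, separately for each coordinate. *)
Lemma chart_extension (eps0 : R) (U : set (M * R)) (Phi : M * R -> M * R) c p :
  0 < eps0 -> collar_nbhd eps0 U -> smooth_collar_map U Phi -> Phi (p, 0) = (p, 0) ->
  atlas c -> cdom c p ->
  exists e, exists P : 'rV[R]_(n + 1) -> 'rV[R]_(n + 1),
    [/\ 0 < e, forall j, smooth_open (ball (at0 (c p)) e) (fun z => P z 0 j),
      (forall x, ball (c p) e x -> crange c x) &
      forall z, ball (at0 (c p)) e z -> 0 <= rcoord z ->
       [/\ U (xinv c z), cdom c (Phi (xinv c z)).1 & P z = xmap c (Phi (xinv c z))]].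
Proof.
move=> e00 [[Oc oOc UE] U0] [cPhi sPhi] Phi0 ac cp.
have cx : crange c (c p) by exists p.
pose A := xmap c @` [set q | [/\ U q, cdom c q.1 & cdom c (Phi q).1]].
have A0 : A (at0 (c p)).
  by exists (p, 0); [split => //=; rewrite Phi0|rewrite xmap0].
have /fin_all_exists[OF HOF] j := sPhi c c ac ac j _ A0.
have /fin_all_exists[F HF] j := HOF j.
pose P z : 'rV[R]_(n + 1) := \row_j F j z.
have PE j z : P z 0 j = F j z by rewrite mxE.
have nO : \forall z \near at0 (c p), forall j, OF j z.
  apply: (@filter_forall _ _ OF _ (nbhs_filter (at0 (c p)))) => j; have [oj xj _ _] := HF j.
  by apply: open_nbhs_nbhs.
have nU : \forall q \near (p, 0 : R), 0 <= q.2 -> U q.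
  have n1 : \forall q \near (p, 0 : R), Oc q.
    by apply: open_nbhs_nbhs; split => //; have := U0 p; rewrite UE => -[].
  have n2 : \forall q \near (p, 0 : R), q.2 < eps0.
    have : (fun q : M * R => q.2) @ (p, 0 : R) --> (0 : R) by exact: cvg_snd.
    move/cvgrPdist_lt => /(_ _ e00); apply: filterS => q; rewrite sub0r normrN.
    by apply: le_lt_trans; exact: ler_norm.
  by apply: filterS2 n1 n2 => q q1 q2 q0; rewrite UE; split => //; rewrite /collar /= q0.
have nP : \forall q \near (p, 0 : R), 0 <= q.2 -> U q /\ cdom c (Phi q).1.
  have nD : nbhs (Phi (p, 0)) [set q | cdom c q.1].
    rewrite Phi0; have : (fun q : M * R => q.1) @ (p, 0 : R) --> p by exact: cvg_fst.
    by apply; apply: open_nbhs_nbhs; split => //; exact: cdom_open.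
  apply: filterS2 nU (within_continuous_near cPhi (U0 p) nD) => q Uq Pq q0.
  by split; [exact: Uq|apply: Pq; exact: Uq].
have nP' : \forall z \near at0 (c p), 0 <= rcoord z -> U (xinv c z) /\ cdom c (Phi (xinv c z)).1.
  by have := @xinv_near c (c p) _ cx; rewrite cmapK// => /(_ _ nP).
have nR : \forall z \near at0 (c p), crange c (lsubmx z).
  apply: (@lsubmx_cvg_at0 (c p) (crange c)).
  by apply: open_nbhs_nbhs; split => //; exact: crange_open.
have nA : nbhs (at0 (c p)) [set z | (forall j, OF j z) /\
    ((0 <= rcoord z -> U (xinv c z) /\ cdom c (Phi (xinv c z)).1) /\ crange c (lsubmx z))].
  exact: filterI nO (filterI nP' nR).
have /nbhs_ballP[e /= e0 He] := nA.
exists e, P; split => //.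
- move=> j; have [_ _ sj _] := HF j.
  apply: (@smooth_open_sub _ _ (OF j)) => [z /He[Oz _]|]; first exact: Oz.
  by under eq_fun do rewrite PE.
- by move=> x /ball_at0 /He[_ []] _; rewrite lsubmx_at0.
- move=> z /He[Oz [UP cz]] z0; have [Uz Cz] := UP z0; split => //.
  apply/rowP => j; rewrite PE; have [_ _ _ E] := HF j; rewrite -E //.
  exists (xinv c z); last exact: xinvK.
  by split => //=; exact: cinv_dom.
Qed.

End Charts.

(** * Graphs by contraction *)

(** Makes row vectors available as a complete normed space to [banach_fixed_point]. *)
HB.instance Definition _ (R : realType) (m n : nat) := Complete.on 'M[R]_(m, n).

Section FixedPoint.
Context {R : realType}.

Lemma smooth_lipschitz d (O : set 'rV[R]_d) (I : finType) (f : I -> 'rV[R]_d -> R) x :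
  open O -> O x -> (forall b, smooth_open O (f b)) ->
  exists2 e, 0 < e & exists2 L, 0 <= L & forall y, ball x e y ->
    [/\ O y, forall b, `|f b y| <= L & forall b y', ball x e y' -> `|f b y - f b y'| <= L * `|y - y'|].
Proof.
move=> oO Ox sf.
(* For the sup norm the sum of the absolute partial derivatives is a Lipschitz constant. The
   summands 1 leave room for variation near x, and the last summand also bounds the values. *)
pose Lb b := \sum_j (`|pderiv j (f b) x| + 1) + (`|f b x| + 1).
have Lb0 b : 0 <= Lb b by rewrite addr_ge0 ?addr_ge0// sumr_ge0// => j _; rewrite addr_ge0.
have LbL b : Lb b <= \sum_b Lb b.
  by rewrite (bigD1 b) //= lerDl sumr_ge0.
have cont1 g : smooth_open O g -> \forall y \near x, `|g y| <= `|g x| + 1.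
  move=> sg; have /cvgrPdist_le/(_ 1 ltr01) := smooth_open_continuous sg Ox.
  apply: filterS => y H; have := ler_normD (g y - g x) (g x); rewrite subrK => /le_trans; apply.
  by rewrite addrC lerD2l distrC.
have nA : nbhs x [set y | O y /\ (forall b, `|f b y| <= `|f b x| + 1) /\
   (forall b j, `|pderiv j (f b) y| <= `|pderiv j (f b) x| + 1)].
  apply: filterI; first by apply: open_nbhs_nbhs.
  apply: filterI.
    apply: (@filter_forall _ _ (fun b => [set y | `|f b y| <= `|f b x| + 1]) _ (nbhs_filter x)) => b.
    exact: cont1.
  apply: (@filter_forall _ _ (fun b => [set y | forall j, `|pderiv j (f b) y| <= `|pderiv j (f b) x| + 1]) _ (nbhs_filter x)) => b.
  apply: (@filter_forall _ _ (fun j => [set y | `|pderiv j (f b) y| <= `|pderiv j (f b) x| + 1]) _ (nbhs_filter x)) => j.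
  by apply: cont1; exact: smooth_open_pderiv.
have /nbhs_ballP[e /= e0 He] := nA.
(* [mvt_line] only gives |t| <= 1, so the intermediate point may lie beyond y' on the line; its
   distance to x is below e / 3 + 2 e / 3. *)
exists (e / 3); first by rewrite divr_gt0.
exists (\sum_b Lb b); first exact: sumr_ge0.
have small y : ball x (e / 3) y -> ball x e y.
  by apply: le_ball; lra.
move=> y Hy; have [Oy [fy _]] := He y (small y Hy); split => //.
  move=> b; apply: le_trans (fy b) (le_trans _ (LbL b)).
  by rewrite lerDr sumr_ge0// => j _; rewrite addr_ge0.
move=> b y' Hy'.
have seg t : `|t| <= 1 -> ball x e (y' + t *: (y - y')).
  move: Hy Hy'; rewrite -!ball_normE /= => Hy Hy' t1.
  have -> : x - (y' + t *: (y - y')) = (x - y') + t *: ((x - y) - (x - y')).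
    by apply/rowP => j; rewrite !mxE; ring.
  apply: le_lt_trans (ler_normD _ _) _; rewrite normrZ.
  have := ler_normB (x - y) (x - y'); have := normr_ge0 (x - y - (x - y')) => n0 n1.
  have : `|t| * `|x - y - (x - y')| <= `|x - y - (x - y')| by rewrite ler_piMl.
  lra.
have [t t1] := @mvt_line _ _ (f b) y' (y - y') (fun t t1 => smooth_open_differentiable (sf b) (He _ (seg t t1)).1).
have yE : y' + (y - y') = y by rewrite addrC subrK.
rewrite yE => ->.
set w := y' + t *: (y - y'); have [Ow [_ pw]] := He w (seg t t1).
have dfw := smooth_open_differentiable (sf b) Ow.
rewrite [X in 'd _ _ X](row_sum_delta (y - y')) linear_sum.
apply: le_trans (ler_norm_sum _ _ _) _; rewrite mulrC.
apply: (@le_trans _ _ (`|y - y'| * \sum_j (`|pderiv j (f b) x| + 1))); last first.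
  rewrite ler_wpM2l//; apply: le_trans (LbL b); rewrite lerDl addr_ge0//.
rewrite mulr_sumr; apply: ler_sum => j _; rewrite diffE_pderiv// normrM ler_pM//.
by apply: (normr_rVP _ _).1 => //.
Qed.

Context {k m : nat}.

Definition graph_point (x : 'rV[R]_k) (u : 'rV[R]_m) (t : R) : 'rV[R]_(k + m + 1) :=
  row_mx (row_mx x u) (const_mx t).

Lemma ball_graph_point x0 x u t e : ball x0 e x -> `|u| < e -> `|t| < e ->
  ball (at0 (row_mx x0 0)) e (graph_point x u t).
Proof.
move=> /ball_rVP[e0 H] ue te; apply/ball_rVP; split => // j.
case: (split_ordP j) => j1 ->; rewrite /at0 /graph_point ?row_mxEl ?row_mxEr.
  case: (split_ordP j1) => j2 ->; rewrite ?row_mxEl ?row_mxEr //.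
  rewrite mxE sub0r normrN; apply: le_lt_trans ue.
  by apply: (normr_rVP _ _).1.
by rewrite !mxE sub0r normrN.
Qed.

Lemma graph_pointB x u u' t : graph_point x u t - graph_point x u' t = row_mx (row_mx 0 (u - u')) 0.
Proof. by rewrite /graph_point !opp_row_mx !add_row_mx !subrr. Qed.

Lemma norm_graph_pointB x u u' t : `|graph_point x u t - graph_point x u' t| <= `|u - u'|.
Proof.
rewrite graph_pointB; apply/normr_rVP => // j.
case: (split_ordP j) => j1 ->; last by rewrite row_mxEr mxE normr0.
rewrite row_mxEl; case: (split_ordP j1) => j2 ->; first by rewrite row_mxEl mxE normr0.
by rewrite row_mxEr; exact: (normr_rVP (u - u') (normr_ge0 _)).1 (lexx _) j2.
Qed.

(** For small t the map u |-> - t K(x, u, t) is a contraction of a closed ball, at each (x, t)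
    separately. The bound L t on f makes the graph approach u = 0 as t tends to 0. *)
Lemma graph_fixed_point (O : set 'rV[R]_(k + m + 1)) (x0 : 'rV[R]_k)
    (K : 'I_m -> 'rV[R]_(k + m + 1) -> R) :
  open O -> O (at0 (row_mx x0 0)) -> (forall b, smooth_open O (K b)) ->
  exists2 e, 0 < e & exists2 L, 0 <= L & exists f : 'rV[R]_k * R -> 'rV[R]_m,
    forall x t, ball x0 e x -> 0 <= t < e ->
    [/\ `|f (x, t)| <= L * t,
        forall b, f (x, t) 0 b + t * K b (graph_point x (f (x, t)) t) = 0 &
        forall u : 'rV[R]_m, `|u| < e -> (forall b, u 0 b + t * K b (graph_point x u t) = 0) -> u = f (x, t)].
Proof.
move=> oO Ox sK; have [e e0 [L L0 H]] := smooth_lipschitz oO Ox sK.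
pose T x t (u : 'rV[R]_m) : 'rV[R]_m := \row_b (- (t * K b (graph_point x u t))).
have TE x t (u : 'rV[R]_m) : (forall b, u 0 b + t * K b (graph_point x u t) = 0) <-> u = T x t u.
  split=> [E|E b]; first by apply/rowP => b; rewrite mxE; apply/eqP; rewrite -addr_eq0 E.
  by rewrite {1}E mxE addNr.
pose A := [set u : 'rV[R]_m | `|u| <= e / 2].
(* The first e / 2 keeps graph points in the Lipschitz ball; t L <= e / 2 makes the ball invariant,
   and t L <= 1 / 2 gives the contraction. *)
pose d := Num.min (e / 2) (Num.min (e / 2) (1 / 2) / (L + 1)).
have L1 : 0 < L + 1 by rewrite ltr_wpDl.
have d0 : 0 < d by rewrite /d lt_min !divr_gt0// lt_min !divr_gt0.
have de : d <= e / 2 by rewrite /d ge_min lexx.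
have dL t : 0 <= t < d -> t * L <= e / 2 /\ t * L <= 1 / 2.
  move=> /andP[t0]; rewrite /d lt_min => /andP[_]; rewrite ltr_pdivlMr// => h.
  have : t * L <= t * (L + 1) by rewrite ler_wpM2l// lerDl.
  have := ge_min (e / 2) (e / 2) (1 / 2); have := ge_min (1 / 2 : R) (e / 2) (1 / 2).
  by rewrite !lexx orbT /= => h1 h2 h3; split; lra.
have inb x t u : ball x0 d x -> 0 <= t < d -> A u -> ball (at0 (row_mx x0 0)) e (graph_point x u t).
  move=> bx /andP[t0 td] Au; apply: ball_graph_point.
  - by apply: le_ball bx; lra.
  - by apply: le_lt_trans Au _; lra.
  - by rewrite ger0_norm//; lra.
have Tb x t u : ball x0 d x -> 0 <= t < d -> A u -> `|T x t u| <= L * t.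
  move=> bx td Au; have [_ Kb _] := H _ (inb x t u bx td Au).
  move: td => /andP[t0 td]; apply/normr_rVP => [|b]; first by rewrite mulr_ge0.
  by rewrite mxE normrN normrM ger0_norm// mulrC ler_wpM2r.
have Tl x t u u' : ball x0 d x -> 0 <= t < d -> A u -> A u' -> `|T x t u - T x t u'| <= 1 / 2 * `|u - u'|.
  move=> bx td Au Au'; have [_ _ Kl] := H _ (inb x t u bx td Au).
  have [_ tL] := dL t td; move: (td) => /andP[t0 _].
  apply/normr_rVP => [|b]; first by rewrite mulr_ge0.
  rewrite !mxE -opprD normrN -mulrBr normrM ger0_norm//.
  apply: (@le_trans _ _ (t * (L * `|u - u'|))); last by rewrite mulrA ler_wpM2r.
  rewrite ler_wpM2l//; apply: le_trans (Kl b _ (inb x t u' bx td Au')) _.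
  by rewrite ler_wpM2l// norm_graph_pointB.
have ex x t : ball x0 d x -> 0 <= t < d -> exists u, A u /\ u = T x t u.
  move=> bx td.
  have TA : set_fun A A (T x t).
    move=> u Au; apply: le_trans (Tb x t u bx td Au) _; rewrite mulrC; exact: (dL t td).1.
  have cA : closed A.
    rewrite (_ : A = (fun u => `|u|) @^-1` [set s | s <= e / 2])//.
    by apply: preimage_closed => [u _|]; [exact: norm_continuous|exact: closed_le].
  have A0 : A !=set0 by exists 0; rewrite /A /= normr0 divr_ge0// ltW.
  have ctr : is_contraction (mkfun TA).
    have h2 : 0 <= 1 / 2 :> R by rewrite divr_ge0.
    exists (NngNum h2); split => /=; first by lra.
    by move=> -[u u'] [Au Au'] /=; exact: Tl.
  by have [u Au E] := banach_fixed_point ctr cA A0; exists u.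
exists d => //; exists L => //.
(* f picks a fixed point of norm at most e / 2 where there is one, and is 0 elsewhere. *)
exists (fun y => xget 0 [set u | A u /\ u = T y.1 y.2 u]) => x t bx td.
have [u0 Hu0] := ex x t bx td.
have [] := xgetPex 0 (ex_intro (fun u => A u /\ u = T x t u) u0 Hu0).
rewrite -/(xget _ _) /=; set f := xget _ _ => Af Ef.
split.
- by rewrite Ef; exact: Tb.
- by apply/TE.
- move=> u ud /TE Eu.
  have Au : A u by rewrite /A /= ltW// (lt_le_trans ud).
  have := Tl x t u f bx td Au Af; rewrite -Eu -Ef => h.
  apply/eqP; rewrite -subr_eq0 -normr_le0; have := normr_ge0 (u - f); lra.
Qed.

End FixedPoint.

(** * The transport equation near a boundary point *)

Section Local.
Context {R : realType} {n : nat}.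
Implicit Types (O : set 'rV[R]_(n + 1)).

Lemma flat_to_sub d (O O' : set 'rV[R]_(d + 1)) N F :
  O' `<=` O -> flat_to (O := O) N F -> flat_to (O := O') N F.
Proof.
move=> sub [g sg E]; exists g; first exact: smooth_open_sub sub sg.
by move=> z /sub; exact: E.
Qed.

Lemma near_neq0 d (O : set 'rV[R]_d) f x : smooth_open O f -> O x -> f x != 0 ->
  \forall z \near x, f z != 0.
Proof.
move=> sf Ox fx.
have /cvgrPdist_lt/(_ `|f x|) := smooth_open_continuous sf Ox; rewrite normr_gt0 => /(_ fx).
by apply: filterS => z H; apply: contraTneq H => ->; rewrite subr0 ltxx.
Qed.

Lemma smooth_mx_mul d (O : set 'rV[R]_d) p q s (A : 'rV[R]_d -> 'M[R]_(p, q)) (B : 'rV[R]_d -> 'M[R]_(q, s)) :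
  open O -> smooth_mx O A -> smooth_mx O B -> smooth_mx O (fun z => A z *m B z).
Proof.
move=> oO sA sB i j; under eq_fun do rewrite mxE.
apply: (smooth_open_sum oO) => l _.
by apply: (smooth_openM oO); [exact: sA|exact: sB].
Qed.

Context (C : set 'rV[R]_n) (oC : open C) (x0 : 'rV[R]_n) (e : R) (e0 : 0 < e)
  (eC : forall x, ball x0 e x -> C x).
Context (lambda lambdah : R) (G Gh : 'rV[R]_n -> 'M[R]_n)
  (sG : smooth_mx C G) (sGh : smooth_mx C Gh)
  (symG : forall x, C x -> (G x)^T = G x)
  (posG : forall x, C x -> forall v : 'rV[R]_n, v != 0 -> 0 < (v *m G x *m v^T) 0 0)
  (posGh : forall x, C x -> forall v : 'rV[R]_n, v != 0 -> 0 < (v *m Gh x *m v^T) 0 0)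
  (n_gt0 : (0 < n)%N).
Context (P : 'rV[R]_(n + 1) -> 'rV[R]_(n + 1))
  (sP : forall j, smooth_open (ball (at0 x0) e) (fun z => P z 0 j))
  (P0 : forall x, ball x0 e x -> P (at0 x) = at0 x)
  (rP : forall z, ball (at0 x0) e z -> 0 < rcoord z -> rcoord (P z) != 0).

Definition poincare_coef (l : R) (A : 'rV[R]_n -> 'M[R]_n) (z : 'rV[R]_(n + 1)) : 'M[R]_(n + 1) :=
  (rcoord z) ^- 2 *: block_mx ((1 - 4^-1 * l * rcoord z ^+ 2) ^+ 2 *: A (lsubmx z)) 0 0 1%:M.

Context (isom : forall x, ball x0 e x -> forall N i j, exists K, \forall z \near at0 x, 0 < rcoord z ->
  `|(jacobian P z *m poincare_coef lambdah Gh (P z) *m (jacobian P z)^T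
     - poincare_coef lambda G z) i j| <= K * rcoord z ^+ N).

Let Px0 : P (at0 x0) = at0 x0.
Proof. by apply: P0; exact: ballxx. Qed.

Let z0O e' : 0 < e' -> ball (at0 x0) e' (at0 x0).
Proof. by move=> ?; exact: ballxx. Qed.

(** Derives from positivity of the metrics and from P = id on the slice the nonvanishing conditions
    that [transport_sig] takes as hypotheses. Each holds at the centre, hence on a smaller ball; m
    is the Hadamard quotient of rho by r. *)
Lemma local_transport : exists2 e' : R, 0 < e' <= e & exists mm, exists aa, exists bb,
  [/\ [/\ smooth_open (ball (at0 x0) e') mm, smooth_open (ball (at0 x0) e') aa & smooth_open (ball (at0 x0) e') bb],
      (forall z, ball (at0 x0) e' z -> [/\ mm z != 0, aa z != 0, bb z != 0 &
          mm z + rcoord z * pderiv (rshift n ord0) mm z != 0]),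
      (forall x, ball x0 e' x -> Gh x = mm (at0 x) ^+ 2 *: G x) &
      forall I, flat (O := ball (at0 x0) e') (fun z =>
        pderiv (rshift n ord0) (fun y => P y 0 (lshift 1 I)) z * (mm z + rcoord z * pderiv (rshift n ord0) mm z)
        - rcoord z * ((aa z)^-1 * mm z ^+ 2 * (bb z)^-1) *
          \sum_i pderiv (lshift 1 i) (fun y => P y 0 (lshift 1 I)) z *
            \sum_j invmx (G (lsubmx z)) i j * pderiv j (fun x => (mm (at0 x))^-1) (lsubmx z))].
Proof.
have cP : P z @[z --> at0 x0] --> at0 x0.
  rewrite -[X in _ --> X]Px0; apply: differentiable_continuous; apply: differentiable_rV => j.
  exact: smooth_open_differentiable (sP j) (z0O e0).
have Cx0 : C x0 by apply: eC; exact: ballxx.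
have n1 : \forall z \near at0 x0, C (lsubmx (P z)).
  have nC : nbhs x0 C by exact: open_nbhs_nbhs.
  exact: (cP _ (@lsubmx_cvg_at0 R n x0 C nC)).
(* The components X of P must take values in C, where the metric coefficients are smooth. *)
have [e1 e10 [e1e He1]] : exists2 e1 : R, 0 < e1 & e1 <= e /\ forall z, ball (at0 x0) e1 z -> C (lsubmx (P z)).
  have /nbhs_ballP[d /= d0 Hd] := n1.
  exists (Num.min d e); first by rewrite lt_min d0.
  split=> [|z Hz]; first by rewrite ge_min lexx orbT.
  by apply: Hd; apply: le_ball Hz; rewrite ge_min lexx.
pose O1 := ball (at0 x0) e1.
have oO1 : open O1 by exact: ball_open.
have sub1 : O1 `<=` ball (at0 x0) e by move=> z; exact: le_ball.
have O1B z : O1 z -> ball x0 e1 (lsubmx z) by move=> /ball_lsubmx; rewrite lsubmx_at0.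
have BO1 x : ball x0 e1 x -> O1 (at0 x) by move/ball_at0.
have sP1 j : smooth_open O1 (fun z => P z 0 j) by exact: smooth_open_sub sub1 (sP j).
have P01 x : ball x0 e1 x -> P (at0 x) = at0 x by move=> bx; apply: P0; exact: le_ball bx.
have [z Oz rz0|mm smm Emm] := hadamard oO1 (sP1 (rshift n ord0)).
  have -> : z = at0 (lsubmx z) by rewrite at0_lsubmx -[in RHS]rz0 setr_id.
  by rewrite P01 ?[at0 _ _ _]rcoord_at0//; exact: O1B.
have Pm z : O1 z -> rcoord (P z) = rcoord z * mm z by exact: Emm.
have uG x : C x -> G x \in unitmx by move=> /posG; exact: posdef_unitmx.
have uGh x : C x -> Gh x \in unitmx by move=> /posGh; exact: posdef_unitmx.
pose aa (z : 'rV[R]_(n + 1)) := 1 - 4^-1 * lambda * rcoord z ^+ 2.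
pose bb (z : 'rV[R]_(n + 1)) := 1 - 4^-1 * lambdah * rcoord (P z) ^+ 2.
have srr : smooth_open O1 (@rcoord R n) by exact: smooth_rcoord.
have saa : smooth_open O1 aa by rewrite /aa; prove_smooth.
have srP : smooth_open O1 (fun z => rcoord (P z)) := sP1 (rshift n ord0).
have sbb : smooth_open O1 bb by rewrite /bb; prove_smooth.
have sJ1 := smooth_jacobian oO1 sP1.
pose T := conformal_defect lambda lambdah G Gh P mm.
have sT : smooth_mx O1 T.
  move=> i j; under eq_fun do rewrite /T /conformal_defect mxE [X in _ + X]mxE [X in _ - X]mxE.
  apply: smooth_openB => //.
    apply: (smooth_mx_mul oO1 (smooth_mx_mul oO1 sJ1 _)) => [|k l].
      apply: smooth_mx_block => // k l; under eq_fun do rewrite mxE.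
      apply: smooth_openM => //; first by prove_smooth.
      apply: (smooth_open_comp oO1 (sGh k l)) => // j'.
      by under eq_fun do rewrite mxE; exact: sP1.
    by under eq_fun do rewrite mxE; exact: sJ1.
  apply: smooth_openM => //; first by prove_smooth.
  move: i j; apply: smooth_mx_block => // k l; under eq_fun do rewrite mxE.
  apply: smooth_openM => //; first by prove_smooth.
  by apply: (smooth_lsubmx oO1 (sG k l)) => z /O1B bz; apply: eC; exact: le_ball bz.
have fT : flat_mx (O := O1) T.
  move=> i j; apply: bigO_flat => // z Oz rz0 N.
  have zE : z = at0 (lsubmx z) by rewrite at0_lsubmx -[in RHS]rz0 setr_id.
  have bz : ball x0 e (lsubmx z) by apply: le_ball (O1B z Oz).
  have [K HK] := isom bz N i j; rewrite -zE in HK.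
  exists `|K|.
  have nO : nbhs z O1 by exact: open_nbhs_nbhs.
  have n2 : \forall y \near z, `|rcoord (P y)| < 1.
    have := smooth_open_continuous srP Oz; move/cvgrPdist_lt => /(_ 1 ltr01).
    by apply: filterS => y; rewrite (Pm z Oz) rz0 mul0r sub0r normrN.
  have nA : nbhs z [set y | O1 y /\ `|rcoord (P y)| < 1 /\ (0 < rcoord y -> `|(jacobian P y *m poincare_coef lambdah Gh (P y) *m (jacobian P y)^T
     - poincare_coef lambda G y) i j| <= K * rcoord y ^+ N)].
    exact: filterI nO (filterI n2 HK).
  apply: filterS nA => y [Oy [rP1 Hy]] ry.
  have rP0 := rP (sub1 _ Oy) ry; have {}Hy := Hy ry.
  (* Multiplying by rho^2 removes the poles of both metrics, and |rho| < 1 keeps the bound of order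
     N. *)
  have TE : T y = rcoord (P y) ^+ 2 *: (jacobian P y *m poincare_coef lambdah Gh (P y) *m (jacobian P y)^T
     - poincare_coef lambda G y).
    rewrite /T /conformal_defect /poincare_coef scalerBr -scalemxAr -scalemxAl scalerA mulfV ?expf_neq0// scale1r.
    congr (_ - _); rewrite scalerA; congr (_ *: _).
    by rewrite (Pm y Oy) exprMn mulrAC mulfV ?mul1r// expf_neq0 ?gt_eqF.
  rewrite TE mxE normrM; apply: le_trans (_ : 1 * (K * rcoord y ^+ N) <= _).
    rewrite ler_pM// normrX exprn_ile1//; exact: ltW.
  by rewrite mul1r ler_wpM2r ?ler_norm// exprn_ge0// ltW.
have bm x : ball x0 e1 x -> Gh x = mm (at0 x) ^+ 2 *: G x.
  by apply: (boundary_metric oO1 (ball_open x0 e1) BO1 sP1 P01 smm Pm fT).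
have z01 : O1 (at0 x0) by exact: ballxx.
(* Otherwise [bm] would make Gh zero at x0, against its positivity in dimension n > 0. *)
have mm0 : mm (at0 x0) != 0.
  apply/eqP => m0; have := bm x0 (ballxx _ e10); rewrite m0 expr0n /= scale0r => Gh0.
  have v0 : (delta_mx 0 (Ordinal n_gt0) : 'rV[R]_n) != 0.
    by apply/eqP => /rowP/(_ (Ordinal n_gt0)); rewrite !mxE !eqxx /= => /eqP; rewrite oner_eq0.
  by have := posGh Cx0 v0; rewrite Gh0 mulmx0 mul0mx mxE ltxx.
have rz0 : rcoord (at0 x0) = 0 := rcoord_at0 x0.
(* At the centre the Jacobian is block triangular with diagonal blocks 1 and m. *)
have J0 : \det (jacobian P (at0 x0)) != 0.
  have JE i j : jacobian P (at0 x0) i j = pderiv i (fun y => P y 0 j) (at0 x0) by exact: (jacobian_pderiv sP1 i j z01).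
  have B0 : ball x0 e1 x0 by exact: ballxx.
  have -> : jacobian P (at0 x0) = block_mx 1%:M 0 (dlsubmx (jacobian P (at0 x0))) (const_mx (mm (at0 x0))).
    rewrite -[LHS]submxK; congr block_mx.
    - apply/matrixP => i j; rewrite [LHS]mxE [LHS]mxE JE [RHS]mxE.
      by rewrite (DX_at0 (ball_open x0 e1) BO1 sP1 P01 _ _ B0) eq_sym.
    - apply/matrixP => i j; rewrite [LHS]mxE [LHS]mxE JE [RHS]mxE (ord1 j).
      by rewrite (D_rho oO1 smm Pm)// rz0 mul0r.
    - apply/matrixP => i j; rewrite [LHS]mxE [LHS]mxE JE [RHS]mxE (ord1 j) (ord1 i).
      by rewrite (rd_rho oO1 smm Pm)// rz0 mul0r addr0.
  by rewrite det_lblock det1 mul1r det_mx11 mxE.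
have srdm := smooth_open_pderiv (rshift n ord0) smm.
pose Good := [set z | mm z != 0 /\ (\det (jacobian P z) != 0 /\
    (mm z + rcoord z * pderiv (rshift n ord0) mm z != 0 /\ (aa z != 0 /\ (bb z != 0 /\
     1 + 4^-1 * lambdah * (rcoord z * mm z) ^+ 2 != 0))))].
have nA : nbhs (at0 x0) Good.
  apply: filterI; first exact: (near_neq0 smm).
  apply: filterI; first by apply: (near_neq0 (smooth_open_det oO1 sJ1)).
  apply: filterI.
    apply: (near_neq0 (O := O1) (f := fun z => mm z + rcoord z * pderiv (rshift n ord0) mm z)) => //; first by prove_smooth.
    by rewrite rz0 mul0r addr0.
  apply: filterI.
    by apply: (near_neq0 saa) => //; rewrite /aa rz0 expr0n mulr0 subr0 oner_eq0.
  apply: filterI.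
    by apply: (near_neq0 sbb) => //; rewrite /bb Px0 rz0 expr0n mulr0 subr0 oner_eq0.
  apply: (near_neq0 (O := O1) (f := fun z => 1 + 4^-1 * lambdah * (rcoord z * mm z) ^+ 2)) => //; first by prove_smooth.
  by rewrite rz0 mul0r expr0n mulr0 addr0 oner_eq0.
have /nbhs_ballP[d /= d0 Hd] := nA.
pose e2 := Num.min d e1.
have e20 : 0 < e2 by rewrite lt_min d0.
have e2e1 : e2 <= e1 by rewrite ge_min lexx orbT.
pose O2 := ball (at0 x0) e2.
have oO2 : open O2 by exact: ball_open.
have sub2 : O2 `<=` O1 by move=> z; exact: le_ball.
have H2 z : O2 z -> Good z by move=> Oz; apply: Hd; apply: le_ball Oz; rewrite ge_min lexx.
exists e2; first by rewrite e20 (le_trans e2e1).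
exists mm, aa, bb; split.
- by split; exact: smooth_open_sub sub2 _.
- by move=> z /H2[? [_ [? [? []]]]].
- by move=> x bx; apply: bm; exact: le_ball bx.
move=> I; apply: (transport_sig oO2 (ball_open x0 e2) oC _ _ _ sG sGh uG uGh symG (mm := mm)).
- by move=> x bx; apply: eC; apply: le_ball bx; exact: le_trans e1e.
- by move=> z /ball_lsubmx; rewrite lsubmx_at0.
- by move=> x /ball_at0.
- by move=> j; exact: smooth_open_sub sub2 (sP1 j).
- by move=> z /sub2 /He1.
- by move=> x bx; apply: P01; exact: le_ball bx.
- exact: smooth_open_sub sub2 _.
- by move=> z /H2[].
- by move=> z /sub2 /Pm.
- by move=> z /H2[_ []]; rewrite unitmxE unitfE.
- by move=> z /H2[_ [_ [_ []]]].
- by move=> z /H2[_ [_ [_ [_ []]]]].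
- by move=> i j N; apply: flat_to_sub sub2 (fT i j N).
- by move=> z /H2[_ [_ []]].
- by move=> z /H2[_ [_ [_ [_ []]]]].
Qed.

End Local.

(** * The image of the slice *)

Section Main.
Context {R : realType}.

Lemma smooth_on_open d (A : set 'rV[R]_d) f : open A -> smooth_on A f -> smooth_open A f.
Proof.
move=> oA sf s x Ax; have [W [F [oW Wx sF E]]] := sf x Ax.
have oAW : open (A `&` W) by exact: openI.
have sAW : smooth_open (A `&` W) f.
  apply: (@smooth_open_ext _ _ _ F) => //.
    by move=> y; rewrite inE => -[Ay Wy]; rewrite E.
  by apply: smooth_open_sub sF => y [].
by apply: sAW; split.
Qed.

Lemma jacobian_near_eq d e (f h : 'rV[R]_d -> 'rV[R]_e) x :
  (\forall y \near x, f y = h y) -> (forall j, differentiable (fun y => h y 0 j) x) ->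
  jacobian f x = jacobian h x.
Proof.
move=> fh dh.
have fhj j : \forall y \near x, h y 0 j = f y 0 j by apply: filterS fh => y ->.
have df j : differentiable (fun y => f y 0 j) x.
  exact: (differentiable_near_eq (fhj j) (dh j)).
apply/matrixP => i j.
apply: (etrans (jacobianE df i j)); apply: etrans (esym (jacobianE dh i j)).
by apply: pderiv_near_eq; apply: filterS (fhj j) => y ->.
Qed.

Lemma chart_extension_at0 n (M : manifold R n) (U : set (M * R)) (Phi : M * R -> M * R) (c : chart R n M)
    (x0 : 'rV[R]_n) (e : R) (P : 'rV[R]_(n + 1) -> 'rV[R]_(n + 1)) :
  (forall x : 'rV[R]_n, ball x0 e x -> crange c x) -> (forall p : M, Phi (p, 0 : R) = (p, 0 : R)) ->
  (forall z : 'rV[R]_(n + 1), ball (at0 x0) e z -> 0 <= rcoord z ->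
       [/\ U (xinv c z), cdom c (Phi (xinv c z)).1 & P z = xmap c (Phi (xinv c z))]) ->
  forall x : 'rV[R]_n, ball x0 e x -> P (at0 x) = at0 x.
Proof.
move=> eC Phi0 HP x bx; have [|_ _ ->] := HP (at0 x) (ball_at0 bx); first by rewrite rcoord_at0.
by rewrite /xinv lsubmx_at0 rcoord_at0 Phi0 xmap0 cinvK//; exact: eC.
Qed.

Section Slices.
Context {k m : nat} (k_ge1 : (1 <= k)%N) (M : manifold R (k + m)) (g ghat : metric M)
  (lambda lambdahat : R) (Sigma : set M) (eps0 : R) (U V : set (M * R)) (Phi Psi : M * R -> M * R).
Context (ming : minimal g Sigma) (minh : minimal ghat Sigma) (eps0_gt0 : 0 < eps0)
  (cU : collar_nbhd eps0 U) (cV : collar_nbhd eps0 V)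
  (sPhi : smooth_collar_map U Phi) (sPsi : smooth_collar_map V Psi)
  (PsiK : forall q, U q -> V (Phi q) /\ Psi (Phi q) = q)
  (PhiK : forall q, V q -> U (Psi q) /\ Phi (Psi q) = q)
  (Phi0 : forall p : M, Phi (p, 0) = (p, 0))
  (isom : pulls_back_to_infinite_order U Phi (poincare g lambda) (poincare ghat lambdahat)).
Context (c : chart R (k + m) M) (slc : slice_chart Sigma c) (p : M) (cp : cdom c p) (Sp : Sigma p).

Let ac : atlas c. Proof. by case: slc. Qed.
Let x0 := c p.
Let U0 q : U (q, 0). Proof. by case: cU. Qed.
Let Ucollar q : U q -> 0 <= q.2. Proof. by case: cU => -[W _ ->] _ [_ /andP[]]. Qed.
Let Psi0 q : Psi (q, 0) = (q, 0). Proof. by have [_] := PsiK (U0 q); rewrite Phi0. Qed.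

Let x0S : rsubmx x0 = 0. Proof. by have [_ /(_ _ cp)[+ _]] := slc; exact. Qed.

Let y0 : 'rV[R]_(k + 1) := at0 (lsubmx x0).
Let at0_x0 : at0 x0 = slice_emb y0.
Proof.
rewrite /slice_emb /y0 lsubmx_at0 /at0 row_mxKr; congr row_mx.
by rewrite -[LHS]hsubmxK x0S.
Qed.

(** Produces the infinite-order vanishing, along Sigma x [0, eps0), of the normal components of Phi.
    The graph of the image is extracted from it afterwards. *)
Lemma slice_transport : exists e, exists P : 'rV[R]_(k + m + 1) -> 'rV[R]_(k + m + 1),
  [/\ 0 < e, (forall x, ball x0 e x -> crange c x),
      forall z, ball (at0 x0) e z -> 0 <= rcoord z ->
       [/\ U (xinv c z), cdom c (Phi (xinv c z)).1 & P z = xmap c (Phi (xinv c z))] &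
      forall (b : 'I_m) N, exists K, \forall y \near y0,
        `|P (slice_emb y) 0 (lshift 1 (rshift k b))| <= K * `|rcoord y| ^+ N].
Proof.
have [e [P [e0 sP eC HP]]] := chart_extension eps0_gt0 cU sPhi (Phi0 p) ac cp.
exists e, P; split => //.
have P0 := chart_extension_at0 eC Phi0 HP.
have oC : open (crange c) by exact: crange_open.
have sG : smooth_mx (crange c) (g c) by move=> i j; apply: smooth_on_open => //; exact: g_smooth.
have sGh : smooth_mx (crange c) (ghat c) by move=> i j; apply: smooth_on_open => //; exact: g_smooth.
(* If an interior point were sent to (q, 0), it would share its image with (q, 0), which Phi fixes;
   the inverse Psi excludes this. *)
have rP z : ball (at0 x0) e z -> 0 < rcoord z -> rcoord (P z) != 0.
  move=> bz rz; have [Uz _ ->] := HP z bz (ltW rz).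
  rewrite rcoord_xmap; apply/eqP => E.
  have EP : Phi (xinv c z) = Phi ((Phi (xinv c z)).1, 0).
    by rewrite Phi0 -[in RHS]E; case: (Phi _).
  have := (PsiK Uz).2; rewrite EP (PsiK (U0 _)).2 => /(congr1 snd) /= Er.
  by rewrite -Er ltxx in rz.
have iso x : ball x0 e x -> forall N i j, exists K, \forall z \near at0 x, 0 < rcoord z ->
  `|(jacobian P z *m poincare_coef lambdahat (ghat c) (P z) *m (jacobian P z)^T
     - poincare_coef lambda (g c) z) i j| <= K * rcoord z ^+ N.
  move=> bx N i j; have cx := eC x bx.
  have [K HK] := isom ac (cinv_dom cx) i j N.
  exists K.
  have nb : nbhs (at0 x) (ball (at0 x0) e).
    by apply: open_nbhs_nbhs; split; [exact: ball_open|exact: ball_at0].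
  apply: filterS2 nb (xinv_near cx HK) => z bz Hz rz.
  have [Uz _ Pz] := HP z bz (ltW rz).
  have cz : crange c (lsubmx z) by apply: eC; move: bz => /ball_lsubmx; rewrite lsubmx_at0.
  (* Since r > 0 is an open condition, Phi in the chart and its extension P have the same Jacobian
     at z. *)
  have near_in : \forall y \near z, in_charts Phi c c y = P y.
    have n1 : nbhs z (ball (at0 x0) e) by apply: open_nbhs_nbhs; split => //; exact: ball_open.
    have n2 : \forall y \near z, 0 < rcoord y.
      have := @coord_continuous R 1 (k + m + 1) 0 (rshift (k + m) ord0) z.
      move/cvgrPdist_lt => /(_ _ rz); apply: filterS => y.
      rewrite -/(rcoord z) -/(rcoord y) => h; have := ler_norm (rcoord z - rcoord y); lra.
    by apply: filterS2 n1 n2 => y b1 r1; have [_ _ ->] := HP y b1 (ltW r1).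
  have := Hz Uz rz; rewrite (xinvK cz) /pullback.
  rewrite (jacobian_near_eq near_in) => [|j']; last exact: smooth_open_differentiable (sP j') bz.
  by rewrite (nbhs_singleton near_in).
have [|e' /andP[e'0 e'e] [mm [aa [bb [[smm saa sbb] nz bm tf]]]]] :=
  local_transport oC e0 eC sG sGh (fun x Cx => g_sym g ac Cx) (fun x Cx => g_pos g ac Cx)
   (fun x Cx => g_pos ghat ac Cx) _ sP P0 rP iso.
  by rewrite addn_gt0 k_ge1.
move=> b N.
pose O := ball (at0 x0) e'.
have oO : open O by exact: ball_open.
have OB z : O z -> ball x0 e' (lsubmx z) by move=> /ball_lsubmx; rewrite lsubmx_at0.
have BO x : ball x0 e' x -> O (at0 x) by move/ball_at0.
have BC x : ball x0 e' x -> crange c x by move=> bx; apply: eC; exact: le_ball bx.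
have oB : open (ball x0 e') by exact: ball_open.
have uG x : crange c x -> g c x \in unitmx by move=> /(g_pos g ac) pg; exact: posdef_unitmx.
pose sig x := (mm (at0 x))^-1.
have sm0 : smooth_open (ball x0 e') (fun x => mm (at0 x)) by exact: smooth_at0 smm BO.
have ssig : smooth_open (ball x0 e') sig.
  by apply: smooth_openV => // x /BO /nz[].
pose Y i (z : 'rV[R]_(k + m + 1)) := \sum_j invmx (g c (lsubmx z)) i j * pderiv j sig (lsubmx z).
(* [normal_gradient] with w = m0 makes grad m0 tangent to Sigma at its points, and d sigma = - m0^-2
   d m0 is proportional to d m0. *)
have normal x : ball x0 e' x -> rsubmx x = 0 -> forall b', \sum_j invmx (g c x) (rshift k b') j * pderiv j sig x = 0.
  move=> bx xS b'; have Cx := BC x bx; have [m0 _ _ _] := nz _ (BO x bx).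
  have cS : Sigma (cinv c x) by apply/(slc.2 _ (cinv_dom Cx)); rewrite cinvK.
  have := ming slc (cinv_dom Cx) cS; have := minh slc (cinv_dom Cx) cS; rewrite cinvK// => mh mg.
  have GhG : \forall y \near x, ghat c y = mm (at0 y) ^+ 2 *: g c y.
    have : nbhs x (ball x0 e') by exact: open_nbhs_nbhs.
    by apply: filterS => y; exact: bm.
  have dG i j : differentiable (fun y => g c y i j) x by exact: smooth_open_differentiable (sG i j) Cx.
  have := normal_gradient dG (smooth_open_differentiable sm0 bx) m0 GhG (g_sym g ac Cx) (g_pos g ac Cx) k_ge1 mg mh.
  move/rowP/(_ b'); rewrite !mxE => E.
  have -> : \sum_j invmx (g c x) (rshift k b') j * pderiv j sig x =
     - ((mm (at0 x))^-1 * (mm (at0 x))^-1) * \sum_j invmx (g c x) (rshift k b') j * pderiv j (fun x => mm (at0 x)) x.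
    rewrite mulr_sumr; apply: eq_bigr => j _.
    have [_ ->] := has_pderivV m0 (has_pderiv_smooth j sm0 bx).
    by ring.
  by rewrite E mulr0.
have sY i : smooth_open O (Y i).
  apply: smooth_open_sum => // j _; apply: smooth_openM => //.
    apply: (smooth_lsubmx oO (smooth_open_invmx oC sG uG i j)) => z /OB; exact: BC.
  by apply: (smooth_lsubmx oO (smooth_open_pderiv j ssig)).
have srdm := smooth_open_pderiv (rshift (k + m) ord0) smm.
have sub : O `<=` ball (at0 x0) e by move=> z; exact: le_ball.
have emb_at0 y : rcoord y = 0 -> slice_emb y = at0 (row_mx (lsubmx y) (0 : 'rV[R]_m)).
  move=> ry; rewrite /slice_emb /at0; congr row_mx; apply/rowP => j.
  by rewrite [RHS]mxE (ord1 j) mxE.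
have lemb (y : 'rV[R]_(k + 1)) : lsubmx (@slice_emb R k m y) = row_mx (lsubmx y) 0 by rewrite /slice_emb row_mxKl.
pose I := lshift 1 (rshift k b).
have srr : smooth_open O (@rcoord R (k + m)) by exact: smooth_rcoord.
have F : flat (O := slice_emb @^-1` O) (fun y => P (slice_emb y) 0 I).
  apply: (@flat_on_slice R k m O oO (fun z => P z 0 I)
    (fun z => mm z + rcoord z * pderiv (rshift (k + m) ord0) mm z)
    (fun z => (aa z)^-1 * mm z ^+ 2 * (bb z)^-1) Y) => //.
  - exact: smooth_open_sub sub (sP I).
  - by prove_smooth.
  - apply: (smooth_openM oO); last by apply: (smooth_openV oO) => // z /nz[].
    by apply: (smooth_openM oO); [apply: (smooth_openV oO) => // z /nz[]|exact: smooth_openX].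
  - by move=> z /nz[].
  - by move=> y b' Oy; apply: normal; [exact: OB|rewrite lemb row_mxKr].
  - move=> y Oy ry; rewrite emb_at0// P0.
      by rewrite /at0 row_mxEl row_mxEr mxE.
    by have := OB _ Oy; rewrite lemb; exact: le_ball.
  - exact: tf.
have y0O : (slice_emb @^-1` O) y0 by rewrite /preimage /= -at0_x0; exact: ballxx.
have oO1 : open (slice_emb @^-1` O) by exact: open_slice.
have [K HK] := flat_to_bound oO1 (F N) y0O.
by exists K.
Qed.

(* Write Psi^u = u + r K near the slice. A point z = (x, u, r) is the image of a point of
   Sigma x [0, eps0) iff Psi^u z = 0, i.e. iff u is the fixed point of - r K(x, -, r), so this
   fixed point f is the graphing function. Its value u = P(Q z)^u is the normal component of
   Phi at a point Q z of the slice, hence O(r^N). *)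
Lemma image_graph : exists f : 'rV[R]_k * R -> 'rV[R]_m,
  (\forall q \near (p, 0 : R), 0 <= q.2 ->
    ((Phi @` [set q' | U q' /\ Sigma q'.1]) q <-> rsubmx (c q.1) = f (lsubmx (c q.1), q.2))) /\
  (forall j : 'I_m, vanishes_to_infinite_order setT (fun y => f y 0 j) (lsubmx (c p))).
Proof.
have [e [P [e0 eC HP PB]]] := slice_transport.
have [eQ [Q [eQ0 sQ eQC HQ]]] := chart_extension eps0_gt0 cV sPsi (Psi0 p) ac cp.
have Q0 := chart_extension_at0 eQC Psi0 HQ.
pose O := ball (at0 x0) eQ.
have oO : open O by exact: ball_open.
have zO : O (at0 x0) by exact: ballxx.
have OB z : O z -> ball x0 eQ (lsubmx z) by move=> /ball_lsubmx; rewrite lsubmx_at0.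
pose I b : 'I_(k + m + 1) := lshift 1 (rshift k b).
have slice0 (z : 'rV[R]_(k + m + 1)) : rcoord z = 0 -> z = at0 (lsubmx z) by move=> rz; rewrite at0_lsubmx -[in RHS]rz setr_id.
have HK b : exists2 K, smooth_open O K & forall z, O z -> Q z 0 (I b) - z 0 (I b) = rcoord z * K z.
  apply: hadamard => //.
    by apply: (smooth_openB oO); [exact: sQ|exact: smooth_open_coord].
  move=> z Oz rz; rewrite {1}(slice0 z rz) Q0; last exact: OB.
  by rewrite -(slice0 z rz) subrr.
have /fin_all_exists2[K sK EK] := HK.
(* The height of Psi is r [mQ], so powers of the height at Q z are controlled by powers of r at
   z. *)
have [z Oz rz|mQ smQ EQ] := hadamard oO (sQ (rshift (k + m) ord0)).
  rewrite (slice0 z rz) Q0; first exact: rcoord_at0.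
  exact: OB.
have x0E : row_mx (lsubmx x0) (0 : 'rV[R]_m) = x0 by rewrite -[RHS]hsubmxK x0S.
have zO' : O (at0 (row_mx (lsubmx x0) (0 : 'rV[R]_m))) by rewrite x0E.
have [e3 e30 [L L0 [f Hf]]] := graph_fixed_point oO zO' sK.
have graph_pointE (z : 'rV[R]_(k + m + 1)) : z = graph_point (lsubmx (lsubmx z)) (rsubmx (lsubmx z)) (rcoord z).
  by rewrite /graph_point hsubmxK; apply/esym; exact: setr_id.
have onS z : O z -> 0 <= rcoord z ->
    Sigma (Psi (xinv c z)).1 <-> forall b, (rsubmx (lsubmx z)) 0 b + rcoord z * K b z = 0.
  move=> Oz rz; have [Vz cz Qz] := HQ z Oz rz.
  have E b : (rsubmx (lsubmx z)) 0 b + rcoord z * K b z = (rsubmx (c (Psi (xinv c z)).1)) 0 b.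
    have -> : (rsubmx (lsubmx z)) 0 b = z 0 (I b) by rewrite !mxE.
    rewrite -EK// addrC subrK Qz [RHS]mxE; exact: row_mxEl.
  split=> [/(slc.2 _ cz) S0 b|H]; first by rewrite E S0 mxE.
  by apply/(slc.2 _ cz)/rowP => b; rewrite -E H mxE.
exists f; split.
- have n1 : \forall q \near (p, 0 : R), cdom c q.1.
    have : (fun q : M * R => q.1) @ (p, 0 : R) --> p by exact: cvg_fst.
    by apply; apply: open_nbhs_nbhs; split => //; exact: cdom_open.
  have n2 : \forall q \near (p, 0 : R), ball (at0 x0) (Num.min eQ e3) (xmap c q).
    apply: (xmap_cvg cp); apply: open_nbhs_nbhs; split; first exact: ball_open.
    by apply: ballxx; rewrite lt_min eQ0.
  apply: filterS2 n1 n2 => q cq bq q0.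
  set z := xmap c q in bq.
  have rz : rcoord z = q.2 by exact: rcoord_xmap.
  have qE : xinv c z = q by exact: xmapK.
  have Oz : O z by apply: le_ball bq; rewrite ge_min lexx.
  have b3 : ball (at0 x0) e3 z by apply: le_ball bq; rewrite ge_min lexx orbT.
  have rz0 : 0 <= rcoord z by rewrite rz.
  have [Vq cPq Qz] := HQ z Oz rz0; rewrite qE in Vq cPq Qz.
  have lz : lsubmx z = c q.1 by exact: lsubmx_xmap.
  have : (Phi @` [set q' | U q' /\ Sigma q'.1]) q <-> Sigma (Psi q).1.
    split=> [[q' [Uq' Sq'] <-]|Sq]; first by rewrite (PsiK Uq').2.
    by have [Uq Eq] := PhiK Vq; exists (Psi q).
  move=> ->; have := onS z Oz rz0; rewrite qE lz rz => ->.
  have bx : ball (lsubmx x0) e3 (lsubmx (c q.1)).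
    rewrite -lz; move: b3 => /ball_rVP[_ H]; apply/ball_rVP; split => // j.
    have := H (lshift 1 (lshift m j)); rewrite /at0 row_mxEl.
    by rewrite -[x0 _ _]/(x0 0 (lshift m j)) !mxE.
  have tq : 0 <= q.2 < e3.
    rewrite q0 -rz; move: b3 => /ball_rVP[_ /(_ (rshift (k + m) ord0))].
    rewrite /at0 row_mxEr mxE sub0r normrN; apply: le_lt_trans; exact: ler_norm.
  have uq : `|rsubmx (c q.1)| < e3.
    have : forall b, `|rsubmx (c q.1) 0 b| < e3.
      move=> b; move: b3 => /ball_rVP[_ /(_ (I b))].
      rewrite /at0 row_mxEl -lz !mxE.
      by have /rowP/(_ b) := x0S; rewrite !mxE => ->; rewrite sub0r normrN.
    move=> H; rewrite [`|_|]/Num.Def.normr /= mx_normrE.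
    by apply: bigmax_lt => // -[i j] _ /=; rewrite (ord1 i).
  have [_ fE fU] := Hf _ _ bx tq.
  have zE : z = graph_point (lsubmx (c q.1)) (rsubmx (c q.1)) q.2 by rewrite -lz -rz -graph_pointE.
  split=> [H|H b]; first by apply: fU => // b; rewrite -zE.
  by rewrite zE H; exact: fE.
- move=> b N.
  have [C HC] := PB b N.
  (* Because |f(x, t)| <= L t, graph points over a small neighbourhood of (x, 0) lie near the
     boundary point; L enters the radius for this reason. *)
  have near_graph_point (W : set 'rV[R]_(k + m + 1)) : nbhs (at0 x0) W ->
      \forall y \near (lsubmx x0, 0 : R), 0 <= y.2 ->
        (ball (lsubmx x0) e3 y.1 /\ 0 <= y.2 < e3) /\ W (graph_point y.1 (f y) y.2).
    move=> /nbhs_ballP[d /= d0 Hd].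
    have L1 : 0 < L + 1 by rewrite ltr_wpDl.
    pose d' := Num.min (Num.min d e3) (d / (L + 1)).
    have d'0 : 0 < d' by rewrite !lt_min d0 e30 divr_gt0.
    have [d'd [d'e d'L]] : d' <= d /\ d' <= e3 /\ d' <= d / (L + 1).
      by rewrite /d' !ge_min !lexx !orbT.
    apply/nbhs_ballP; exists d' => // -[x t] [/= bx bt] t0.
    have td : t < d' by move: bt; rewrite /ball /= sub0r normrN ger0_norm.
    have b3 : ball (lsubmx x0) e3 x by exact: le_ball bx.
    have t3 : 0 <= t < e3 by rewrite t0 (lt_le_trans td).
    split => //; apply: Hd; rewrite -x0E; apply: ball_graph_point.
    - exact: le_ball bx.
    - have [fL _ _] := Hf x t b3 t3; apply: le_lt_trans fL _.
      have : t * (L + 1) < d by rewrite -ltr_pdivlMr//; exact: lt_le_trans d'L.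
      by have := t0; lra.
    - by rewrite ger0_norm//; exact: lt_le_trans d'd.
  have Cm : \forall z \near at0 x0, `|mQ z| <= `|mQ (at0 x0)| + 1.
    have /cvgrPdist_le/(_ 1 ltr01) := smooth_open_continuous smQ zO.
    apply: filterS => z H; have := ler_normD (mQ z - mQ (at0 x0)) (mQ (at0 x0)); rewrite subrK => /le_trans; apply.
    by rewrite addrC lerD2l distrC.
  pose drop (z : 'rV[R]_(k + m + 1)) : 'rV[R]_(k + 1) := row_mx (lsubmx (lsubmx z)) (rsubmx z).
  have cQ : Q z @[z --> at0 x0] --> at0 x0.
    rewrite -[X in _ --> X](Q0 x0); last exact: ballxx.
    apply: differentiable_continuous; apply: differentiable_rV => j.
    exact: smooth_open_differentiable (sQ j) zO.
  have cdrop : drop z @[z --> at0 x0] --> y0.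
    have cl : lsubmx (lsubmx z) @[z --> at0 x0] --> lsubmx x0.
      move=> W h; exact: (@lsubmx_cvg_at0 R (k + m) x0 _ (@continuous_lsubmx R 1 k m x0 _ h)).
    have cr : rsubmx z @[z --> at0 x0] --> (0 : 'rV[R]_1).
      rewrite -[X in _ --> X](row_mxKr x0 (0 : 'rV[R]_1)); exact: continuous_rsubmx.
    exact: cvg_row_mx cl cr.
  (* Conditions to be met at the preimage Q z: it lies where P represents Phi, and the bound on
     normal components applies to its position on the slice. *)
  pose W' := [set z | ball (at0 x0) e z /\
     `|P (slice_emb (drop z)) 0 (I b)| <= C * `|rcoord (drop z)| ^+ N].
  have nW' : nbhs (at0 x0) W'.
    by apply: filterI; [apply: open_nbhs_nbhs; split; [exact: ball_open|exact: ballxx]|exact: cdrop _ HC].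
  pose W := [set z | O z /\ `|mQ z| <= `|mQ (at0 x0)| + 1 /\ W' (Q z)].
  have nW : nbhs (at0 x0) W.
    by apply: filterI; [exact: open_nbhs_nbhs|apply: filterI => //; exact: cQ _ nW'].
  (* The height of Q z is t [mQ z] with |mQ z| <= |mQ(x0)| + 1, so C times its N-th power is at most
     this constant times t^N. *)
  exists (`|C| * (`|mQ (at0 x0)| + 1) ^+ N).
  apply: filterS (near_graph_point W nW) => -[x t] /= Hy _ t0.
  have [[bx t3] [Oz [mz [be HPz]]]] := Hy (ltW t0).
  have [_ fE _] := Hf x t bx t3.
  set z := graph_point x (f (x, t)) t in Oz mz be HPz fE.
  have rz : rcoord z = t by rewrite /rcoord /z /graph_point row_mxEr mxE.
  have lz : lsubmx z = row_mx x (f (x, t)) by exact: row_mxKl.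
  have rz0 : 0 <= rcoord z by rewrite rz ltW.
  have [Vz cPz Qz] := HQ z Oz rz0.
  have Sz : Sigma (Psi (xinv c z)).1.
    by apply/(onS z Oz rz0) => b'; rewrite lz row_mxKr rz; exact: fE.
  have [Uz Ez] := PhiK Vz.
  have QzS : rsubmx (lsubmx (Q z)) = 0.
    by rewrite Qz lsubmx_xmap; apply/(slc.2 _ cPz).
  have QzE : slice_emb (drop (Q z)) = Q z.
    by rewrite /slice_emb /drop row_mxKl row_mxKr -QzS !hsubmxK.
  have rQ : rcoord (Q z) = t * mQ z by rewrite [LHS]EQ// rz.
  have rQ0 : 0 <= rcoord (Q z) by rewrite Qz rcoord_xmap; exact: Ucollar.
  have [_ _ PQ] := HP (Q z) be rQ0.
  have PQz : P (Q z) = z.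
    rewrite PQ {1}Qz xmapK// Ez xinvK// lz; have := eQC _ (OB z Oz).
    by rewrite lz.
  have <- : z 0 (I b) = f (x, t) 0 b by rewrite /z /graph_point /I row_mxEl row_mxEr.
  rewrite QzE PQz in HPz; apply: le_trans HPz _.
  have -> : rcoord (drop (Q z)) = rcoord (Q z) by rewrite /drop {1}/rcoord row_mxEr mxE.
  have tN : 0 <= t ^+ N by rewrite exprn_ge0// ltW.
  rewrite rQ normrM gtr0_norm// exprMn.
  apply: (@le_trans _ _ (`|C| * (t ^+ N * `|mQ z| ^+ N))).
    by rewrite ler_wpM2r ?ler_norm// mulr_ge0// exprn_ge0.
  rewrite -mulrA ler_wpM2l// mulrC ler_wpM2r//.
  by rewrite lerXn2r ?nnegrE ?addr_ge0.
Qed.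

End Slices.
End Main.

Theorem theorem4p10 (R : realType) (k m : nat)
  (k_ge1 : (1 <= k)%N) (m_ge1 : (1 <= m)%N) (n_ge3 : (3 <= k + m)%N)
  (M : manifold R (k + m)) (g ghat : metric M) (lambda lambdahat : R)
  (omega : M -> R) (Sigma : set M)
  (eps0 : R) (U V : set (M * R)) (Phi : M * R -> M * R) :
  einstein g lambda ->
  smooth_fun omega ->
  conformal_change g ghat omega ->
  einstein ghat lambdahat ->
  embedded_submanifold Sigma ->
  minimal g Sigma ->
  minimal ghat Sigma ->
  0 < eps0 ->
  (forall r : R, 0 < r < eps0 -> 0 < 1 - 4^-1 * lambda * r ^+ 2) ->
  (forall r : R, 0 < r < eps0 -> 0 < 1 - 4^-1 * lambdahat * r ^+ 2) ->
  collar_nbhd eps0 U ->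
  collar_nbhd eps0 V ->
  diffeomorphism U V Phi ->
  (forall p : M, Phi (p, 0) = (p, 0)) ->
  pulls_back_to_infinite_order U Phi (poincare g lambda)
    (poincare ghat lambdahat) ->
  preserves_to_infinite_order Sigma U Phi.
Proof.
move=> eg somega conf eghat emb ming minh eps0_gt0 lam lamh cU cV [Psi [sPhi sPsi PsiK PhiK]] Phi0 isom.
move=> c slc p cp Sp.
exact: (image_graph k_ge1 ming minh eps0_gt0 cU cV sPhi sPsi PsiK PhiK Phi0 isom slc cp Sp).
Qed.
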